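(* Let $p\geq 5$ be prime, let $k\in 2\mathbb{Z}$, let $O_L$ be the ring of integers of a number field $L$, and let $f(z)=\sum_{n\gg-\infty}a_f(n)q^n\in M_k^{!}$ be a weakly holomorphic modular form of weight $k$ for $\mathrm{SL}_2(\mathbb{Z})$ all of whose Fourier coefficients $a_f(n)$ lie in $O_L$. (1) Suppose that $a\geq 0$ and $m\in\{4,6,8,10,14\}$ are integers for which $k-2\leq (m-2)p^a$. If $\mathrm{ord}_{\infty}(f)>-p^a$ and $(p-1)\mid (k-m)$, then for every integer $b\geq a$ we have $$a_f(p^b)\equiv -\frac{2m}{B_m}\,a_f(0)\pmod{p}.$$ (2) Suppose that $k\leq 2$, and that $r,s\in\mathbb{Z}_{\geq 0}$ and $t,u\in\mathbb{Z}_{>0}$ are integers for which $2-k=r(p-1)+sp^t$, where $s\neq 2$. If $\mathrm{ord}_{\infty}(f)>-p^u$ and $u\leq t$, then for every integer $v$ with $u\leq v\leq t$ we have $$a_f(p^v)\equiv a_f(0)\equiv 0\pmod{p}.$$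
   Context: Here $q:=e^{2\pi i z}$. For $k\in 2\mathbb{Z}$, $M_k^{!}$ denotes the space of weakly holomorphic modular forms of weight $k$ with respect to $\mathrm{SL}_2(\mathbb{Z})$, i.e. meromorphic modular forms of weight $k$ whose poles (if any) are supported at the cusp; each is identified with its Fourier expansion $\sum_{n\gg-\infty}a_f(n)q^n$ at infinity, and $\mathrm{ord}_{\infty}(f)$ is the smallest $n$ with $a_f(n)\neq 0$ (and $+\infty$ if $f=0$). The Bernoulli numbers $B_m$ are given by $\sum_{m=0}^{\infty}B_m\frac{t^m}{m!}=\frac{t}{e^t-1}$; for $m\in\{4,6,8,10,14\}$ the number $\frac{2m}{B_m}$ is an integer. Congruences modulo $p$ are in $O_L$, i.e. modulo the ideal $pO_L$. *)

(* Defs.v *)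
From HB Require Import structures.
From mathcomp Require Import all_boot all_order all_algebra all_field.
From mathcomp Require Import all_classical all_reals all_analysis.
From mathcomp Require Import complex.

Set Implicit Arguments.
Unset Strict Implicit.
Unset Printing Implicit Defensive.

Import Order.TTheory GRing.Theory Num.Theory.
Import numFieldNormedType.Exports.

Local Open Scope classical_set_scope.
Local Open Scope ring_scope.
Local Open Scope complex_scope.

(* The complex numbers are R[i] for an arbitrary R : realType. Topological
   notions are taken in R[i]^o, which carries the modulus norm; in particular
   [derivable f z 1] in R[i]^o is complex differentiability, the increment
   ranging over R[i]. *)

Definition upper_half_plane (R : realType) : set R[i] :=
  [set z | 0 < complex.Im z].

Definition cexp (R : realType) (z : R[i]) : R[i] :=
  (expR (complex.Re z))%:C
    * (cos (complex.Im z) +i* sin (complex.Im z)).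

Definition nome (R : realType) (z : R[i]) : R[i] :=
  cexp (2 * (pi : R)%:C * 'i%C * z).

Definition automorphy_factor (R : realType) (g : 'M[int]_2) (z : R[i]) : R[i] :=
  (g 1 0)%:~R * z + (g 1 1)%:~R.

Definition mobius (R : realType) (g : 'M[int]_2) (z : R[i]) : R[i] :=
  ((g 0 0)%:~R * z + (g 0 1)%:~R) / automorphy_factor g z.

Definition holomorphic_on_uhp (R : realType) (f : R[i] -> R[i]) : Prop :=
  forall z, upper_half_plane z -> derivable (f : R[i]^o -> R[i]^o) z 1.

Definition weight_invariant (R : realType) (k : int) (f : R[i] -> R[i]) : Prop :=
  forall g : 'M[int]_2, \det g = 1 -> forall z, upper_half_plane z ->
    f (mobius g z) = automorphy_factor g z ^ k * f z.

(* f(z) = \sum_{n >= -N} a(n) q^n on the upper half plane, for some N *)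
Definition fourier_expansion (R : realType) (f : R[i] -> R[i])
    (a : int -> R[i]) : Prop :=
  exists N : nat,
    (forall n : int, n < - N%:Z -> a n = 0) /\
    (forall z, upper_half_plane z ->
       series (fun j : nat => a (j%:Z - N%:Z) * nome z ^ (j%:Z - N%:Z)) @ \oo
         --> (f z : R[i]^o)).

(* Meromorphy at the cusp is the existence of a Fourier expansion with finite
   principal part. Values of f off the upper half plane are irrelevant. *)
Definition weakly_holomorphic (R : realType) (k : int) (f : R[i] -> R[i]) : Prop :=
  [/\ holomorphic_on_uhp f, weight_invariant k f
    & exists a, fourier_expansion f a].

(* The Fourier expansion is unique, so that for f weakly holomorphic the choice
   made by xget is immaterial. *)
Definition fourier_coef (R : realType) (f : R[i] -> R[i]) : int -> R[i] :=
  xget (fun=> 0) [set a | fourier_expansion f a].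

(* An infimum of integers in \bar R: it is the least index of a nonzero
   coefficient, and +oo when all the coefficients vanish. *)
Definition ord_infty (R : realType) (f : R[i] -> R[i]) : \bar R :=
  ereal_inf [set (n%:~R)%:E | n in [set n : int | fourier_coef f n != 0]].

(* The image in the complex numbers, under the embedding iota, of the ring of
   integers of the number field L *)
Definition ring_of_integers (R : realType) (L : fieldExtType rat)
    (iota : {rmorphism L -> R[i]}) : set R[i] :=
  iota @` [set x : L | integralOver (intr : int -> L) x].

(* x = y modulo the ideal p O *)
Definition congr_mod (R : realType) (O : set R[i]) (p : nat) (x y : R[i]) : Prop :=
  exists2 w, O w & x - y = p%:R * w.

(* The first n + 1 coefficients of the inverse of the formal power series
   \sum_i a(i) t^i *)
Fixpoint ps_inv_seq (a : nat -> rat) (n : nat) : seq rat :=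
  if n is m.+1 then
    let s := ps_inv_seq a m in
    rcons s (- (a 0)^-1 * \sum_(j < m.+1) s`_j * a (m.+1 - j)%N)
  else [:: (a 0)^-1].

Definition ps_inv (a : nat -> rat) (n : nat) : rat := (ps_inv_seq a n)`_n.

(* n! times the coefficient of t^n in t / (e^t - 1), the formal inverse of
   (e^t - 1) / t = \sum_i t^i / (i + 1)! *)
Definition bernoulli (n : nat) : rat :=
  n`!%:R * ps_inv (fun i => (i.+1`!%:R)^-1) n.

Lemma size_ps_inv_seq a n : size (ps_inv_seq a n) = n.+1.
Proof. by elim: n => //= n IHn; rewrite size_rcons IHn. Qed.

Lemma nth_ps_inv_seq a n j : (j <= n)%N -> (ps_inv_seq a n)`_j = ps_inv a j.
Proof.
elim: n => [|n IHn]; first by rewrite leqn0 => /eqP->.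
rewrite leq_eqVlt => /predU1P[-> //|lt_jn].
by rewrite /= nth_rcons size_ps_inv_seq lt_jn IHn.
Qed.

Lemma ps_invP (a : nat -> rat) (n : nat) : a 0 != 0 ->
  \sum_(j < n.+1) ps_inv a j * a (n - j)%N = (n == 0)%:R.
Proof.
move=> a0; case: n => [|n]; first by rewrite big_ord1 /ps_inv /= mulVf.
rewrite big_ord_recr /= subnn {2}/ps_inv /= nth_rcons size_ps_inv_seq ltnn eqxx.
rewrite mulNr mulNr mulrAC mulVf // mul1r; apply/eqP; rewrite subr_eq0; apply/eqP.
by apply: eq_bigr => j _; rewrite nth_ps_inv_seq // -ltnS.
Qed.

(* (\sum_i B_i t^i / i!) (e^t - 1) = t *)
Lemma bernoulli_egf (n : nat) :
  \sum_(i < n.+1) (bernoulli i / i`!%:R)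
    * (if (n - i)%N is 0 then 0 else ((n - i)`!%:R)^-1) = (n == 1)%:R.
Proof.
rewrite big_ord_recr /= subnn mulr0 addr0.
case: n => [|n]; first by rewrite big_ord0.
rewrite eqSS -(ps_invP (a := fun i => (i.+1`!%:R)^-1) n) ?invr1 ?oner_eq0 //.
apply: eq_bigr => i _; rewrite subSn; last by rewrite -ltnS.
congr (_ * _).
by rewrite /bernoulli mulrAC divff ?mul1r // pnatr_eq0 -lt0n fact_gt0.
Qed.

(* Main.v *)
(* The constant term of a weakly holomorphic form of weight 2 vanishes. Let E be
   a multiple of the Eisenstein series of weight p - 1 whose q-expansion is
   congruent modulo p to a constant prime to p, let g = E4^al E6^be Delta^-eps,
   and put P = p^b. The weights being matched, f E^j g^P has weight 2, so its
   constant term vanishes. Modulo p its q-expansion is proportional to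
   f(q) g(q^P); as ord f > -P, the vanishing reads a(0) = 0 for eps = 0, and
   a(P) + c a(0) = 0 for eps = 1, where g = q^-1 + c + O(q). In (1), the residue
   theorem for the weight 2 form E_m g identifies c with 2m / B_m.
   Modularity of E_k comes from the Lipschitz formula, the limit over division
   points of the distribution relation for \sum_d d^j q^d, summed over the rows
   of a lattice; that of Delta from the quasi-modularity of its logarithmic
   derivative E_2. *)

Require Import Defs.
From HB Require Import structures.
From mathcomp Require Import all_boot all_order all_algebra all_field.
From mathcomp Require Import all_classical all_reals all_analysis.
From mathcomp Require Import complex.
From mathcomp Require Import ring lra zify.

Set Implicit Arguments.
Unset Strict Implicit.
Unset Printing Implicit Defensive.

Import Order.TTheory GRing.Theory Num.Theory.
Import numFieldNormedType.Exports.

Local Open Scope classical_set_scope.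
Local Open Scope ring_scope.
Local Open Scope complex_scope.

(** * Complex limits and series *)

Section Modulus.
Variable R : realType.
Implicit Types x y z : R[i].

(** The exceptional values share one cause: a monomial E4^al E6^be exists in every nonnegative even
    weight except 2. In (1), g has weight 2 - m, so 14 - m must be the weight of such a monomial,
    which excludes m = 12; in (2), with eps = 0, g has weight s, which excludes s = 2. For eps = 1
    in (2) the weight to represent is s p^(t-v) + 12, and nothing is lost. The exponent j of E must
    be a nonnegative integer: P is 1 modulo p - 1, so integrality depends only on k modulo p - 1,
    and the bounds on k make j nonnegative. The condition p >= 5 puts the weight p - 1 in the range,
    at least 4, where the lattice sum of the Eisenstein series converges absolutely; that E reduces
    to a constant prime to p is von Staudt's theorem for B_(p-1), proved from the recursion of the
    Bernoulli numbers. On the analytic side every exchange of limits is dominated convergence for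
    series, with majorants that are products of two one-variable majorants. *)

Definition cabs z : R := Normc.normc z.

Lemma cabsM x y : cabs (x * y) = cabs x * cabs y.
Proof. exact: Normc.normcM. Qed.

Lemma cabsV x : cabs x^-1 = (cabs x)^-1.
Proof. exact: Normc.normcV. Qed.

Lemma cabs0 : cabs 0 = 0.
Proof. exact: Normc.normc0. Qed.

Lemma cabs1 : cabs 1 = 1.
Proof. exact: Normc.normc1. Qed.

Lemma cabsD x y : cabs (x + y) <= cabs x + cabs y.
Proof. exact: le_normcD. Qed.

Lemma cabsN x : cabs (- x) = cabs x.
Proof. exact: normcN. Qed.

Lemma cabsB x y : cabs (x - y) <= cabs x + cabs y.
Proof. by rewrite -(cabsN y); apply: cabsD. Qed.

Lemma cabsC x y : cabs (x - y) = cabs (y - x).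
Proof. by rewrite -cabsN opprB. Qed.

Lemma cabs_ge0 x : 0 <= cabs x.
Proof. by case: x => a b; apply: sqrtr_ge0. Qed.

Lemma cabs_eq0 x : (cabs x == 0) = (x == 0).
Proof.
by apply/eqP/eqP => [/Normc.eq0_normc //|->]; rewrite cabs0.
Qed.

Lemma cabs_gt0 x : (0 < cabs x) = (x != 0).
Proof. by rewrite lt_neqAle cabs_ge0 andbT eq_sym cabs_eq0. Qed.

Lemma cabsX x n : cabs (x ^+ n) = cabs x ^+ n.
Proof. by elim: n => [|n IH]; rewrite ?expr0 ?cabs1 // !exprS cabsM IH. Qed.

Lemma cabs_sum I (r : seq I) (P : pred I) (F : I -> R[i]) :
  cabs (\sum_(i <- r | P i) F i) <= \sum_(i <- r | P i) cabs (F i).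
Proof.
elim/big_rec2: _ => [|i y1 y2 _ le]; first by rewrite cabs0.
by apply: le_trans (cabsD _ _) _; rewrite lerD2l.
Qed.

Lemma cabsR (a : R) : cabs a%:C = `|a|.
Proof. by rewrite /cabs /= expr0n addr0 sqrtr_sqr. Qed.

Lemma cabs_sqr z : cabs z ^+ 2 = complex.Re z ^+ 2 + complex.Im z ^+ 2.
Proof. by case: z => a b; rewrite /cabs /= sqr_sqrtr // addr_ge0 ?sqr_ge0. Qed.

Lemma natC n : n%:R = (n%:R : R)%:C :> R[i].
Proof. by rewrite rmorph_nat. Qed.

Lemma cabs_nat n : cabs n%:R = n%:R.
Proof. by rewrite natC cabsR ger0_norm. Qed.

Lemma intC (n : int) : n%:~R = (n%:~R : R)%:C :> R[i].
Proof. by rewrite rmorph_int. Qed.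

Lemma cabs_int (n : int) : cabs n%:~R = `|n%:~R|.
Proof. by rewrite intC cabsR. Qed.

Lemma cabsi : cabs 'i%C = 1.
Proof. by rewrite /cabs /= expr0n add0r expr1n sqrtr1. Qed.

Lemma cabs_Re z : `|complex.Re z| <= cabs z.
Proof.
rewrite -(@ler_pXn2r _ 2) ?nnegrE ?cabs_ge0 //.
by rewrite cabs_sqr real_normK ?num_real // lerDl sqr_ge0.
Qed.

Lemma cabs_Im z : `|complex.Im z| <= cabs z.
Proof.
rewrite -(@ler_pXn2r _ 2) ?nnegrE ?cabs_ge0 //.
by rewrite cabs_sqr real_normK ?num_real // lerDr sqr_ge0.
Qed.

Lemma cabs_ReIm z : cabs z <= `|complex.Re z| + `|complex.Im z|.
Proof.
rewrite -(@ler_pXn2r _ 2) ?nnegrE ?cabs_ge0 ?addr_ge0 //.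
rewrite cabs_sqr sqrrD !real_normK ?num_real //.
by rewrite -addrA lerD2l lerDr mulrn_wge0 // mulr_ge0.
Qed.

Lemma cabs_subr_ge x y : cabs x - cabs y <= cabs (x - y).
Proof. by rewrite lerBlDr; apply: le_trans (cabsD _ _); rewrite subrK. Qed.

End Modulus.

Section Limits.
Variable R : realType.
Implicit Types (u v : nat -> R[i]) (l : R[i]).

(** Tolerances are real here, whereas the norm of [R[i]^o] takes its values in [R[i]]; [climP] leads
    back to the topology used in the statement. *)
Definition clim u l := forall e : R, 0 < e ->
  exists N, forall n, (N <= n)%N -> cabs (u n - l) <= e.

Lemma climP u l : clim u l <-> (u : nat -> R[i]^o) @ \oo --> (l : R[i]^o).
Proof.
split=> [ul|/cvgrPdist_le ul].
  apply/cvgrPdist_le => e e0.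
  (* Positivity in the partial order of [R[i]] forces a zero imaginary part, so a complex tolerance
     is a real one. *)
  have [eI eR] : complex.Im e = 0 /\ 0 < complex.Re e.
    by move: e0; rewrite ltcE /= => /andP[/eqP].
  have [N hN] := ul _ eR; exists N => // n /= /hN.
  rewrite cabsC -lecR => h.
  by rewrite (_ : e = (complex.Re e)%:C); [exact: h | case: (e) eI => ? ? /= ->].
move=> e e0; have /ul[N _ hN] : (0 : R[i]) < e%:C by rewrite ltcR.
by exists N => n /hN /=; rewrite cabsC -lecR.
Qed.

Lemma clim_unique u l l' : clim u l -> clim u l' -> l = l'.
Proof.
move=> /climP h /climP h'.
exact: (@cvg_unique (R[i]^o) (@norm_hausdorff _ _) _ _ _ _ h h').
Qed.

Lemma clim_cst l : clim (fun=> l) l.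
Proof. by move=> e e0; exists 0%N => n _; rewrite subrr cabs0 ltW. Qed.

Lemma climD u v l l' : clim u l -> clim v l' -> clim (fun n => u n + v n) (l + l').
Proof. by move=> /climP h /climP h'; apply/climP; exact: (cvgD h h'). Qed.

Lemma climM u v l l' : clim u l -> clim v l' -> clim (fun n => u n * v n) (l * l').
Proof. by move=> /climP h /climP h'; apply/climP; exact: (cvgM h h'). Qed.

Lemma climZ (c : R[i]) u l : clim u l -> clim (fun n => c * u n) (c * l).
Proof. by move=> h; apply: climM => //; apply: clim_cst. Qed.

Lemma climN u l : clim u l -> clim (fun n => - u n) (- l).
Proof. by move=> /climP h; apply/climP; exact: (cvgN h). Qed.

Lemma climB u v l l' : clim u l -> clim v l' -> clim (fun n => u n - v n) (l - l').
Proof. by move=> h h'; apply: climD => //; apply: climN. Qed.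

Lemma climV u l : l != 0 -> clim u l -> clim (fun n => (u n)^-1) (l^-1).
Proof. by move=> l0 /climP h; apply/climP; exact: (cvgV l0 h). Qed.

Lemma climX u l n : clim u l -> clim (fun j => u j ^+ n) (l ^+ n).
Proof.
move=> h; elim: n => [|n IH]; first exact: clim_cst.
rewrite exprS (_ : (fun _ => _) = (fun j => u j * u j ^+ n)); first exact: climM.
by apply: funext => j; rewrite exprS.
Qed.

Lemma clim_sum I (r : seq I) (F : nat -> I -> R[i]) (f : I -> R[i]) :
  (forall i, clim (F^~ i) (f i)) ->
  clim (fun n => \sum_(i <- r) F n i) (\sum_(i <- r) f i).
Proof.
move=> h; elim: r => [|i r IH].
  by rewrite big_nil (_ : (fun _ => _) = fun=> 0); [exact: clim_cst|apply: funext => n; rewrite big_nil].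
rewrite big_cons (_ : (fun _ => _) = (fun n => F n i + \sum_(j <- r) F n j)).
  exact: climD.
by apply: funext => n; rewrite big_cons.
Qed.

Lemma clim_near N u v l : (forall n, (N <= n)%N -> u n = v n) -> clim u l -> clim v l.
Proof.
move=> uv h e e0; have [M hM] := h _ e0; exists (maxn N M) => n.
by rewrite geq_max => /andP[nN nM]; rewrite -uv //; apply: hM.
Qed.

Lemma clim_eq u v l : u =1 v -> clim u l -> clim v l.
Proof. by move=> uv; apply: (@clim_near 0%N). Qed.

Lemma clim_sub (s : nat -> nat) u l : (forall n, (n <= s n)%N) ->
  clim u l -> clim (fun n => u (s n)) l.
Proof.
move=> hs h e e0; have [N hN] := h _ e0; exists N => n nN.
by apply: hN; apply: leq_trans nN _.
Qed.

Lemma clim_shift k u l : clim (fun n => u (n + k)%N) l -> clim u l.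
Proof.
move=> h e e0; have [N hN] := h _ e0; exists (N + k)%N => n nN.
by rewrite -(@subnK k n); [apply: hN|]; lia.
Qed.

Lemma clim_squeeze u l (b : nat -> R) :
  (forall e : R, 0 < e -> exists N, forall n, (N <= n)%N -> b n <= e) ->
  (exists N, forall n, (N <= n)%N -> cabs (u n - l) <= b n) -> clim u l.
Proof.
move=> hb [N hN] e e0; have [M hM] := hb _ e0; exists (maxn N M) => n.
by rewrite geq_max => /andP[nN nM]; apply: le_trans (hN _ nN) (hM _ nM).
Qed.

Lemma inv_small (c e : R) : 0 < e ->
  exists N, forall n, (N <= n)%N -> c / n.+1%:R <= e.
Proof.
move=> e0; exists (Num.bound (c / e)) => n nN.
rewrite ler_pdivrMr ?ltr0n // mulrC -ler_pdivrMr //.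
have [c0|c0] := leP 0 (c / e); last by apply: le_trans (ltW c0) _.
apply: ltW; apply: lt_le_trans (archi_boundP c0) _.
by rewrite ler_nat ltnW.
Qed.

Lemma clim_inv (c : R) u l : (exists N, forall n, (N <= n)%N -> cabs (u n - l) <= c / n.+1%:R) ->
  clim u l.
Proof. by apply: clim_squeeze => e; apply: inv_small. Qed.

Lemma clim_bounded u l (B : R) : (forall n, cabs (u n) <= B) -> clim u l -> cabs l <= B.
Proof.
move=> hB h; rewrite leNgt; apply/negP => hl.
have e0 : 0 < (cabs l - B) / 2 by rewrite divr_gt0 ?subr_gt0.
have [N /(_ N (leqnn _))] := h _ e0; rewrite cabsC => hN.
have := le_trans (cabs_subr_ge l (u N)) hN; have := hB N.
by move=> ??; lra.
Qed.

End Limits.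

Section Sums.
Variable R : realType.
Implicit Types (u v : nat -> R[i]) (s : R[i]) (b : nat -> R).

Definition has_sum u s := clim (fun n => \sum_(i < n) u i) s.

(** Bounded partial sums of nonnegative terms: a majorant never needs a named limit. *)
Definition rsummable b :=
  (forall i, 0 <= b i) /\ exists B, forall n, \sum_(i < n) b i <= B.

Lemma rsummable_tail b : rsummable b -> forall e : R, 0 < e ->
  exists N, forall n, \sum_(N <= i < n) b i <= e.
Proof.
case=> b0 [B hB] e e0.
have mono m n : (m <= n)%N -> \sum_(i < m) b i <= \sum_(i < n) b i.
  move=> mn; rewrite -!(big_mkord xpredT b) [leRHS](big_cat_nat (n := m)) //=.
  by rewrite lerDl sumr_ge0.
have sup1 : has_sup (range (fun n => \sum_(i < n) b i)).
  by split; [exists (\sum_(i < 0) b i), 0%N | exists B => _ [n _ <-]].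
have [_ [N _ <-] hN] := sup_adherent e0 sup1.
exists N => n; have [nN|Nn] := leqP n N; first by rewrite big_geq // ltW.
have /(sup_ubound (proj2 sup1)) : range (fun n => \sum_(i < n) b i) (\sum_(i < n) b i).
  by exists n.
rewrite -{1}(big_mkord xpredT b) (big_cat_nat (n := N)) ?(ltnW Nn) //= big_mkord.
move=> h; move: hN; set S := sup _; set A := \sum_(i < N) _; move=> hN.
rewrite -/S -/A in h hN.
lra.
Qed.

Lemma le_rsummable b b' : (forall i, 0 <= b' i) -> (forall i, b' i <= b i) ->
  rsummable b -> rsummable b'.
Proof.
move=> b'0 le [b0 [B hB]]; split=> //; exists B => n.
by apply: le_trans (hB n); apply: ler_sum.
Qed.

Lemma rsummableZ c b : 0 <= c -> rsummable b -> rsummable (fun i => c * b i).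
Proof.
move=> c0 [b0 [B hB]]; split; first by move=> i; rewrite mulr_ge0.
by exists (c * B) => n; rewrite -mulr_sumr ler_wpM2l.
Qed.

Lemma real_abs_cvg (a : nat -> R) b : rsummable b -> (forall i, `|a i| <= b i) ->
  exists l : R, forall e : R, 0 < e ->
    exists N, forall n, (N <= n)%N -> `|\sum_(i < n) a i - l| <= e.
Proof.
move=> [b0 [B hB]] ab.
have h : cvgn [normed series a].
  apply: nondecreasing_is_cvgn.
    move=> m n mn /=; rewrite /series /= [leRHS](big_cat_nat (n := m)) //=.
    by rewrite lerDl sumr_ge0.
  exists B => _ [n _ <-]; apply: le_trans (hB n).
  by rewrite /series /= -(big_mkord xpredT b); apply: ler_sum.
have /cvgrPdist_le {}h := normed_cvg h.
exists (limn (series a)) => e e0; have [N _ hN] := h _ e0.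
by exists N => n /hN /=; rewrite distrC -(big_mkord xpredT a).
Qed.

Lemma ReD (x y : R[i]) : complex.Re (x + y) = complex.Re x + complex.Re y.
Proof. by case: x; case: y. Qed.
Lemma ImD (x y : R[i]) : complex.Im (x + y) = complex.Im x + complex.Im y.
Proof. by case: x; case: y. Qed.
Lemma ReN (x : R[i]) : complex.Re (- x) = - complex.Re x.
Proof. by case: x. Qed.
Lemma ImN (x : R[i]) : complex.Im (- x) = - complex.Im x.
Proof. by case: x. Qed.

Lemma Re_sum n u : complex.Re (\sum_(i < n) u i) = \sum_(i < n) complex.Re (u i).
Proof. by elim/big_rec2: _ => // i x y _ <-; rewrite ReD. Qed.
Lemma Im_sum n u : complex.Im (\sum_(i < n) u i) = \sum_(i < n) complex.Im (u i).
Proof. by elim/big_rec2: _ => // i x y _ <-; rewrite ImD. Qed.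

Lemma has_sum_ex u b : rsummable b -> (forall i, cabs (u i) <= b i) ->
  exists s, has_sum u s.
Proof.
move=> hb ub.
have [x hx] := real_abs_cvg hb (fun i => le_trans (cabs_Re (u i)) (ub i)).
have [y hy] := real_abs_cvg hb (fun i => le_trans (cabs_Im (u i)) (ub i)).
exists (x +i* y) => e e0; have e20 : 0 < e / 2 by rewrite divr_gt0.
have [N hN] := hx _ e20; have [M hM] := hy _ e20.
exists (maxn N M) => n; rewrite geq_max => /andP[nN nM].
apply: le_trans (cabs_ReIm _) _.
rewrite ReD ImD ReN ImN Re_sum Im_sum /=.
have := hN _ nN; have := hM _ nM; lra.
Qed.

Lemma has_sum_bound u s b (B : R) : (forall i, cabs (u i) <= b i) ->
  (forall n, \sum_(i < n) b i <= B) -> has_sum u s -> cabs s <= B.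
Proof.
move=> ub hB; apply: clim_bounded => n; apply: le_trans (cabs_sum _ _ _) _.
by apply: le_trans (hB n); apply: ler_sum.
Qed.

Lemma has_sum_unique u s s' : has_sum u s -> has_sum u s' -> s = s'.
Proof. exact: clim_unique. Qed.

Lemma has_sum_eq u v s : u =1 v -> has_sum u s -> has_sum v s.
Proof. by move=> uv; apply: clim_eq => n; apply: eq_bigr => i _. Qed.

Lemma has_sumD u v s s' : has_sum u s -> has_sum v s' ->
  has_sum (fun i => u i + v i) (s + s').
Proof.
by move=> h h'; apply: clim_eq (climD h h') => n; rewrite big_split.
Qed.

Lemma has_sumZ c u s : has_sum u s -> has_sum (fun i => c * u i) (c * s).
Proof. by move=> h; apply: clim_eq (climZ c h) => n; rewrite mulr_sumr. Qed.

Lemma has_sumN u s : has_sum u s -> has_sum (fun i => - u i) (- s).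
Proof. by move=> h; apply: clim_eq (climN h) => n; rewrite sumrN. Qed.

Lemma has_sumB u v s s' : has_sum u s -> has_sum v s' ->
  has_sum (fun i => u i - v i) (s - s').
Proof. by move=> h h'; apply: has_sumD h _; apply: has_sumN. Qed.

Lemma has_sum0 : has_sum (fun=> 0) 0.
Proof. by apply: clim_eq (clim_cst _) => n; rewrite big1. Qed.

Lemma has_sum_sum I (r : seq I) (P : pred I) (F : I -> nat -> R[i]) (S : I -> R[i]) :
  (forall i, P i -> has_sum (F i) (S i)) ->
  has_sum (fun n => \sum_(i <- r | P i) F i n) (\sum_(i <- r | P i) S i).
Proof.
move=> h; elim: r => [|i r IH].
  rewrite big_nil; apply: has_sum_eq has_sum0 => n; by rewrite big_nil.
rewrite big_cons; case: ifP => Pi.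
  by apply: has_sum_eq (has_sumD (h _ Pi) IH) => n; rewrite big_cons Pi.
by apply: has_sum_eq IH => n; rewrite big_cons Pi.
Qed.

Lemma sum_fin (M : zmodType) (u : nat -> M) N n : (N <= n)%N ->
  (forall i, (N <= i)%N -> u i = 0) -> \sum_(i < n) u i = \sum_(i < N) u i.
Proof.
move=> Nn u0; rewrite -!(big_mkord xpredT u) (big_cat_nat (n := N)) //=.
rewrite [X in _ + X]big_nat [X in _ + X]big1 ?addr0 // => i /andP[h _]; exact: u0.
Qed.

Lemma has_sum_fin N u : (forall i, (N <= i)%N -> u i = 0) ->
  has_sum u (\sum_(i < N) u i).
Proof. move=> u0; apply: (@clim_near _ N _ _ _ _ (clim_cst _)) => n Nn.
by rewrite (sum_fin Nn u0). Qed.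

Lemma has_sum_recl u s : has_sum (fun i => u i.+1) s -> has_sum u (u 0%N + s).
Proof.
move=> h; apply: (@clim_shift _ 1%N).
apply: clim_eq (climD (clim_cst (u 0%N)) h) => n /=.
by rewrite addn1 big_ord_recl.
Qed.

(** Turns the bare convergence of a Fourier expansion at one point into a bound on its
    coefficients. *)
Lemma has_sum_bounded_terms u s : has_sum u s -> exists2 B : R, 0 <= B & forall i, cabs (u i) <= B.
Proof.
move=> h; have [N hN] := h 1 ltr01.
exists (2 + \sum_(i < N) cabs (u i)) => [|i].
  by rewrite addr_ge0 // sumr_ge0 // => i _; apply: cabs_ge0.
have [iN|Ni] := ltnP i N.
  apply: (@le_trans _ _ (\sum_(j < N) cabs (u j))); last by rewrite lerDr.
  rewrite (bigD1 (Ordinal iN)) //= lerDl sumr_ge0 // => j _; exact: cabs_ge0.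
apply: (@le_trans _ _ 2); last by rewrite lerDl sumr_ge0 // => j _; apply: cabs_ge0.
have := hN _ Ni; have := hN i.+1 (leqW Ni); rewrite big_ord_recr /=.
set S := \sum_(j < i) _ => h1 h2.
have -> : u i = (S + u i - s) - (S - s) by ring.
apply: le_trans (cabsB _ _) _; lra.
Qed.

(** Dominated convergence for series: the tails beyond some K are uniformly small, and the K first
    terms converge one by one. Domination is asked only from [N0] on because the bounds at division
    points hold only for large M. *)
Lemma tannery (F : nat -> nat -> R[i]) (S : nat -> R[i]) (f : nat -> R[i]) b N0 :
  rsummable b ->
  (forall N i, (N0 <= N)%N -> cabs (F N i) <= b i) ->
  (forall i, clim (F^~ i) (f i)) ->
  (forall N, has_sum (F N) (S N)) ->
  exists2 s, has_sum f s & clim S s.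
Proof.
move=> hb Fb Ff FS.
have fb i : cabs (f i) <= b i.
  apply: (@clim_bounded _ (fun N => F (N + N0)%N i)) => [N|].
    by apply: Fb; apply: leq_addl.
  by apply: (@clim_sub _ (fun n => n + N0)%N (F^~ i)) (Ff i) => n; apply: leq_addr.
have [s hs] := has_sum_ex hb fb; exists s => // e e0.
have e3 : 0 < e / 4 by rewrite divr_gt0.
have [K hK] := rsummable_tail hb e3.
have tail (g : nat -> R[i]) t : (forall i, cabs (g i) <= b i) -> has_sum g t ->
    cabs (t - \sum_(i < K) g i) <= e / 4.
  move=> gb gt; apply: (@clim_bounded _ (fun n => \sum_(i < n + K) g i - \sum_(i < K) g i)) => [n|].
    rewrite -!(big_mkord xpredT g) [X in X - _](big_cat_nat (n := K)) ?leq_addl //= addrAC subrr add0r.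
    by apply: le_trans (cabs_sum _ _ _) _; apply: le_trans (hK (n + K)%N); apply: ler_sum.
  apply: climB (clim_cst _).
  by apply: (@clim_sub _ (fun n => n + K)%N (fun n => \sum_(i < n) g i)) gt => n; apply: leq_addr.
have [M hM] := clim_sum (index_enum 'I_K) (fun i : 'I_K => Ff i) e3.
exists (maxn M N0) => n; rewrite geq_max => /andP[nM nN0].
have h1 := tail _ _ (fun i => Fb _ i nN0) (FS n).
have h2 := tail _ _ fb hs; have h3 := hM _ nM.
set A := \sum_(i < K) F n i in h1 h3; set B := \sum_(i < K) f i in h2 h3.
have -> : S n - s = (S n - A) + (A - B) - (s - B) by ring.
apply: le_trans (cabsB _ _) _.
have := cabsD (S n - A) (A - B); lra.
Qed.

End Sums.

(** * The exponential function and division points *)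

Section RealBounds.
Variable R : realType.
Implicit Types x y : R.

Lemma real_mvt (f df : R -> R) (a b : R) : a < b ->
  (forall x, is_derive x 1 f (df x)) ->
  exists2 c, a < c < b & f b - f a = df c * (b - a).
Proof.
move=> ab fd; have fc : {within `[a, b], continuous f}.
  by apply: derivable_within_continuous => x _; apply: ex_derive.
have [c cab ->] := MVT ab (fun x _ => fd x) fc.
by exists c => //; rewrite in_itv /= in cab.
Qed.

Lemma expR_sub1_le x : `|expR x - 1| <= `|x| * expR `|x|.
Proof.
have h y : expR y - 1 <= y * expR y.
  have := expR_ge1Dx (- y); rewrite expRN => /(ler_wpM2r (ltW (expR_gt0 y))).
  by rewrite mulVf ?gt_eqF ?expR_gt0 //; lra.
have [x0|x0] := leP 0 x.
  by rewrite (ger0_norm x0) ger0_norm ?h // subr_ge0 -expR0 ler_expR.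
have h1 : expR x < 1 by rewrite -expR0 ltr_expR.
rewrite (ltr0_norm x0) ltr0_norm ?subr_lt0 //; have := expR_ge1Dx x.
have : 1 <= expR (- x) by rewrite -expR0 ler_expR oppr_ge0 ltW.
nra.
Qed.

Lemma expR_sub1x_le x : `|expR x - 1 - x| <= x ^+ 2 * expR `|x|.
Proof.
have h y : expR y - 1 <= y * expR y.
  have := expR_ge1Dx (- y); rewrite expRN => /(ler_wpM2r (ltW (expR_gt0 y))).
  by rewrite mulVf ?gt_eqF ?expR_gt0 //; lra.
have h0 := expR_ge1Dx x.
rewrite ger0_norm; last by lra.
have [x0|x0] := leP 0 x.
  by rewrite (ger0_norm x0); have := h x; nra.
rewrite (ltr0_norm x0); have := h x.
have : 1 <= expR (- x) by rewrite -expR0 ler_expR oppr_ge0 ltW.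
nra.
Qed.

Lemma sin_le_id x : 0 <= x -> sin x <= x.
Proof.
rewrite le_eqVlt => /predU1P[<-|x0]; first by rewrite sin0.
have [c _] := real_mvt x0 (@is_derive_sin R).
rewrite sin0 !subr0 => ->; rewrite ger_pMl // cos_le1 //.
Qed.

Lemma normr_sin_le x : `|sin x| <= `|x|.
Proof.
wlog x0 : x / 0 <= x.
  move=> h; have [/h//|x0] := leP 0 x.
  by rewrite -(normrN x) -(normrN (sin x)) -sinN; apply: h; lra.
rewrite (ger0_norm x0) ler_norml sin_le_id // andbT lerNl -sinN.
have [c|] := leP x 0.
  by rewrite (_ : x = 0) ?oppr0 ?sin0 //; lra.
move=> /real_mvt /(_ (@is_derive_sin R)) [c _].
rewrite sin0 !subr0 sinN => ->; have := cos_geN1 c; nra.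
Qed.

Lemma one_sub_cos_le x : 1 - cos x <= x ^+ 2 / 2.
Proof.
have -> : cos x = 1 - 2 * sin (x / 2) ^+ 2.
  rewrite {1}(_ : x = (x / 2) *+ 2); last by rewrite mulr2n; lra.
  by rewrite cos_mulr2n cos2sin2 mulr2n; lra.
have : sin (x / 2) ^+ 2 <= (x / 2) ^+ 2.
  by rewrite -(real_normK (num_real (sin _))) -(real_normK (num_real (x / 2)))
     ler_pXn2r ?nnegrE // normr_sin_le.
rewrite exprMn expr2; lra.
Qed.

(** The exponent 2, short of the true 3, is all that [cexp_bound] needs. *)
Lemma sin_sub_id_le x : `|sin x - x| <= x ^+ 2.
Proof.
wlog x0 : x / 0 <= x.
  move=> h; have [/h//|x0] := leP 0 x.
  by rewrite -(normrN (sin x - x)) opprD -sinN -(sqrrN x); apply: h; lra.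
have sx := sin_le_id x0; rewrite ler0_norm ?subr_le0 // opprB.
have [c|] := leP x 0.
  by rewrite (_ : x = 0) ?sin0 ?subr0 ?sqr_ge0 //; lra.
move=> /real_mvt /(_ (@is_derive_sin R)) [c /andP[c0 cx]].
rewrite sin0 !subr0 => ->.
have : 1 - cos c <= c.
  have [c2|c2] := leP c 2; last by have := cos_geN1 c; lra.
  have := one_sub_cos_le c; nra.
nra.
Qed.

Lemma sin_ge_xcos x : 0 <= x -> x <= pi -> x * cos x <= sin x.
Proof.
move=> x0 xpi; have [h|] := leP x 0.
  by rewrite (_ : x = 0) ?mul0r ?sin0 //; lra.
pose f := fun t : R => sin t - t * cos t.
have fd (t : R) : is_derive t (1 : R) f (t * sin t).
  have h := is_deriveB (is_derive_sin t) (is_deriveM (is_derive_id t (1 : R)) (is_derive_cos t)).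
  apply: is_derive_eq h _.
  by rewrite /GRing.scale /= mulr1; ring.
move=> /real_mvt /(_ fd) [c /andP[c0 cx]].
rewrite /f sin0 mul0r !subr0 => h.
have s0 : 0 <= sin c by apply: sin_ge0_pi; apply/andP; split; lra.
have : 0 <= c * sin c * x by rewrite !mulr_ge0 // ltW.
lra.
Qed.

(** Halving the angle, sin x = 2 sin(x/2) cos(x/2) >= x cos(x/2)^2. The range 3 pi / 4 is what
    [torsion_bound] requires: |n| <= M/2 together with |Re z| <= M/4. *)
Lemma sin_lower x : 0 <= x -> x <= 3 * pi / 4 -> cos (3 * pi / 8) ^+ 2 * x <= sin x.
Proof.
move=> x0 x1; have p0 := pi_gt0 R.
have c0 : 0 < cos (3 * pi / 8 : R) by apply: cos_gt0_pihalf; apply/andP; split; lra.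
rewrite [in leRHS](_ : x = (x / 2) *+ 2); last by rewrite mulr2n; lra.
rewrite sin_mulr2n mulr2n.
have h1 : cos (3 * pi / 8) <= cos (x / 2).
  by rewrite leNgt ltr_cos ?in_itv /= -?leNgt; try (apply/andP; split); lra.
have h2 : x / 2 * cos (x / 2) <= sin (x / 2) by apply: sin_ge_xcos; lra.
have h3 : x / 2 * cos (x / 2) ^+ 2 <= cos (x / 2) * sin (x / 2).
  by rewrite expr2; nra.
have h4 : cos (3 * pi / 8) ^+ 2 <= cos (x / 2) ^+ 2 by nra.
nra.
Qed.

Lemma cos_3pi8_gt0 : 0 < cos (3 * pi / 8 : R).
Proof. by have p0 := pi_gt0 R; apply: cos_gt0_pihalf; apply/andP; split; lra. Qed.

End RealBounds.

Section Exponential.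
Variable R : realType.
Implicit Types (z w : R[i]) (x y : R).

Lemma cexpD z w : cexp (z + w) = cexp z * cexp w.
Proof.
case: z w => [a b] [c d]; rewrite /cexp /= expRD cosD sinD; simpc.
by congr (_ +i* _); ring.
Qed.

Lemma cexp0 : cexp 0 = 1 :> R[i].
Proof. by rewrite /cexp /= expR0 cos0 sin0 mul1r. Qed.

Lemma cabs_cis y : cabs (cos y +i* sin y) = 1.
Proof. by rewrite /cabs /= cos2Dsin2 sqrtr1. Qed.

Lemma cabs_cexp z : cabs (cexp z) = expR (complex.Re z).
Proof. by rewrite /cexp cabsM cabs_cis mulr1 cabsR ger0_norm ?expR_ge0. Qed.

Lemma cexp_bound w : cabs (cexp w - 1 - w) <= 3 * cabs w ^+ 2 * expR (cabs w).
Proof.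
have hx := cabs_Re w; have hs := cabs_sqr w.
case: w hx hs => x y; rewrite [complex.Re _]/= [complex.Im _]/= => hx hs.
(* With w = x + i y, each of the three summands is quadratic in (x, y). *)
rewrite (_ : _ - _ - _ =
    (expR x - 1 - x)%:C + (expR x)%:C * ((cos y - 1)%:C + 'i%C * (sin y - y)%:C)
    + 'i%C * (y * (expR x - 1))%:C); last first.
  by rewrite /cexp /=; simpc; congr (_ +i* _); ring.
set r := cabs _ in hx hs *.
have E : expR `|x| <= expR r by rewrite ler_expR.
have E' : expR x <= expR r by rewrite ler_expR; apply: le_trans (ler_norm _) _.
have r0 : 0 <= r := cabs_ge0 _.
apply: le_trans (cabsD _ _) _; apply: le_trans (lerD (cabsD _ _) (lexx _)) _.
rewrite !cabsM cabsi mul1r.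
have h1 : cabs ((cos y - 1)%:C + 'i%C * (sin y - y)%:C) <= y ^+ 2 / 2 + y ^+ 2.
  apply: le_trans (cabsD _ _) _; rewrite cabsM cabsi mul1r !cabsR.
  apply: lerD (sin_sub_id_le _).
  rewrite ler0_norm ?subr_le0 ?cos_le1 // opprB; exact: one_sub_cos_le.
rewrite !cabsR (ger0_norm (expR_ge0 x)) normrM.
have h2 := expR_sub1x_le x; have h3 := expR_sub1_le x.
have e0 := expR_ge0 x.
have h4 : expR x * cabs ((cos y - 1)%:C + 'i%C * (sin y - y)%:C) <=
    expR r * (3 / 2 * y ^+ 2).
  apply: ler_pM => //; first exact: cabs_ge0.
  by apply: le_trans h1 _; lra.
have h5 : `|expR x - 1 - x| <= expR r * x ^+ 2.
  by apply: le_trans h2 _; rewrite mulrC ler_wpM2r ?sqr_ge0.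
have h6 : `|y| * `|expR x - 1| <= expR r * (`|x| * `|y|).
  rewrite mulrC mulrA; apply: ler_wpM2r => //; apply: le_trans h3 _.
  by rewrite mulrC ler_wpM2r.
have h7 : `|x| * `|y| <= r ^+ 2.
  rewrite hs -(real_normK (num_real x)) -(real_normK (num_real y)).
  have := sqr_ge0 (`|x| - `|y|); have := normr_ge0 x; have := normr_ge0 y; nra.
have E0 := expR_ge0 r.
apply: le_trans (lerD (lerD h5 h4) h6) _.
rewrite -!mulrDr mulrC; apply: ler_wpM2r => //.
have := sqr_ge0 x; have := sqr_ge0 y; lra.
Qed.

Definition tau : R[i] := 0 +i* (2 * pi).

Lemma tauE : tau = 0 +i* (2 * pi).
Proof. by []. Qed.

Lemma nomeE z : nome z = cexp (tau * z).
Proof.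
have -> : tau = 2 * pi%:C * 'i%C by rewrite (natC R 2) /tau; simpc.
by [].
Qed.

Lemma tau_neq0 : tau != 0.
Proof. by rewrite tauE eq_complex /= negb_and mulf_neq0 ?orbT ?gt_eqF ?pi_gt0. Qed.

Lemma cabs_tau : cabs tau = 2 * pi.
Proof.
by rewrite tauE /cabs /= expr0n add0r sqrtr_sqr ger0_norm ?mulr_ge0 ?pi_ge0.
Qed.

Lemma nomeD z w : nome (z + w) = nome z * nome w.
Proof. by rewrite !nomeE mulrDr cexpD. Qed.

Lemma nome0 : nome 0 = 1 :> R[i].
Proof. by rewrite nomeE mulr0 cexp0. Qed.

Lemma cabs_nome z : cabs (nome z) = expR (- (2 * pi * complex.Im z)).
Proof. by rewrite nomeE cabs_cexp tauE; case: z => a b /=; congr expR; ring. Qed.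

Lemma nome_neq0 z : nome z != 0.
Proof. by rewrite -cabs_eq0 cabs_nome gt_eqF ?expR_gt0. Qed.

Lemma cabs_nome_lt1 z : 0 < complex.Im z -> cabs (nome z) < 1.
Proof.
move=> z0; rewrite cabs_nome -expR0 ltr_expR oppr_lt0.
by rewrite !mulr_gt0 ?pi_gt0.
Qed.

Lemma nome1 : nome 1 = 1 :> R[i].
Proof.
rewrite nomeE mulr1 tauE /cexp /= expR0 mul1r.
have -> : 2 * pi = (0 : R) + pi *+ 2 by rewrite mulr2n; ring.
by rewrite cosD2pi sinD2pi cos0 sin0.
Qed.

Lemma nome_half : nome 2^-1 = -1 :> R[i].
Proof.
have -> : 2^-1 = (2^-1)%:C :> R[i] by rewrite fmorphV rmorph_nat.
rewrite nomeE tauE (_ : _ * _ = 0 +i* pi); last first.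
  by simpc; congr (_ +i* _); field.
by rewrite /cexp /= expR0 cospi sinpi mul1r -[RHS]/(- 1 +i* - 0) oppr0.
Qed.

Lemma nomeN z : nome (- z) = (nome z)^-1.
Proof.
apply: (mulIf (nome_neq0 z)).
by rewrite -nomeD addNr nome0 mulVf ?nome_neq0.
Qed.

Lemma nome_nat n z : nome (n%:R * z) = nome z ^+ n.
Proof.
elim: n => [|n IH]; first by rewrite mul0r nome0.
by rewrite mulrS mulrDl mul1r nomeD IH exprS.
Qed.

Lemma nome_int (n : int) : nome n%:~R = 1 :> R[i].
Proof.
case: n => n; first by rewrite -[_%:~R](mulr1 n%:R) nome_nat nome1 expr1n.
rewrite NegzE mulrNz nomeN -[_%:~R](mulr1 n.+1%:R).
by rewrite nome_nat nome1 expr1n invr1.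
Qed.

Lemma nomeDint (n : int) z : nome (z + n%:~R) = nome z.
Proof. by rewrite nomeD nome_int mulr1. Qed.

Lemma nome_real x : nome x%:C = cos (2 * pi * x) +i* sin (2 * pi * x).
Proof. by rewrite nomeE tauE /cexp /=; rewrite !mul0r mulr0 subr0 expR0 mul1r add0r. Qed.

Lemma cabs_1subnome_real x : cabs (1 - nome x%:C) = 2 * `|sin (pi * x)|.
Proof.
rewrite nome_real (_ : 2 * pi * x = (pi * x) *+ 2); last by rewrite mulr2n; ring.
rewrite cos_mulr2n sin_mulr2n /cabs /=.
set c := cos _; set s := sin _.
have cs : c ^+ 2 = 1 - s ^+ 2 by rewrite -(cos2Dsin2 (pi * x)) -/c -/s; ring.
rewrite -(_ : (2 * s) ^+ 2 = (1 - (c ^+ 2 *+ 2 - 1)) ^+ 2 + (0 - (c * s *+ 2)) ^+ 2).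
  by rewrite sqrtr_sqr normrM ger0_norm.
rewrite (_ : (0 - _) ^+ 2 = 4 * c ^+ 2 * s ^+ 2); last by rewrite mulr2n; ring.
by rewrite cs mulr2n; ring.
Qed.

Lemma nome_polar z : nome z = (expR (- (2 * pi * complex.Im z)))%:C * nome (complex.Re z)%:C.
Proof.
by rewrite nome_real nomeE tauE; case: z => a b; rewrite /cexp /=;
   congr (_%:C * (cos _ +i* sin _)); [congr expR|..]; ring.
Qed.

(** Push q radially to the unit circle: the distance from 1 becomes 2 |sin(pi x)|, and the
    displacement 1 - |q| is itself at most |1 - q|. *)
Lemma one_sub_nome_ge z : 0 < complex.Im z -> `|sin (pi * complex.Re z)| <= cabs (1 - nome z).
Proof.
move=> z0; set r := expR (- (2 * pi * complex.Im z)).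
have r1 : r < 1 by have := cabs_nome_lt1 z0; rewrite cabs_nome.
set q1 := nome (complex.Re z)%:C.
have h1 : cabs q1 = 1 by rewrite /q1 nome_real cabs_cis.
have E : nome z = r%:C * q1 by exact: nome_polar.
have h2 : cabs (1 - q1) <= cabs (1 - nome z) + (1 - r).
  have -> : 1 - q1 = (1 - nome z) - (1 - r)%:C * q1.
    by rewrite E rmorphB rmorph1; ring.
  apply: le_trans (cabsB _ _) _; rewrite cabsM h1 mulr1 cabsR.
  by rewrite ger0_norm // subr_ge0 ltW.
have h3 : 1 - r <= cabs (1 - nome z).
  have := cabs_subr_ge 1 (nome z); rewrite cabs1 E cabsM h1 mulr1 cabsR.
  by rewrite ger0_norm ?expR_ge0.
rewrite cabs_1subnome_real in h2; lra.
Qed.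

Lemma sin_pi_lower x : `|x| <= 3 / 4 ->
  cos (3 * pi / 8) ^+ 2 * pi * `|x| <= `|sin (pi * x)|.
Proof.
have p0 := pi_gt0 R.
wlog x0 : x / 0 <= x => [h|].
  have [/h//|x0] := leP 0 x.
  rewrite -(normrN x) -(normrN (sin _)) -sinN -mulrN; apply: h; lra.
rewrite (ger0_norm x0) => x1; rewrite -mulrA.
apply: le_trans (ler_norm _); apply: sin_lower; nra.
Qed.

(* The domination needed to let M tend to infinity in [distribution]. *)
Lemma torsion_bound z : 0 < complex.Im z ->
  exists K : R, 0 < K /\ exists M0 : nat, forall (M : nat) (n : int),
    (M0 <= M)%N -> (0 < M)%N -> (2 * `|n| <= M)%N ->
    (1 + `|n|%N)%:R <= K * M%:R * cabs (1 - nome ((z + n%:~R) / M%:R)).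
Proof.
move=> z0; have p0 := pi_gt0 R; have c0 := cos_3pi8_gt0 R.
set x := complex.Re z; set y := complex.Im z in z0.
set c1 := 2 * pi * y / (1 + 2 * pi * y); set c2 : R := cos (3 * pi / 8) ^+ 2 * pi.
have y0 : 0 < 2 * pi * y by rewrite !mulr_gt0.
have c10 : 0 < c1 by rewrite divr_gt0 // addr_gt0.
have c20 : 0 < c2 by rewrite mulr_gt0 // exprn_gt0.
exists (c2^-1 + (`|x| + 1) / c1); split.
  by rewrite addr_gt0 ?invr_gt0 // divr_gt0 // ltr_wpDl.
(* From this M on, |x| <= M/4, so that |x + n| / M <= 3/4, the range of [sin_pi_lower]. *)
exists (Num.bound (4 * `|x|)) => M n hM M0 nM.
have Mp : 0 < M%:R :> R by rewrite ltr0n.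
have xM : 4 * `|x| <= M%:R.
  apply: ltW; apply: lt_le_trans (archi_boundP _) _; first by rewrite mulr_ge0.
  by rewrite ler_nat.
set w := (z + n%:~R) / M%:R.
have wE : w = ((x + n%:~R) / M%:R) +i* (y / M%:R).
  rewrite /w (natC R M) -fmorphV /= intC /x /y; case: (z) => a b /=.
  by simpc.
have w0 : 0 < complex.Im w by rewrite wE /= divr_gt0.
have nE : `|n%:~R| = `|n|%N%:R :> R by rewrite -intr_norm -abszE.
have hA : c2 * `|x + n%:~R| <= M%:R * cabs (1 - nome w).
  have h := one_sub_nome_ge w0; rewrite {1}wE [complex.Re _]/= in h.
  have h' : `|(x + n%:~R) / M%:R| <= 3 / 4.
    rewrite normrM [`|M%:R^-1|]ger0_norm ?invr_ge0 ?ler0n // ler_pdivrMr //.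
    apply: le_trans (ler_normD _ _) _; rewrite nE.
    have : 2 * (`|n|%N)%:R <= M%:R :> R by rewrite -natrM ler_nat.
    lra.
  have := le_trans (sin_pi_lower h') h; rewrite -/c2.
  rewrite normrM [`|M%:R^-1|]ger0_norm ?invr_ge0 ?ler0n //.
  by rewrite mulrA ler_pdivrMr // mulrC [_ * M%:R]mulrC.
(* For n near -x the previous bound is void; the height y / M of the point still gives a positive
   constant, which accounts for the summand 1 in [1 + |n|]. *)
have hB : c1 <= M%:R * cabs (1 - nome w).
  have := cabs_subr_ge 1 (nome w); rewrite cabs1 cabs_nome {1}wE [complex.Im _]/= => h.
  apply: (@le_trans _ _ (M%:R * (1 - expR (- (2 * pi * (y / M%:R)))))).
    set s := 2 * pi * (y / M%:R).
    have s0 : 0 < s by rewrite mulr_gt0 ?divr_gt0 // mulr_gt0.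
    have h1 : s / (1 + s) <= 1 - expR (- s).
      rewrite ler_pdivrMr ?addr_gt0 // expRN.
      have e1 := expR_ge1Dx s; have e0 := expR_gt0 s.
      rewrite mulrBl mul1r.
      suff : (expR s)^-1 * (1 + s) <= 1 by lra.
      by rewrite mulrC ler_pdivrMr // mul1r.
    apply: le_trans (ler_wpM2l (ltW Mp) h1).
    have -> : M%:R * (s / (1 + s)) = 2 * pi * y / (1 + s).
      by rewrite mulrA; congr (_ / _); rewrite /s; field; rewrite gt_eqF.
    rewrite /c1 ler_wpM2l ?(ltW y0) // lef_pV2 ?posrE ?addr_gt0 // lerD2l.
    rewrite /s mulrA ler_pdivrMr // ler_peMr ?(ltW y0) // ler1n //.
  by rewrite ler_wpM2l // ltW.
set X := M%:R * _ in hA hB; rewrite -mulrA -/X.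
have h1 : `|n|%N%:R <= `|x + n%:~R| + `|x|.
  by rewrite -nE -{1}[n%:~R](addKr x) addrC -(normrN x); apply: ler_normD.
have h2 : `|x + n%:~R| <= c2^-1 * X by rewrite mulrC ler_pdivlMr // mulrC.
have h3 : 1 <= c1^-1 * X by rewrite mulrC ler_pdivlMr // mul1r.
have h4 : `|x| + 1 <= (`|x| + 1) * (c1^-1 * X) by rewrite ler_peMr // addr_ge0.
rewrite natrD mulrDl -[(_ / c1) * X]mulrA; lra.
Qed.

End Exponential.

(** * Double series and sums over the integers *)

Section DoubleSums.
Variable R : realType.
Implicit Types (b : nat -> R).

(** By [tannery] each iterated sum is the limit of the sums over squares, and these do not depend on
    the order of summation. *)
Lemma swap_sums (a : nat -> nat -> R[i]) b b' (r c : nat -> R[i]) :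
  rsummable b -> rsummable b' -> (forall i j, cabs (a i j) <= b i * b' j) ->
  (forall i, has_sum (a i) (r i)) -> (forall j, has_sum (a^~ j) (c j)) ->
  exists2 s, has_sum r s & has_sum c s.
Proof.
move=> hb hb' ab ar ac.
have half (a' : nat -> nat -> R[i]) (d d' : nat -> R) (t : nat -> R[i]) :
    rsummable d -> rsummable d' -> (forall i j, cabs (a' i j) <= d i * d' j) ->
    (forall i, has_sum (a' i) (t i)) ->
    exists2 s, has_sum t s & clim (fun N => \sum_(i < N) \sum_(j < N) a' i j) s.
  move=> hd [d'0 [D hD]] ad at_.
  have D0 : 0 <= D by have := hD 0%N; rewrite big_ord0.
  apply: (@tannery _ (fun N i => if (i < N)%N then \sum_(j < N) a' i j else 0)
    (fun N => \sum_(i < N) \sum_(j < N) a' i j) t (fun i => D * d i) 0%N).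
  - exact: rsummableZ.
  - move=> N i _; case: ifP => _; last by rewrite cabs0 mulr_ge0 // (proj1 hd).
    apply: le_trans (cabs_sum _ _ _) _.
    apply: (@le_trans _ _ (\sum_(j < N) d i * d' j)); first by apply: ler_sum.
    by rewrite -mulr_sumr mulrC ler_wpM2r // (proj1 hd).
  - by move=> i; apply: (@clim_near _ i.+1) (at_ i) => N ->.
  - move=> N.
    rewrite (_ : \sum_(i < N) _ =
      \sum_(i < N) (if (i < N)%N then \sum_(j < N) a' i j else 0)); last first.
      by apply: eq_bigr => i _; rewrite ltn_ord.
    apply: (@has_sum_fin _ N (fun i => if (i < N)%N then \sum_(j < N) a' i j else 0)).
    by move=> i; rewrite leqNgt => /negbTE ->.
have [s hs1 hs2] := half a b b' r hb hb' ab ar.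
have [s' hs1' hs2'] := half (fun i j => a j i) b' b c hb' hb
  (fun i j => eq_ind _ (fun x => cabs (a j i) <= x) (ab j i) _ (mulrC _ _)) ac.
suff E : s = s' by exists s => //; rewrite E.
apply: clim_unique hs2 _; apply: clim_eq hs2' => N.
exact: exchange_big.
Qed.

(** Regroups a double series along the level sets of [phi], which are finite because [phi] bounds
    both indices. Addition gives Cauchy products, multiplication (shifted by one) gives Lambert
    series. *)
Lemma level_sums (phi : nat -> nat -> nat) (a : nat -> nat -> R[i]) b b' (r : nat -> R[i]) :
  (forall i j, (maxn i j <= phi i j)%N) ->
  rsummable b -> rsummable b' -> (forall i j, cabs (a i j) <= b i * b' j) ->
  (forall i, has_sum (a i) (r i)) ->
  exists2 s, has_sum r s &
    has_sum (fun n => \sum_(i < n.+1) \sum_(j < n.+1 | phi i j == n) a i j) s.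
Proof.
move=> hphi hb hb' ab ar.
have phii i j : (i <= phi i j)%N by apply: leq_trans (leq_maxl _ _) (hphi i j).
have phij i j : (j <= phi i j)%N by apply: leq_trans (leq_maxr _ _) (hphi i j).
have [b'0 [D hD]] := hb'.
have D0 : 0 <= D by have := hD 0%N; rewrite big_ord0.
pose F N i := \sum_(j < N | (phi i j < N)%N) a i j.
have FE N i : F N i = \sum_(j < N) (if (phi i j < N)%N then a i j else 0).
  by rewrite /F big_mkcond.
have Fr i : clim (F^~ i) (r i).
  have [||||s hs] := @tannery _ (fun N j => if (phi i j < N)%N then a i j else 0)
    (F^~ i) (a i) (fun j => b i * b' j) 0%N.
  - by apply: rsummableZ => //; apply: (proj1 hb).
  - move=> N j _; case: ifP => _ //; rewrite cabs0 mulr_ge0 //; exact: (proj1 hb).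
  - by move=> j; apply: (@clim_near _ (phi i j).+1) (clim_cst _) => N ->.
  - move=> N; rewrite FE.
    apply: (@has_sum_fin _ N (fun j => if (phi i j < N)%N then a i j else 0)) => j Nj.
    by rewrite ltnNge (leq_trans Nj (phij i j)).
  by rewrite (has_sum_unique hs (ar i)).
have [||||s hs1 hs2] := @tannery _ F (fun N => \sum_(i < N) F N i) r
    (fun i => D * b i) 0%N.
- exact: rsummableZ.
- move=> N i _; apply: le_trans (cabs_sum _ _ _) _.
  apply: (@le_trans _ _ (\sum_(j < N) b i * b' j)).
    rewrite big_mkcond; apply: ler_sum => j _; case: ifP => // _.
    by rewrite mulr_ge0 //; apply: (proj1 hb).
  by rewrite -mulr_sumr mulrC ler_wpM2r // (proj1 hb).
- exact: Fr.
- move=> N; apply: has_sum_fin => i Ni; rewrite /F big_pred0 // => j.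
  by rewrite ltnNge (leq_trans Ni (phii i j)).
exists s => //; apply: clim_eq hs2 => N.
transitivity (\sum_(n < N) \sum_(i < N) \sum_(j < N | phi i j == n) a i j).
  rewrite exchange_big; apply: eq_bigr => i _; rewrite /F.
  rewrite [RHS](exchange_big_dep xpredT) //= big_mkcond.
  apply: eq_bigr => j _; case: ifP => h.
    by rewrite (big_pred1 (Ordinal h)) // => n; rewrite -val_eqE /= eq_sym.
  by rewrite big_pred0 // => n; apply/eqP => E; rewrite E ltn_ord in h.
apply: eq_bigr => n _.
have lt : (n.+1 <= N)%N by [].
transitivity (\sum_(i < N) \sum_(j < n.+1 | phi i j == n) a i j).
  apply: eq_bigr => i _.
  rewrite big_mkcond [RHS]big_mkcond; apply: (@sum_fin _ (fun j => if phi i j == n then a i j else 0)) => // j.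
  by move=> h; case: eqP => // E; move: h; rewrite -E ltnNge phij.
apply: (@sum_fin _ (fun i : nat => \sum_(j < n.+1 | phi i j == n) a i j)) => // i h.
by rewrite big_pred0 // => j; apply/eqP => E; move: h; rewrite -E ltnNge phii.
Qed.

End DoubleSums.

Section TwoSided.
Variable R : realType.
Implicit Types (u v : int -> R[i]).

(** Pairing n with -n makes [zsum] a limit of symmetric partial sums, the only sense in which the
    cotangent series converges. *)
Definition zfold u (i : nat) : R[i] := if i is _.+1 then u i + u (- i%:Z) else u 0.

Definition zsum u s := has_sum (zfold u) s.

Definition bz (n : nat) : R := (n.+1%:R ^+ 2)^-1.

Lemma bz_ge0 n : 0 <= bz n.
Proof. by rewrite invr_ge0 exprn_ge0. Qed.

Lemma rsummable_bz : rsummable bz.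
Proof.
split; first exact: bz_ge0.
exists 2 => -[|n]; first by rewrite big_ord0.
suff : \sum_(i < n.+1) bz i <= 2 - n.+1%:R^-1.
  by move=> /le_trans; apply; rewrite gerBl invr_ge0.
elim: n => [|n IH]; first by rewrite big_ord1 /bz expr1n invr1; lra.
rewrite big_ord_recr /=; apply: le_trans (lerD IH (lexx _)) _.
have n0 : 0 <= n%:R :> R by [].
rewrite -addrA lerD2l /bz -[n.+2]addn2 -[n.+1]addn1 !natrD.
set x : R := n%:R in n0 *.
rewrite -subr_ge0.
have -> : - (x + 2)^-1 - (- (x + 1)^-1 + ((x + 2) ^+ 2)^-1) =
   ((x + 2) ^+ 2 * (x + 1))^-1.
  by field; rewrite !gt_eqF //; lra.
by rewrite invr_ge0 mulr_ge0 ?exprn_ge0 //; lra.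
Qed.

Lemma zfold_bound u (C : R) (b : nat -> R) : (forall n, cabs (u n) <= b `|n|%N) ->
  forall i, cabs (zfold u i) <= 2 * b i.
Proof.
move=> h [|i] /=.
  by have := h 0; rewrite absz0 => h0; have := le_trans (cabs_ge0 _) h0; lra.
have := cabsD (u i.+1) (u (- i.+1%:Z)); have := h i.+1; have := h (- i.+1%:Z).
rewrite abszN absz_nat; lra.
Qed.

Lemma zfoldD u v i : zfold (fun n => u n + v n) i = zfold u i + zfold v i.
Proof. by case: i => //= i; rewrite addrACA. Qed.

Lemma zfoldZ c u i : zfold (fun n => c * u n) i = c * zfold u i.
Proof. by case: i => //= i; rewrite mulrDr. Qed.

Lemma zfold_opp u i : zfold (fun n => u (- n)) i = zfold u i.
Proof. by case: i => [|i] /=; rewrite ?oppr0 // opprK addrC. Qed.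

Lemma zsum_eq u v s : u =1 v -> zsum u s -> zsum v s.
Proof. by move=> uv; apply: has_sum_eq => -[|i] /=; rewrite !uv. Qed.

Lemma zsumD u v s t : zsum u s -> zsum v t -> zsum (fun n => u n + v n) (s + t).
Proof. by move=> h h'; apply: has_sum_eq (has_sumD h h') => i; rewrite zfoldD. Qed.

Lemma zsumZ c u s : zsum u s -> zsum (fun n => c * u n) (c * s).
Proof. by move=> h; apply: has_sum_eq (has_sumZ c h) => i; rewrite zfoldZ. Qed.

Lemma zsumN u s : zsum u s -> zsum (fun n => - u n) (- s).
Proof.
move=> h; rewrite -mulN1r; apply: zsum_eq (zsumZ (-1) h) => n; by rewrite mulN1r.
Qed.

Lemma zsum_opp u s : zsum u s -> zsum (fun n => u (- n)) s.
Proof. by apply: has_sum_eq => i; rewrite zfold_opp. Qed.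

Lemma zsum_unique u s t : zsum u s -> zsum u t -> s = t.
Proof. exact: has_sum_unique. Qed.

Lemma zsum_ex u (C : R) : 0 <= C -> (forall n, cabs (u n) <= C * bz `|n|%N) ->
  exists s, zsum u s.
Proof.
move=> C0 h; apply: (@has_sum_ex _ _ (fun i => 2 * (C * bz i))).
  by do 2! [apply: rsummableZ => //]; apply: rsummable_bz.
by apply: (@zfold_bound _ 0 (fun i => C * bz i)).
Qed.

Lemma zsum_swap (a : int -> int -> R[i]) (C : R) (r c : int -> R[i]) : 0 <= C ->
  (forall m n, cabs (a m n) <= C * bz `|m|%N * bz `|n|%N) ->
  (forall m, zsum (a m) (r m)) -> (forall n, zsum (a^~ n) (c n)) ->
  exists2 s, zsum r s & zsum c s.
Proof.
move=> C0 h ar ac.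
apply: (@swap_sums _ (fun i j => zfold (fun m => zfold (a m) j) i)
  (fun i => 2 * (2 * C) * bz i) bz).
- by apply: rsummableZ; [rewrite !mulr_ge0|apply: rsummable_bz].
- exact: rsummable_bz.
- move=> i j.
  apply: le_trans (@zfold_bound (fun m => zfold (a m) j) 0 (fun i => 2 * (C * bz i * bz j)) _ i) _.
    by move=> m; apply: (@zfold_bound _ 0 (fun j => C * bz `|m|%N * bz j)) => n; apply: h.
  by rewrite le_eqVlt; apply/orP; left; apply/eqP; ring.
- case=> [|i] /=; first exact: ar.
  by apply: has_sum_eq (has_sumD (ar i.+1) (ar (- i.+1%:Z))) => j.
- move=> j; have hc : has_sum (fun i => zfold (fun n => zfold (a^~ n) i) j) (zfold c j).
    case: j => [|j] /=; first exact: ac.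
    by apply: has_sum_eq (has_sumD (ac j.+1) (ac (- j.+1%:Z))) => i.
  by apply: has_sum_eq hc => i; case: i => [|i]; case: j => [|j] //=; rewrite addrACA.
Qed.

End TwoSided.

(** * Power series on the open unit disc *)

Definition cprod (K : pzSemiRingType) (a b : nat -> K) (n : nat) : K :=
  \sum_(i < n.+1) a i * b (n - i)%N.

Section PowerSeries.
Variable R : realType.
Implicit Types (a b : nat -> R[i]) (q : R[i]) (r s : R).

Lemma geo_sum_le s n : 0 <= s -> s < 1 -> \sum_(i < n) s ^+ i <= (1 - s)^-1.
Proof.
move=> s0 s1; rewrite -[leRHS]mul1r ler_pdivlMr ?subr_gt0 //.
rewrite mulrC -(opprB s 1) mulNr -subrX1 opprB.
by rewrite gerBl exprn_ge0.
Qed.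

Lemma rsummable_geo s : 0 <= s -> s < 1 -> rsummable (fun n => s ^+ n).
Proof.
move=> s0 s1; split=> [i|]; first exact: exprn_ge0.
by exists (1 - s)^-1 => n; apply: geo_sum_le.
Qed.

Lemma succ_geo_le s n : 0 <= s -> s < 1 -> n.+1%:R * s ^+ n <= (1 - s)^-1.
Proof.
move=> s0 s1; apply: le_trans (geo_sum_le n.+1 s0 s1).
rewrite -[n.+1 in X in X%:R * _]card_ord mulr_natl -sumr_const.
by apply: ler_sum => i _; rewrite ler_wiXn2l // ?ltW // -ltnS.
Qed.

(** Radius of convergence at least 1. Boundedness at every r < 1 is enough, since passing from r to
    a larger radius gains a geometric factor; that factor absorbs the polynomial losses of products
    and derivatives. *)
Definition conv a := forall r, 0 < r -> r < 1 ->
  exists2 C, 0 <= C & forall n, cabs (a n) * r ^+ n <= C.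

Lemma conv_geo a r : 0 < r -> r < 1 -> conv a ->
  exists2 C, 0 <= C & exists s, [/\ 0 <= s, s < 1 &
    forall n, cabs (a n) * r ^+ n <= C * s ^+ n].
Proof.
move=> r0 r1 ca; set t := (1 + r) / 2.
have t0 : 0 < t by rewrite /t; lra.
have t1 : t < 1 by rewrite /t; lra.
have [C C0 hC] := ca _ t0 t1; exists C => //; exists (r / t); split.
- by rewrite divr_ge0 ?ltW.
- by rewrite ltr_pdivrMr // mul1r /t; lra.
move=> n; rewrite expr_div_n mulrA ler_pdivlMr ?exprn_gt0 //.
by rewrite mulrAC; apply: ler_wpM2r; [by rewrite exprn_ge0 // ltW|exact: hC].
Qed.

Lemma conv_rsummable a r : 0 <= r -> r < 1 -> conv a ->
  rsummable (fun n => cabs (a n) * r ^+ n).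
Proof.
move=> r0 r1 ca; set t := (1 + r) / 2.
have t0 : 0 < t by rewrite /t; lra.
have t1 : t < 1 by rewrite /t; lra.
have [C C0 [s [s0 s1 hs]]] := conv_geo t0 t1 ca.
apply: (@le_rsummable _ (fun n => C * s ^+ n)).
- by move=> n; rewrite mulr_ge0 ?cabs_ge0 ?exprn_ge0.
- move=> n; apply: le_trans (hs n); apply: ler_wpM2l; first exact: cabs_ge0.
  by apply: lerXn2r; rewrite ?nnegrE ?(ltW t0) // /t; lra.
- by apply: rsummableZ => //; apply: rsummable_geo.
Qed.

Lemma conv_le a b : (forall n, cabs (b n) <= cabs (a n)) -> conv a -> conv b.
Proof.
move=> le ca r r0 r1; have [C C0 hC] := ca r r0 r1; exists C => // n.
by apply: le_trans (hC n); rewrite ler_wpM2r // exprn_ge0 // ltW.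
Qed.

Lemma conv_eq a b : a =1 b -> conv a -> conv b.
Proof. by move=> ab; apply: conv_le => n; rewrite ab. Qed.

Lemma conv_bounded a (B : R) : 0 <= B -> (forall n, cabs (a n) <= B) -> conv a.
Proof.
move=> B0 h r r0 r1; exists B => // n; apply: le_trans (h n).
by rewrite ler_piMr ?cabs_ge0 // exprn_ile1 // ltW.
Qed.

Lemma convD a b : conv a -> conv b -> conv (fun n => a n + b n).
Proof.
move=> ca cb r r0 r1; have [C C0 hC] := ca r r0 r1; have [D D0 hD] := cb r r0 r1.
exists (C + D) => [|n]; first exact: addr_ge0.
apply: le_trans (lerD (hC n) (hD n)); rewrite -mulrDl ler_wpM2r ?cabsD //.
by rewrite exprn_ge0 // ltW.
Qed.

Lemma convZ c a : conv a -> conv (fun n => c * a n).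
Proof.
move=> ca r r0 r1; have [C C0 hC] := ca r r0 r1.
exists (cabs c * C) => [|n]; first by rewrite mulr_ge0 ?cabs_ge0.
by rewrite cabsM -mulrA ler_wpM2l ?cabs_ge0.
Qed.

Lemma conv_der a : conv a -> conv (fun n => n%:R * a n).
Proof.
move=> ca r r0 r1; have [C C0 [s [s0 s1 hs]]] := conv_geo r0 r1 ca.
exists (C * (1 - s)^-1) => [|n].
  by rewrite mulr_ge0 // invr_ge0 subr_ge0 ltW.
rewrite cabsM cabs_nat -mulrA.
apply: (@le_trans _ _ (n.+1%:R * (C * s ^+ n))).
  apply: ler_pM => //; first by rewrite mulr_ge0 ?cabs_ge0 // exprn_ge0 // ltW.
  by rewrite ler_nat.
by rewrite mulrCA; apply: ler_wpM2l => //; apply: succ_geo_le.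
Qed.

Lemma conv_natX k : conv (fun n => n%:R ^+ k).
Proof.
elim: k => [|k IH]; first by apply: (@conv_bounded _ 1) => // n; rewrite expr0 cabs1.
by apply: conv_eq (conv_der IH) => n; rewrite exprS.
Qed.

Lemma conv_cprod a b : conv a -> conv b -> conv (cprod a b).
Proof.
move=> ca cb r r0 r1.
have t0 : 0 < (1 + r) / 2 by lra.
have t1 : (1 + r) / 2 < 1 by lra.
set t := (1 + r) / 2 in t0 t1.
have [C C0 hC] := ca t t0 t1; have [D D0 hD] := cb t t0 t1.
set s := r / t; have s0 : 0 <= s by rewrite divr_ge0 // ltW.
have s1 : s < 1 by rewrite ltr_pdivrMr // mul1r /t; lra.
exists (C * D * (1 - s)^-1) => [|n].
  by rewrite !mulr_ge0 // invr_ge0 subr_ge0 ltW.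
have -> : r ^+ n = t ^+ n * s ^+ n by rewrite -exprMn mulrC divfK // gt_eqF.
apply: (@le_trans _ _ ((n.+1%:R * (C * D)) * s ^+ n)); last first.
  rewrite mulrAC [leLHS]mulrC; apply: ler_wpM2l; first exact: mulr_ge0.
  exact: succ_geo_le.
rewrite mulrA ler_wpM2r ?exprn_ge0 //.
apply: le_trans (ler_wpM2r _ (cabs_sum _ _ _)) _; first by rewrite exprn_ge0 // ltW.
rewrite mulr_suml -[n.+1 in leRHS]card_ord mulr_natl -sumr_const.
apply: ler_sum => i _; rewrite cabsM.
have -> : t ^+ n = t ^+ i * t ^+ (n - i) by rewrite -exprD subnKC // -ltnS.
rewrite mulrACA; apply: ler_pM => //; rewrite mulr_ge0 ?cabs_ge0 // exprn_ge0 // ltW //.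
Qed.

(** A total sum, with value 0 when the series diverges; for power series [psumP] gives it its
    meaning under [conv] and |q| < 1. *)
Definition csum (u : nat -> R[i]) : R[i] := xget 0 [set s | has_sum u s].

Lemma csumP (u : nat -> R[i]) (s : R[i]) : has_sum u s -> csum u = s.
Proof.
move=> h; have : has_sum u (csum u) by rewrite /csum; apply: xgetPex; exists s.
by move=> /has_sum_unique /(_ h).
Qed.

Definition psum a q := csum (fun n => a n * q ^+ n).

Lemma psum_bound a q n : cabs (a n * q ^+ n) <= cabs (a n) * cabs q ^+ n.
Proof. by rewrite cabsM cabsX. Qed.

Lemma psumP a q : conv a -> cabs q < 1 -> has_sum (fun n => a n * q ^+ n) (psum a q).
Proof.
move=> ca q1.
have [s hs] := has_sum_ex (conv_rsummable (cabs_ge0 q) q1 ca) (psum_bound a q).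
by rewrite /psum (csumP hs).
Qed.

Lemma psumE a q (s : R[i]) : has_sum (fun n => a n * q ^+ n) s -> psum a q = s.
Proof. exact: csumP. Qed.

Lemma psum_eq a b q : a =1 b -> psum a q = psum b q.
Proof. by move=> ab; congr csum; apply: funext => n; rewrite ab. Qed.

Lemma psumD a b q : conv a -> conv b -> cabs q < 1 ->
  psum (fun n => a n + b n) q = psum a q + psum b q.
Proof.
move=> ca cb q1; apply: psumE.
by apply: has_sum_eq (has_sumD (psumP ca q1) (psumP cb q1)) => n; rewrite mulrDl.
Qed.

Lemma psumZ c a q : conv a -> cabs q < 1 ->
  psum (fun n => c * a n) q = c * psum a q.
Proof.
move=> ca q1; apply: psumE.
by apply: has_sum_eq (has_sumZ c (psumP ca q1)) => n; rewrite mulrA.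
Qed.

Lemma psumM a b q : conv a -> conv b -> cabs q < 1 ->
  psum (cprod a b) q = psum a q * psum b q.
Proof.
move=> ca cb q1; apply: psumE.
have [|||||s hs1 hs2] := @level_sums _ addn (fun i j => (a i * q ^+ i) * (b j * q ^+ j))
  (fun n => cabs (a n) * cabs q ^+ n) (fun n => cabs (b n) * cabs q ^+ n)
  (fun i => a i * q ^+ i * psum b q).
- by move=> i j; rewrite geq_max leq_addr leq_addl.
- by apply: conv_rsummable => //; apply: cabs_ge0.
- by apply: conv_rsummable => //; apply: cabs_ge0.
- by move=> i j; rewrite cabsM !cabsM !cabsX.
- by move=> i; apply: has_sumZ; apply: psumP.
have -> : psum a q * psum b q = s.
  apply: has_sum_unique hs1; rewrite mulrC.
  by apply: has_sum_eq (has_sumZ _ (psumP ca q1)) => n; rewrite mulrC.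
apply: has_sum_eq hs2 => n; rewrite /cprod mulr_suml; apply: eq_bigr => i _.
have lt : (n - i < n.+1)%N by rewrite ltnS leq_subr.
rewrite (big_pred1 (Ordinal lt)) /=.
  by rewrite mulrACA -exprD subnKC // -ltnS.
move=> j /=; rewrite -val_eqE /=; have := ltn_ord i; have := ltn_ord j; lia.
Qed.

End PowerSeries.

(** * The Lipschitz formula *)

Section Lipschitz.
Variable R : realType.
Implicit Types (q z w : R[i]).

(* [polylog j] is the polynomial Q with \sum_d d^j q^d = Q(1 / (1 - q)). *)
Fixpoint polylog_seq (n : nat) : seq {poly R[i]} :=
  if n is m.+1 then
    let s := polylog_seq m in
    rcons s (('X - 1) * \sum_(i < m.+1) 'C(m.+1, i)%:R *: s`_i)
  else [:: 'X].

Definition polylog n := (polylog_seq n)`_n.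

Lemma size_polylog_seq n : size (polylog_seq n) = n.+1.
Proof. by elim: n => //= n IHn; rewrite size_rcons IHn. Qed.

Lemma nth_polylog_seq n j : (j <= n)%N -> (polylog_seq n)`_j = polylog j.
Proof.
elim: n => [|n IHn]; first by rewrite leqn0 => /eqP->.
rewrite leq_eqVlt => /predU1P[-> //|lt_jn].
by rewrite /= nth_rcons size_polylog_seq lt_jn IHn.
Qed.

Lemma polylog0 : polylog 0 = 'X.
Proof. by []. Qed.

Lemma polylogS n : polylog n.+1 = ('X - 1) * \sum_(i < n.+1) 'C(n.+1, i)%:R *: polylog i.
Proof.
rewrite {1}/polylog /= nth_rcons size_polylog_seq ltnn eqxx; congr (_ * _).
by apply: eq_bigr => i _; rewrite nth_polylog_seq // -ltnS.
Qed.

Lemma size_polylog n : (size (polylog n) <= n.+2)%N.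
Proof.
elim/ltn_ind: n => -[|n] IH; first by rewrite polylog0 size_polyX.
rewrite polylogS; apply: leq_trans (size_polyMleq _ _) _.
rewrite -polyC1 size_XsubC /= ltnS; apply: leq_trans (size_sum _ _ _) _.
apply/bigmax_leqP => i _; apply: leq_trans (size_scale_leq _ _) _.
by apply: leq_trans (IH i (ltn_ord i)) _; rewrite !ltnS -ltnS.
Qed.

Lemma lead_polylog n : (polylog n)`_n.+1 = n`!%:R.
Proof.
elim: n => [|n IH]; first by rewrite polylog0 coefX.
rewrite polylogS mulrBl mul1r coefB coefXM /= !coef_sum.
rewrite [X in _ - X]big1 => [|i _]; last first.
  rewrite coefZ nth_default ?mulr0 //; apply: leq_trans (size_polylog _) _.
  by rewrite !ltnS -ltnS.
rewrite subr0 big_ord_recr /= big1 => [|i _]; last first.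
  rewrite coefZ nth_default ?mulr0 //; apply: leq_trans (size_polylog _) _.
  by rewrite !ltnS.
by rewrite add0r coefZ IH binSn factS natrM.
Qed.

Definition npow (j d : nat) : R[i] := d%:R ^+ j.

Lemma conv_npow j : conv (npow j).
Proof. exact: conv_natX. Qed.

(** Shifting d and expanding (d + 1)^j gives S_j = [j = 0] + q sum_(i <= j) C(j,i) S_i. Solved for
    S_j, with x = 1 / (1 - q) and q x = x - 1, this is the recursion [polylogS]. The term d = 0
    counts for j = 0, as 0^0 = 1. *)
Lemma psum_npow j q : cabs q < 1 ->
  psum (npow j) q = (polylog j).[(1 - q)^-1].
Proof.
move=> q1.
have q0 : 1 - q != 0.
  by apply/eqP => /eqP; rewrite subr_eq0 => /eqP E; rewrite -E cabs1 ltxx in q1.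
have rec k : psum (npow k) q =
    (k == 0%N)%:R + q * \sum_(i < k.+1) 'C(k, i)%:R * psum (npow i) q.
  apply: psumE.
  have h0 : npow k 0 * q ^+ 0 = (k == 0%N)%:R.
    by rewrite /npow mulr1 expr0n.
  rewrite -h0; apply: (@has_sum_recl _ (fun n => npow k n * q ^+ n)).
  have h := has_sumZ q (@has_sum_sum _ _ (index_enum 'I_k.+1) xpredT
    (fun (i : 'I_k.+1) n => 'C(k, i)%:R * (npow i n * q ^+ n)) _
    (fun i _ => has_sumZ 'C(k, i)%:R (psumP (conv_npow i) q1))).
  apply: has_sum_eq h => n.
  rewrite /npow -nat1r exprDn mulr_sumr mulr_suml; apply: eq_bigr => i _.
  by rewrite expr1n mul1r exprS -mulr_natl; ring.
elim/ltn_ind: j => j IH; apply: (mulfI q0).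
have -> : (1 - q) * psum (npow j) q =
    (j == 0%N)%:R + q * \sum_(i < j) 'C(j, i)%:R * psum (npow i) q.
  rewrite mulrBl mul1r {1}rec big_ord_recr /= binn mul1r mulrDr; ring.
case: j IH => [|j] IH; first by rewrite big_ord0 mulr0 addr0 polylog0 hornerX mulfV.
rewrite add0r polylogS hornerM hornerD hornerN hornerC hornerX horner_sum.
rewrite mulrA; congr (_ * _); first by rewrite mulrBr mulr1 mulfV //; ring.
by apply: eq_bigr => i _; rewrite hornerZ IH.
Qed.

Lemma has_sum_stretch (u : nat -> R[i]) s M : (0 < M)%N -> has_sum u s ->
  has_sum (fun d => if (M %| d)%N then u (d %/ M)%N else 0) s.
Proof.
move=> M0 h.
have E n : \sum_(d < n) (if (M %| d)%N then u (d %/ M)%N else 0) =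
    \sum_(i < (n + M.-1) %/ M) u i.
  elim: n => [|n IH]; first by rewrite big_ord0 add0n divn_small ?big_ord0 ?prednK.
  rewrite big_ord_recr /= IH; case: ifP => [/dvdnP[c ->]|nd].
    have -> : ((c * M).+1 + M.-1 = c.+1 * M)%N by rewrite mulSn; lia.
    rewrite !mulnK // divnMDl // [(M.-1 %/ M)%N]divn_small ?prednK // addn0.
    by rewrite big_ord_recr.
  rewrite addr0; suff -> : ((n + M.-1) %/ M = (n.+1 + M.-1) %/ M)%N by [].
  rewrite (divn_eq n M); have := ltn_pmod n M0.
  have : (0 < n %% M)%N by rewrite lt0n; apply: contraFN nd.
  set a := (n %/ M)%N; set b := (n %% M)%N => b0 bM.
  have -> : (a * M + b + M.-1 = a.+1 * M + b.-1)%N by rewrite mulSn; lia.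
  have -> : ((a * M + b).+1 + M.-1 = a.+1 * M + b)%N by rewrite mulSn; lia.
  by rewrite !divnMDl // !divn_small //; lia.
move=> e e0; have [N hN] := h e e0; exists (N * M)%N => n hn; rewrite E; apply: hN.
by rewrite leq_divRL //; lia.
Qed.

(** Orthogonality of the M-th roots of unity. M is odd so that -h, ..., h is a symmetric system of
    residues, as [zfold] requires. *)
Lemma zfold_roots (h d : nat) : let M := h.*2.+1 in
  \sum_(i < h.+1) zfold (fun n => nome (d%:R * n%:~R / M%:R) : R[i]) i =
  if (M %| d)%N then M%:R else 0.
Proof.
move=> M; have M0 : M%:R != 0 :> R[i] by rewrite pnatr_eq0.
set w : R[i] := nome (d%:R / M%:R).
have wn (n : nat) : nome (d%:R * n%:~R / M%:R) = w ^+ n :> R[i].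
  by rewrite -nome_nat; congr nome; rewrite mulrCA mulrA.
have wN (n : nat) : nome (d%:R * (- n%:Z)%:~R / M%:R) = w ^- n :> R[i].
  by rewrite mulrNz mulrN mulNr nomeN wn.
have w0 : w != 0 := nome_neq0 _.
have wM : w ^+ M = 1.
  by rewrite -nome_nat mulrCA mulfV // mulr1; apply: (nome_int R d).
case: ifP => [/dvdnP[c cd]|nd].
  have w1 : w = 1 by rewrite /w cd natrM mulfK //; apply: (nome_int R c).
  have E i : zfold (fun n => nome (d%:R * n%:~R / M%:R) : R[i]) i = if i is _.+1 then 2 else 1.
    by case: i => [|i]; rewrite [LHS]/= ?wN wn w1 ?expr1n ?invr1.
  rewrite (eq_bigr (fun i : 'I_h.+1 => if (i : nat) is _.+1 then 2 else 1)) => [|i _]; last exact: E.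
  rewrite big_ord_recl (eq_bigr (fun=> 2)) // sumr_const card_ord.
  by rewrite /M -mul2n -[in RHS]add1n natrD natrM mulr_natr.
have w1 : 1 - w != 0.
  rewrite subr_eq0 eq_sym; apply/eqP => w1.
  have dM : (0 < d %% M < M)%N by rewrite ltn_pmod // lt0n andbT; apply: contraFN nd.
  have E : w = nome ((d %% M)%:R / M%:R).
    rewrite /w {1}(divn_eq d M) natrD natrM mulrDl mulfK // addrC.
    exact: (nomeDint (d %/ M)%N).
  have rE : (d %% M)%:R / M%:R = ((d %% M)%:R / M%:R)%:C :> R[i].
    by rewrite (natC R M) (natC R (d %% M)) -fmorphV -rmorphM.
  have := @cabs_1subnome_real R ((d %% M)%:R / M%:R).
  rewrite -rE -E w1 subrr cabs0 => /esym/eqP; rewrite mulf_eq0 pnatr_eq0 /= normr_eq0.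
  have p0 := pi_gt0 R; rewrite gt_eqF //; apply: sin_gt0_pi; case/andP: dM => d0 dM.
  by rewrite mulr_gt0 ?divr_gt0 ?ltr0n //= gtr_pMr // ltr_pdivrMr ?ltr0n // mul1r ltr_nat.
apply: (mulfI w1); rewrite mulr0.
(* The symmetric geometric sum telescopes; at k = h the two remaining powers of w agree because
   w^(2h+1) = 1. *)
suff -> : forall k, (1 - w) * \sum_(i < k.+1) zfold (fun n => nome (d%:R * n%:~R / M%:R) : R[i]) i
    = w ^- k - w ^+ k.+1.
  have E : w ^+ h * w ^+ h.+1 = 1 by rewrite -exprD addnS addnn.
  by rewrite -[w ^+ h.+1](mulKf (expf_neq0 h w0)) E mulr1 subrr.
elim=> [|k IH].
  by rewrite big_ord1 /= -[0]/(0%N%:Z) wn expr0 invr1 expr1 mulr1.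
rewrite big_ord_recr mulrDr IH [zfold _ _]/= wn wN.
by rewrite !exprS; field; rewrite w0 expf_neq0.
Qed.

(** Summing over the M division points kills every d prime to the condition M | d; a term d = M c
    keeps q^c, with M^j from d^j and M from the orthogonality relation. *)
Lemma distribution j (h : nat) z : 0 < complex.Im z -> let M := h.*2.+1 in
  \sum_(i < h.+1) zfold (fun n => psum (npow j) (nome ((z + n%:~R) / M%:R))) i =
  M%:R ^+ j.+1 * psum (npow j) (nome z).
Proof.
move=> z0 M; have M0 : M%:R != 0 :> R[i] by rewrite pnatr_eq0.
have Mr : 0 < M%:R :> R by rewrite ltr0n.
have qn n : cabs (nome ((z + n%:~R) / M%:R)) < 1.
  apply: cabs_nome_lt1; rewrite (natC R M) -fmorphV intC.
  case: (z) z0 => a b /= b0; simpc; by rewrite mulr_gt0 ?invr_gt0.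
have hs n := psumP (conv_npow j) (qn n).
have hf i : has_sum (fun d => zfold (fun n => npow j d * nome ((z + n%:~R) / M%:R) ^+ d) i)
    (zfold (fun n => psum (npow j) (nome ((z + n%:~R) / M%:R))) i).
  by case: i => [|i] /=; [apply: hs | apply: has_sumD; apply: hs].
have h1 := @has_sum_sum _ _ (index_enum 'I_h.+1) xpredT _ _ (fun i _ => hf (i : 'I_h.+1)).
have h2 := has_sum_stretch (ltn0Sn h.*2) (psumP (conv_npow j) (cabs_nome_lt1 z0)).
apply: has_sum_unique h1 _.
apply: has_sum_eq (has_sumZ (M%:R ^+ j.+1) h2) => d.
have -> : \sum_(i < h.+1) zfold (fun n => npow j d * nome ((z + n%:~R) / M%:R) ^+ d) i =
  npow j d * nome (d%:R * z / M%:R) * \sum_(i < h.+1) zfold (fun n => nome (d%:R * n%:~R / M%:R) : R[i]) i.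
  rewrite mulr_sumr; apply: eq_bigr => i _; rewrite -zfoldZ.
  suff E n : npow j d * nome ((z + n%:~R) / M%:R) ^+ d =
     npow j d * nome (d%:R * z / M%:R) * nome (d%:R * n%:~R / M%:R).
    by case: i => -[|i] ? /=; rewrite !E.
  by rewrite -mulrA -nomeD -nome_nat; congr (_ * nome _); ring.
rewrite zfold_roots; case: ifP => [/dvdnP[c ->]|]; last by rewrite !mulr0.
rewrite mulnK // /npow -nome_nat natrM.
have -> : c%:R * M%:R * z / M%:R = c%:R * z by field.
by rewrite exprMn exprS /M; ring.
Qed.

End Lipschitz.

Section LipschitzFormula.
Variable R : realType.
Implicit Types (q z w : R[i]).

Lemma one_sub_nome_bound w (M : nat) : (0 < M)%N ->
  cabs (M%:R * (1 - nome (w / M%:R)) + tau R * w) <=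
  3 * cabs (tau R * w) ^+ 2 * expR (cabs (tau R * w)) / M%:R.
Proof.
move=> M0; have Mr : 0 < M%:R :> R by rewrite ltr0n.
have MC : M%:R != 0 :> R[i] by rewrite pnatr_eq0 -lt0n.
set t := tau R * w.
have -> : M%:R * (1 - nome (w / M%:R)) + t = - (M%:R * (cexp (t / M%:R) - 1 - t / M%:R)).
  by rewrite nomeE mulrA -/t; field.
rewrite cabsN cabsM cabs_nat.
apply: le_trans (ler_wpM2l (ltW Mr) (cexp_bound _)) _.
rewrite cabsM cabsV cabs_nat.
have t0 := cabs_ge0 t.
have -> : M%:R * (3 * (cabs t / M%:R) ^+ 2 * expR (cabs t / M%:R)) =
   3 * cabs t ^+ 2 * expR (cabs t / M%:R) / M%:R by field; rewrite gt_eqF.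
rewrite ler_wpM2r ?invr_ge0 ?(ltW Mr) // ler_wpM2l ?mulr_ge0 ?exprn_ge0 //.
by rewrite ler_expR ler_pdivrMr // ler_peMr // ler1n.
Qed.

Lemma clim_one_sub_nome w :
  clim (fun h : nat => h.*2.+1%:R * (1 - nome (w / h.*2.+1%:R))) (- (tau R * w)).
Proof.
apply: (@clim_inv _ (3 * cabs (tau R * w) ^+ 2 * expR (cabs (tau R * w)))).
exists 0%N => h _; rewrite opprK; apply: le_trans (one_sub_nome_bound _ _) _ => //.
rewrite ler_wpM2l //; first by rewrite !mulr_ge0 ?exprn_ge0 ?cabs_ge0 ?expR_ge0.
by rewrite lef_pV2 ?posrE ?ltr0n // ler_nat; lia.
Qed.

Lemma clim_torsion w : w != 0 ->
  clim (fun h : nat => (1 - nome (w / h.*2.+1%:R))^-1 / h.*2.+1%:R) (- (tau R * w))^-1.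
Proof.
move=> w0; have h := climV _ (clim_one_sub_nome w).
apply: clim_eq (h _) => [n|]; last by rewrite oppr_eq0 mulf_neq0 ?tau_neq0.
by rewrite invfM mulrC.
Qed.

Lemma uhp_addz_neq0 z (n : int) : 0 < complex.Im z -> z + n%:~R != 0.
Proof.
rewrite intC; case: z => a b /= b0; simpc.
by rewrite eq_complex /= negb_and (gt_eqF b0) orbT.
Qed.

Lemma clim_inv_nat : clim (fun h : nat => h.*2.+1%:R^-1 : R[i]) 0.
Proof.
apply: (@clim_inv _ 1); exists 0%N => h _.
rewrite subr0 cabsV cabs_nat mul1r.
by rewrite lef_pV2 ?posrE ?ltr0n // ler_nat; lia.
Qed.

Lemma torsion_bound_inv z : 0 < complex.Im z ->
  exists K : R, 0 < K /\ exists M0 : nat, forall (h : nat) (n : int),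
    (M0 <= h)%N -> (`|n| <= h)%N ->
    cabs ((1 - nome ((z + n%:~R) / h.*2.+1%:R))^-1 / h.*2.+1%:R)
     <= K / (1 + `|n|%N)%:R.
Proof.
move=> z0; have [K [K0 [M0 hK]]] := torsion_bound z0.
exists K; split=> //; exists M0 => h n hM hn.
have := hK h.*2.+1 n _ isT _; rewrite cabsM !cabsV cabs_nat.
set X := cabs _; set M := _.*2.+1 => /(_ _ _)/wrap[]; first by rewrite /M; lia.
  by rewrite /M; lia.
move=> hX; have n0 : 0 < (1 + `|n|)%N%:R :> R by rewrite ltr0n.
have Mp : 0 < M%:R :> R by rewrite ltr0n.
have X0 : 0 < X.
  rewrite lt_neqAle cabs_ge0 andbT; apply/eqP => E.
  by move: hX; rewrite -E mulr0 leNgt n0.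
rewrite ler_pdivlMr // -invfM mulrC ler_pdivrMr ?mulr_gt0 //.
by rewrite [X * _]mulrC mulrA.
Qed.

Lemma one_sub_neq0 q : cabs q < 1 -> 1 - q != 0.
Proof.
by move=> q1; apply/eqP => /eqP; rewrite subr_eq0 => /eqP E; rewrite -E cabs1 ltxx in q1.
Qed.

(* The distribution relation with M = 2h + 1, divided by M^(j+1): as h tends to
   infinity, 1 - nome (w / M) behaves like - tau w / M. *)
Lemma lipschitz j z : (0 < j)%N -> 0 < complex.Im z ->
  zsum (fun n => j`!%:R * (- (tau R * (z + n%:~R)))^-1 ^+ j.+1) (psum (@npow R j) (nome z)).
Proof.
move=> j0 z0.
have [K [K0 [M0 hK]]] := torsion_bound_inv z0.
pose Y (h : nat) (n : int) : R[i] := (1 - nome ((z + n%:~R) / h.*2.+1%:R))^-1 / h.*2.+1%:R.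
pose Q := polylog R j.
(* The polynomial [Q] has degree j + 1, so after division by M^(j+1) its coefficient i carries the
   factor M^(i-j-1): in the limit only the leading coefficient j! survives. *)
pose G (h : nat) (n : int) : R[i] :=
  \sum_(i < j.+2) Q`_i * Y h n ^+ i * (h.*2.+1%:R^-1) ^+ (j.+1 - i).
have Mn0 (h : nat) : h.*2.+1%:R != 0 :> R[i] by rewrite pnatr_eq0.
have qn (h : nat) n : cabs (nome ((z + n%:~R) / h.*2.+1%:R)) < 1.
  apply: cabs_nome_lt1; rewrite (natC R h.*2.+1) -fmorphV intC.
  by case: (z) z0 => a b /= b0; simpc; rewrite mulr_gt0 ?invr_gt0 ?ltr0n.
have GE h n : psum (@npow R j) (nome ((z + n%:~R) / h.*2.+1%:R)) = h.*2.+1%:R ^+ j.+1 * G h n.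
  rewrite psum_npow // (horner_coef_wide _ (size_polylog _ j)) mulr_sumr.
  apply: eq_bigr => i _; rewrite /Y exprMn.
  set m := h.*2.+1%:R.
  have m0 : m != 0 := Mn0 h.
  have -> : m ^+ j.+1 = m ^+ i * m ^+ (j.+1 - i) by rewrite -exprD subnKC // -ltnS.
  by rewrite !exprVn; field; rewrite !expf_neq0 ?(one_sub_neq0 (qn h n)).
pose A := \sum_(i < j.+2) cabs Q`_i * K ^+ i.
have A0 : 0 <= A by apply: sumr_ge0 => i _; rewrite mulr_ge0 ?cabs_ge0 ?exprn_ge0 ?ltW.
(* Both [Y h n] and 1 / M are O(1 / (1 + |n|)), as |n| <= h < M. Their product has j + 1 factors,
   and j > 0 makes the exponent at least 2. *)
have Gb h n : (M0 <= h)%N -> (`|n| <= h)%N -> cabs (G h n) <= A * bz R `|n|.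
  move=> hM hn; apply: le_trans (cabs_sum _ _ _) _.
  rewrite mulr_suml; apply: ler_sum => i _.
  rewrite !cabsM !cabsX cabsV cabs_nat -!mulrA ler_wpM2l ?cabs_ge0 //.
  have n0 : 0 < (1 + `|n|)%N%:R :> R by rewrite ltr0n.
  set N : R := (1 + `|n|)%N%:R in n0.
  have N1 : 1 <= N by rewrite ler1n.
  apply: (@le_trans _ _ ((K / N) ^+ i * N^-1 ^+ (j.+1 - i))).
    apply: ler_pM; rewrite ?exprn_ge0 ?cabs_ge0 ?invr_ge0 //.
      by apply: lerXn2r; rewrite ?nnegrE ?cabs_ge0 ?divr_ge0 ?(ltW K0) ?(ltW n0) ?hK.
    apply: lerXn2r; rewrite ?nnegrE ?invr_ge0 ?(ltW n0) ?ler0n //.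
    by rewrite lef_pV2 ?posrE ?ltr0n // ler_nat; lia.
  rewrite exprMn -mulrA -exprD subnKC; last by rewrite -ltnS.
  rewrite ler_wpM2l ?exprn_ge0 ?(ltW K0) // /bz -add1n -/N -exprVn.
  by apply: ler_wiXn2l; rewrite ?invr_ge0 ?(ltW n0) ?invf_le1.
have Gl n : clim (G^~ n) (j`!%:R * (- (tau R * (z + n%:~R)))^-1 ^+ j.+1).
  have -> : j`!%:R * (- (tau R * (z + n%:~R)))^-1 ^+ j.+1 =
      \sum_(i < j.+2) Q`_i * (- (tau R * (z + n%:~R)))^-1 ^+ i * 0 ^+ (j.+1 - i).
    rewrite big_ord_recr /= subnn mulr1 lead_polylog big1 ?add0r // => i _.
    by rewrite expr0n subn_eq0 leqNgt ltn_ord mulr0.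
  apply: (@clim_sum _ _ _ (fun h (i : 'I_j.+2) => Q`_i * Y h n ^+ i * (h.*2.+1%:R^-1) ^+ (j.+1 - i))) => i.
  apply: climM; last exact: climX clim_inv_nat.
  by apply: climZ; apply: climX; apply: clim_torsion; apply: uhp_addz_neq0.
have [||||s hs1 hs2] := @tannery _ (fun h i => if (i <= h)%N then zfold (G h) i else 0)
   (fun=> psum (@npow R j) (nome z))
   (zfold (fun n => j`!%:R * (- (tau R * (z + n%:~R)))^-1 ^+ j.+1))
   (fun i => 2 * (A * bz R i)) M0.
- by do 2! [apply: rsummableZ => //]; apply: rsummable_bz.
- move=> h i hM; case: ifP => [ih|_]; last by rewrite cabs0 !mulr_ge0 ?bz_ge0.
  case: i ih => [|i] ih /=.
    by apply: le_trans (Gb h 0 hM _) _ => //; have := mulr_ge0 A0 (bz_ge0 R 0); rewrite absz0; lra.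
  apply: le_trans (cabsD _ _) _.
  have := Gb h i.+1 hM ih; have := Gb h (- i.+1%:Z) hM; rewrite abszN => /(_ ih).
  by rewrite absz_nat; lra.
- move=> i; apply: (@clim_near _ i (fun h => zfold (G h) i)) => [h ->//|].
  by case: i => [|i] /=; [apply: Gl | apply: climD; apply: Gl].
- move=> h; have -> : psum (@npow R j) (nome z) =
      \sum_(i < h.+1) (if (i <= h)%N then zfold (G h) i else 0).
    apply: (mulfI (expf_neq0 j.+1 (Mn0 h))); rewrite -distribution // mulr_sumr.
    apply: eq_bigr => i _; rewrite -ltnS ltn_ord -zfoldZ.
    by case: i => -[|i] ? /=; rewrite !GE.
  apply: (@has_sum_fin _ h.+1 (fun i => if (i <= h)%N then zfold (G h) i else 0)) => i hi.
  by rewrite leqNgt hi.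
by rewrite -(clim_unique (clim_cst _) hs2) in hs1.
Qed.

(** The case j = 0 of the Lipschitz formula. Single terms decay only like 1 / |n|, so domination is
    sought for the pairs n, -n; subtracting 1/2 makes such a pair small. *)
Lemma cot_expansion z : 0 < complex.Im z ->
  zsum (fun n => (- (tau R * (z + n%:~R)))^-1) ((1 - nome z)^-1 - 2^-1).
Proof.
move=> z0.
have [K [K0 [M0 hK]]] := torsion_bound_inv z0.
pose Y (h : nat) (n : int) : R[i] := (1 - nome ((z + n%:~R) / h.*2.+1%:R))^-1.
pose G (h : nat) (n : int) : R[i] := Y h n / h.*2.+1%:R - 2^-1 / h.*2.+1%:R.
have Mn0 (h : nat) : h.*2.+1%:R != 0 :> R[i] by rewrite pnatr_eq0.
have qn (h : nat) n : cabs (nome ((z + n%:~R) / h.*2.+1%:R)) < 1.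
  apply: cabs_nome_lt1; rewrite (natC R h.*2.+1) -fmorphV intC.
  by case: (z) z0 => a b /= b0; simpc; rewrite mulr_gt0 ?invr_gt0 ?ltr0n.
have YE h n : psum (@npow R 0) (nome ((z + n%:~R) / h.*2.+1%:R)) = Y h n.
  by rewrite psum_npow // polylog0 hornerX.
set B := 3 * cabs (tau R * (2 * z)) ^+ 2 * expR (cabs (tau R * (2 * z))) + cabs (tau R * (2 * z)).
have B0 : 0 <= B by rewrite addr_ge0 ?cabs_ge0 // !mulr_ge0 ?exprn_ge0 ?cabs_ge0 ?expR_ge0.
(* With a, b the two nomes, 1/(1-a) + 1/(1-b) - 1 = (1 - ab) / ((1-a)(1-b)). Here ab =
   [nome (2 * z / M)] no longer depends on i, and M (1 - ab) is bounded by [B]. *)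
have pairE (h i : nat) : G h i.+1 + G h (- i.+1%:Z) =
   h.*2.+1%:R * (1 - nome (2 * z / h.*2.+1%:R)) * (Y h i.+1 / h.*2.+1%:R) * (Y h (- i.+1%:Z) / h.*2.+1%:R).
  rewrite /G /Y; have := one_sub_neq0 (qn h i.+1); have := one_sub_neq0 (qn h (- i.+1%:Z)).
  have -> : nome (2 * z / h.*2.+1%:R) =
     nome ((z + i.+1%:~R) / h.*2.+1%:R) * nome ((z + (- i.+1%:Z)%:~R) / h.*2.+1%:R).
    by rewrite -nomeD; congr nome; rewrite mulrNz; ring.
  move: (nome _) (nome _) => a b; move: (h.*2.+1%:R) (Mn0 h) => m m0 a0 b0.
  by field; rewrite a0 b0 m0.
have Gb (h i : nat) : (M0 <= h)%N -> (i.+1 <= h)%N ->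
    cabs (G h i.+1 + G h (- i.+1%:Z)) <= B * K ^+ 2 * bz R i.+1.
  move=> hM ih; rewrite pairE cabsM [cabs (_ * (Y h i.+1 / _))]cabsM -[leLHS]mulrA -[leRHS]mulrA.
  have h1 : cabs (h.*2.+1%:R * (1 - nome (2 * z / h.*2.+1%:R))) <= B.
    have /(_ isT) := one_sub_nome_bound (2 * z) (M := h.*2.+1).
    set t := tau R * (2 * z) in B B0 *; set u := _ * (1 - _) => h1.
    have -> : u = (u + t) - t by ring.
    apply: le_trans (cabsB _ _) _; rewrite lerD2r; apply: le_trans h1 _.
    rewrite ler_piMr ?invf_le1 ?ltr0n ?ler1n //.
    by rewrite !mulr_ge0 ?exprn_ge0 ?cabs_ge0 ?expR_ge0.
  apply: ler_pM => //; rewrite ?mulr_ge0 ?cabs_ge0 //.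
  have := hK h i.+1 hM ih; have := hK h (- i.+1%:Z) hM; rewrite abszN => /(_ ih).
  rewrite absz_nat -/(Y h i.+1) -/(Y h (- i.+1%:Z)) => h2 h3.
  apply: le_trans (ler_pM (cabs_ge0 _) (cabs_ge0 _) h3 h2) _.
  by rewrite /bz -add1n le_eqVlt; apply/orP; left; apply/eqP; field; rewrite gt_eqF // ltr0n.
have Gl n : clim (G^~ n) (- (tau R * (z + n%:~R)))^-1.
  have -> : (- (tau R * (z + n%:~R)))^-1 = (- (tau R * (z + n%:~R)))^-1 - 2^-1 * 0 by rewrite mulr0 subr0.
  apply: climB; first by apply: clim_torsion; apply: uhp_addz_neq0.
  by apply: climZ clim_inv_nat.
pose b i := if i is _.+1 then B * K ^+ 2 * bz R i else K + 2^-1.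
have [||||s hs1 hs2] := @tannery _ (fun h i => if (i <= h)%N then zfold (G h) i else 0)
   (fun=> (1 - nome z)^-1 - 2^-1)
   (zfold (fun n => (- (tau R * (z + n%:~R)))^-1)) (fun i => (B * K ^+ 2 + K + 2^-1) * bz R i) M0.
- apply: rsummableZ; last exact: rsummable_bz.
  by rewrite !addr_ge0 ?mulr_ge0 ?exprn_ge0 ?invr_ge0 ?(ltW K0) ?B0.
- move=> h i hM; case: ifP => [ih|_]; last first.
    by rewrite cabs0 mulr_ge0 ?bz_ge0 // !addr_ge0 ?mulr_ge0 ?exprn_ge0 ?invr_ge0 ?(ltW K0) ?B0.
  case: i ih => [|i] ih /=.
    rewrite /bz expr1n invr1 mulr1; apply: le_trans (cabsB _ _) _.
    have := hK h 0 hM ih; rewrite -/(Y h 0) addn0 divr1 => h1.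
    have h2 : cabs (2^-1 / h.*2.+1%:R : R[i]) <= 2^-1.
      rewrite cabsM !cabsV !cabs_nat ler_piMr ?invr_ge0 //.
      by rewrite invf_le1 ?ltr0n ?ler1n.
    have : 0 <= B * K ^+ 2 by rewrite mulr_ge0 ?exprn_ge0 ?(ltW K0).
    lra.
  apply: le_trans (Gb h i hM ih) _; rewrite ler_wpM2r ?bz_ge0 //.
  have : 0 <= K + 2^-1 by rewrite addr_ge0 ?invr_ge0 ?(ltW K0).
  lra.
- move=> i; apply: (@clim_near _ i (fun h => zfold (G h) i)) => [h ->//|].
  by case: i => [|i] /=; [apply: Gl | apply: climD; apply: Gl].
- move=> h; have -> : (1 - nome z)^-1 - 2^-1 =
      \sum_(i < h.+1) (if (i <= h)%N then zfold (G h) i else 0).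
    rewrite (eq_bigr (fun i : 'I_h.+1 => zfold (fun n => psum (@npow R 0) (nome ((z + n%:~R) / h.*2.+1%:R))) i / h.*2.+1%:R
        + (- (2^-1 / h.*2.+1%:R)) * zfold (fun=> 1) i)); last first.
      move=> i _; rewrite -ltnS ltn_ord; case: i => -[|i] ? /=; rewrite !YE /G; ring.
    rewrite big_split /= -mulr_suml distribution // -mulr_sumr.
    have -> : \sum_(i < h.+1) zfold (fun=> 1) i = h.*2.+1%:R :> R[i].
      rewrite big_ord_recl /= (eq_bigr (fun=> 2)) ?sumr_const ?card_ord //.
      by rewrite -mul2n -[in RHS]add1n natrD natrM mulr_natr.
    rewrite psum_npow ?cabs_nome_lt1 // polylog0 hornerX.
    have := one_sub_neq0 (cabs_nome_lt1 z0); move: (nome z) => a; move: (h.*2.+1%:R) (Mn0 h) => m m0 a0.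
    by field; rewrite m0 a0.
  apply: (@has_sum_fin _ h.+1 (fun i => if (i <= h)%N then zfold (G h) i else 0)) => i hi.
  by rewrite leqNgt hi.
by rewrite -(clim_unique (clim_cst _) hs2) in hs1.
Qed.

End LipschitzFormula.

(** * Eisenstein series *)

Definition sigma (j n : nat) : nat := \sum_(d < n | (d.+1 %| n)%N) d.+1 ^ j.

Section Eisenstein.
Variable R : realType.
Implicit Types (z w q : R[i]).

Definition sigmaC (j n : nat) : R[i] := (sigma j n)%:R.

Lemma sigma_le j n : (sigma j n <= n ^ j.+1)%N.
Proof.
rewrite /sigma big_mkcond.
apply: (@leq_trans (\sum_(d < n) n ^ j)); last by rewrite sum_nat_const card_ord expnS.
by apply: leq_sum => d _; case: ifP => // _; case: j => [|j] //; rewrite leq_exp2r.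
Qed.

Lemma conv_sigma j : conv (sigmaC j).
Proof.
apply: conv_le (@conv_natX R j.+1) => n.
by rewrite /sigmaC -natrX !cabs_nat ler_nat sigma_le.
Qed.

Lemma has_sum_behead (u : nat -> R[i]) s : has_sum u s ->
  has_sum (fun n => u n.+1) (s - u 0%N).
Proof.
move=> h; have := climB (@clim_sub _ S _ _ (fun n => leqnSn n) h) (clim_cst (u 0%N)).
by apply: clim_eq => n; rewrite big_ord_recl addrAC subrr add0r.
Qed.

(** The double series of d^j q^(m d) regrouped by the product m d; both indices are shifted to start
    at 0. *)
Lemma lambert j z : (0 < j)%N -> 0 < complex.Im z ->
  has_sum (fun i => psum (npow R j) (nome (i.+1%:R * z))) (psum (sigmaC j) (nome z)).
Proof.
move=> j0 z0; have q1 := cabs_nome_lt1 z0; set q := nome z in q1 *.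
have q0 := cabs_ge0 q.
have qi i : cabs (nome (i.+1%:R * z)) < 1.
  by rewrite nome_nat cabsX exprn_ilt1.
pose u (i d : nat) := npow R j d.+1 * q ^+ (i.+1 * d.+1).
have hr i : has_sum (u i) (psum (npow R j) (nome (i.+1%:R * z))).
  have := has_sum_behead (psumP (@conv_npow R j) (qi i)).
  rewrite [npow R j 0]expr0n gtn_eqF // mul0r subr0; apply: has_sum_eq => d.
  by rewrite nome_nat -exprM.
pose b d := cabs (npow R j d.+1) * cabs q ^+ d.+1.
have [|||||s hs1 hs2] := @level_sums _ (fun i d => (i.+1 * d.+1).-1) u
    (fun i => cabs q ^+ i) b (fun i => psum (npow R j) (nome (i.+1%:R * z))).
- by move=> i d; rewrite mulnS mulSn /= geq_max; lia.
- exact: rsummable_geo.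
- have [b0 [B hB]] := conv_rsummable q0 q1 (@conv_npow R j).
  split=> [d|]; first exact: b0.
  exists B => n; apply: le_trans (hB n.+1).
  by rewrite big_ord_recl lerDr; apply: b0.
- move=> i d; rewrite /u /b cabsM cabsX mulrCA ler_wpM2l ?cabs_ge0 // -exprD.
  by apply: ler_wiXn2l => //; [apply: ltW | rewrite mulnS mulSn; lia].
- exact: hr.
suff <- : s = psum (sigmaC j) q by [].
apply/esym/psumE; rewrite -[s]add0r.
have -> : 0 = sigmaC j 0 * q ^+ 0 by rewrite /sigmaC /sigma big_ord0 mul0r.
apply: (@has_sum_recl _ (fun n => sigmaC j n * q ^+ n)).
apply: has_sum_eq hs2 => n.
rewrite (exchange_big_dep xpredT) // /sigmaC /sigma natr_sum mulr_suml [RHS]big_mkcond.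
apply: eq_bigr => d _; case: ifP => [/dvdnP[c E]|nd].
  have c0 : (0 < c)%N by rewrite lt0n; apply/eqP => c0; rewrite c0 in E.
  have lt : (c.-1 < n.+1)%N.
    by rewrite prednK // -[c]muln1 E leq_mul2l orbT.
  rewrite (big_pred1 (Ordinal lt)) => [|i].
    by rewrite /u /= prednK // -E /npow natrX.
  have -> : pred1 (Ordinal lt) i = (i.+1 == c)%N by rewrite -[in RHS](prednK c0) eqSS.
  have -> : (i.+1 == c)%N = (i.+1 * d.+1 == n.+1)%N by rewrite -(eqn_pmul2r (ltn0Sn d)) -E.
  by rewrite andTb -[in LHS]eqSS prednK ?muln_gt0.
rewrite big_pred0 // => i; rewrite andTb; apply/eqP => E; move/negP: nd; apply.
apply/dvdnP; exists i.+1.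
by have : (0 < i.+1 * d.+1)%N := isT; move: E; set x := (i.+1 * d.+1)%N; lia.
Qed.

(** For k > 0 the origin contributes 0, the inverse of 0 being 0, so lattice sums range over all
    pairs without exception. *)
Definition lat (k : nat) z (m n : int) : R[i] := (m%:~R * z + n%:~R) ^- k.

Definition lipC (k : nat) : R[i] := (- tau R) ^+ k / k.-1`!%:R.

Lemma lipC_neq0 k : lipC k != 0.
Proof.
by rewrite mulf_neq0 ?expf_neq0 ?oppr_eq0 ?tau_neq0 // invr_eq0 pnatr_eq0 -lt0n fact_gt0.
Qed.

Lemma lipschitz_lat j z : (0 < j)%N -> 0 < complex.Im z ->
  zsum (fun n => (z + n%:~R) ^- j.+1) (lipC j.+1 * psum (npow R j) (nome z)).
Proof.
move=> j0 z0; apply: zsum_eq (zsumZ (lipC j.+1) (lipschitz j0 z0)) => n.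
have := uhp_addz_neq0 n z0; move: (z + _) => w w0.
have f0 : j`!%:R != 0 :> R[i] by rewrite pnatr_eq0 -lt0n fact_gt0.
have x0 : - tau R != 0 by rewrite oppr_eq0 tau_neq0.
have -> : - (tau R * w) = - tau R * w by rewrite mulNr.
rewrite /lipC [j.+1.-1]/= exprVn [(- tau R * w) ^+ _]exprMn; move: (expf_neq0 j.+1 x0) (expf_neq0 j.+1 w0) f0.
move: (_ ^+ _) (_ ^+ _) (_%:R) => x y m x1 y1 m1.
by field; rewrite m1 x1 y1.
Qed.

Definition rowsum k (Z : R[i]) z (m : int) : R[i] :=
  if m == 0 then Z else lipC k * psum (npow R k.-1) (nome (`|m|%N%:R * z)).

Lemma Im_natM (m : nat) z : complex.Im (m%:R * z) = m%:R * complex.Im z.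
Proof. by rewrite natC; case: z => a b /=; simpc. Qed.

Lemma zsum_row j z Z (m : int) : odd j -> 0 < complex.Im z ->
  zsum (fun n : int => (n%:~R : R[i]) ^- j.+1) Z ->
  zsum (lat j.+1 z m) (rowsum j.+1 Z z m).
Proof.
move=> oj z0 hZ; have j0 : (0 < j)%N by case: (j) oj.
rewrite /rowsum; have [->|m0] := eqVneq m 0.
  by apply: zsum_eq hZ => n; rewrite /lat mul0r add0r.
have mz : 0 < complex.Im (`|m|%N%:R * z) by rewrite Im_natM mulr_gt0 // ltr0n absz_gt0.
have h := lipschitz_lat j0 mz.
case: m m0 mz h => m m0 mz h; first exact: h.
apply: zsum_eq (zsum_opp h) => n.
rewrite /lat NegzE abszN absz_nat; congr (_^-1).
have -> : (- m.+1%:Z)%:~R * z + n%:~R = - (m.+1%:R * z + (- n)%:~R).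
  by rewrite !mulrNz; ring.
by rewrite [RHS]exprNn -signr_odd /= oj expr0 mul1r.
Qed.

Lemma zsum_rows j z Z : (0 < j)%N -> 0 < complex.Im z ->
  zsum (rowsum j.+1 Z z) (Z + 2 * lipC j.+1 * psum (sigmaC j) (nome z)).
Proof.
move=> j0 z0; have h := has_sumZ (2 * lipC j.+1) (lambert j0 z0).
apply: (@has_sum_recl _ (zfold (rowsum j.+1 Z z))).
apply: has_sum_eq h => i; rewrite [RHS]/=.
have -> : rowsum j.+1 Z z (- i.+1%:Z) = rowsum j.+1 Z z i.+1.
  by rewrite /rowsum oppr_eq0 abszN.
by rewrite /rowsum /=; ring.
Qed.

(** Equivalence of norms in the real basis (z, 1). The second coordinate is real so that the bound
    also applies at half-integers. *)
Lemma lattice_lower z : 0 < complex.Im z -> exists2 c : R, 0 < c &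
  forall (m : int) (x : R), c * (`|m|%N%:R + `|x|) <= cabs (m%:~R * z + x%:C).
Proof.
case: z => a y /= y0.
have D0 : 0 < 1 + (`|a| + 1) / y by rewrite addr_gt0 // divr_gt0 // ltr_wpDl.
exists (1 + (`|a| + 1) / y)^-1; first by rewrite invr_gt0.
move=> m x; rewrite mulrC ler_pdivrMr // mulrDr mulr1.
have -> : m%:~R * (a +i* y) + x%:C = (m%:~R * a + x) +i* (m%:~R * y).
  by rewrite intC; simpc.
set X := cabs _.
have mE : `|m%:~R| = `|m|%N%:R :> R by rewrite -intr_norm -abszE.
have h1 : `|m|%N%:R * y <= X.
  have := cabs_Im ((m%:~R * a + x) +i* (m%:~R * y)); rewrite -/X /= normrM mE.
  by rewrite (gtr0_norm y0).
have h2 : `|x| <= X + `|m|%N%:R * `|a|.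
  have := cabs_Re ((m%:~R * a + x) +i* (m%:~R * y)); rewrite -/X /=.
  have := ler_normB (m%:~R * a + x) (m%:~R * a); rewrite addrC addKr normrM mE; lra.
have h3 : `|m|%N%:R * (`|a| + 1) <= X * ((`|a| + 1) / y).
  have a0 : 0 <= `|a| + 1 by rewrite addr_ge0.
  by rewrite [X * _]mulrA ler_pdivlMr // mulrAC ler_wpM2r.
lra.
Qed.

(** Since (1 + m)(1 + n) <= (1 + m + n)^2, decay of order 4 splits into a product of two summable
    majorants. This is the source of the restriction to weights at least 4. *)
Lemma bz_mul_ge (m n : nat) (x : R) : (1 + m%:R + n%:R) <= x ->
  (x ^+ 4)^-1 <= bz R m * bz R n.
Proof.
move=> h; have m0 : 0 <= m%:R :> R by []. have n0 : 0 <= n%:R :> R by [].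
rewrite /bz -invfM -exprMn -!nat1r.
move: (m%:R) (n%:R) h m0 n0 => a b h a0 b0.
have h1 : (1 + a) * (1 + b) <= x ^+ 2.
  apply: (@le_trans _ _ ((1 + a + b) ^+ 2)); first by rewrite expr2; nra.
  by apply: lerXn2r; rewrite ?nnegrE //; lra.
have h2 : 0 < (1 + a) * (1 + b) by rewrite mulr_gt0 //; lra.
have x0 : 0 < x by lra.
rewrite lef_pV2 ?posrE ?exprn_gt0 // -[4%N]/(2 * 2)%N exprM.
by apply: lerXn2r; rewrite ?nnegrE ?exprn_ge0 // ltW.
Qed.

Lemma lat_bound k z : (4 <= k)%N -> 0 < complex.Im z ->
  exists2 C : R, 0 <= C &
  forall m n, cabs (lat k z m n) <= C * bz R `|m|%N * bz R `|n|%N.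
Proof.
move=> k4 z0; have [c c0 hc] := lattice_lower z0.
exists ((2 / c) ^+ k); first by rewrite exprn_ge0 // divr_ge0 // ltW.
move=> m n; rewrite /lat cabsV cabsX.
have [/andP[/eqP-> /eqP->]|mn] := boolP ((m == 0) && (n == 0)).
  rewrite mul0r addr0 cabs0 expr0n gtn_eqF 1?(leq_trans _ k4) // invr0.
  by rewrite !mulr_ge0 ?bz_ge0 // exprn_ge0 // divr_ge0 // ltW.
have h := hc m n%:~R; rewrite -intC in h.
rewrite -intr_norm -abszE in h.
have s1 : 1 <= `|m|%N%:R + `|n|%N%:R :> R.
  by rewrite -natrD ler1n; move: mn; rewrite -!absz_eq0; lia.
set X := cabs _ in h *; set s : R := _ + _ in h s1.
have h2 : c / 2 * (1 + s) <= X by apply: le_trans h; nra.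
have p0 : 0 < c / 2 * (1 + s) by rewrite mulr_gt0 ?divr_gt0 //; lra.
apply: (@le_trans _ _ ((c / 2 * (1 + s)) ^+ k)^-1).
  rewrite lef_pV2 ?posrE ?exprn_gt0 //; first by apply: lerXn2r; rewrite ?nnegrE; lra.
  exact: lt_le_trans p0 h2.
rewrite exprMn invfM -exprVn invf_div -mulrA ler_wpM2l ?exprn_ge0 ?divr_ge0 ?(ltW c0) //.
apply: le_trans (_ : ((1 + s) ^+ 4)^-1 <= _); last first.
  by apply: bz_mul_ge; rewrite /s addrA.
rewrite lef_pV2 ?posrE ?exprn_gt0 ?ler_weXn2l //; lra.
Qed.

Lemma uhp_neq0 z : 0 < complex.Im z -> z != 0.
Proof. by move=> z0; apply/eqP => E; rewrite E /= ltxx in z0. Qed.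

Lemma uhp_negV z : 0 < complex.Im z -> 0 < complex.Im (- z^-1).
Proof.
move=> z0; have zn := uhp_neq0 z0.
case: z z0 zn => a b /= b0 zn; rewrite ?mulNr opprK divr_gt0 //.
by rewrite ltr_wpDl ?sqr_ge0 ?exprn_gt0.
Qed.

(** m z + n = z ((-n)(-1/z) + m): the columns of the lattice of z are, up to scaling, the rows of
    that of -1/z. *)
Lemma lat_swap k z m n : 0 < complex.Im z ->
  lat k z m n = z ^- k * lat k (- z^-1) (- n) m.
Proof.
move=> z0; have zn := uhp_neq0 z0.
rewrite /lat -invfM -exprMn; congr ((_ ^+ _)^-1).
by rewrite mulrNz; field.
Qed.

Lemma zsum_lat_ex j : (0 < j)%N -> exists Z, zsum (fun n : int => (n%:~R : R[i]) ^- j.+1) Z.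
Proof.
move=> j0; apply: (@zsum_ex _ _ 4) => // n.
rewrite cabsV cabsX cabs_int -intr_norm -abszE.
have [->|n0] := eqVneq n 0; first by rewrite expr0n invr0 mulr_ge0 ?bz_ge0.
have n1 : 1 <= `|n|%N%:R :> R by rewrite ler1n absz_gt0.
rewrite /bz -nat1r.
rewrite -[leRHS](_ : ((1 + `|n|%N%:R) / 2) ^- 2 = _); last by field; rewrite gt_eqF //; lra.
rewrite lef_pV2 ?posrE ?exprn_gt0 ?divr_gt0 //; try lra.
apply: le_trans (_ : `|n|%N%:R ^+ 2 <= _); last by rewrite ler_weXn2l.
by apply: lerXn2r; rewrite ?nnegrE; lra.
Qed.

(** Summing the lattice by rows gives the series at z, summing it by columns gives z^(-j-1) times
    the series at -1/z. *)
Lemma eisenstein_inv j Z z : odd j -> (3 <= j)%N -> 0 < complex.Im z ->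
  zsum (fun n : int => (n%:~R : R[i]) ^- j.+1) Z ->
  Z + 2 * lipC j.+1 * psum (sigmaC j) (nome (- z^-1)) =
  z ^+ j.+1 * (Z + 2 * lipC j.+1 * psum (sigmaC j) (nome z)).
Proof.
move=> oj j3 z0 hZ; have j0 : (0 < j)%N by case: (j) oj.
have w0 := uhp_negV z0; have zn := uhp_neq0 z0.
have [C C0 hC] := lat_bound (j3 : (4 <= j.+1)%N) z0.
have hc n : zsum ((lat j.+1 z)^~ n) (z ^- j.+1 * rowsum j.+1 Z (- z^-1) (- n)).
  apply: zsum_eq (zsumZ (z ^- j.+1) (zsum_row (- n) oj w0 hZ)) => m.
  by rewrite [RHS]lat_swap.
have [s hs1 hs2] := zsum_swap C0 hC (fun m => zsum_row m oj z0 hZ) hc.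
rewrite (zsum_unique hs1 (zsum_rows Z j0 z0)) in hs2.
have h := zsumZ (z ^- j.+1) (zsum_opp (zsum_rows Z j0 w0)).
have scale (x a b : R[i]) : x != 0 -> b = x^-1 * a -> a = x * b.
  by move=> x0 ->; rewrite mulrA mulfV // mul1r.
exact: scale (expf_neq0 j.+1 zn) (zsum_unique hs2 h).
Qed.

End Eisenstein.

(** * Even zeta values from the Lipschitz formula at z = 1/2 *)

Section Zeta.
Variable R : realType.
Implicit Types (z w q : R[i]).

Lemma clim_horner (P : {poly R[i]}) (u : nat -> R[i]) l : clim u l ->
  clim (fun n => P.[u n]) P.[l].
Proof.
move=> h; rewrite horner_coef.
apply: clim_eq (@clim_sum _ _ (index_enum 'I_(size P)) (fun n (i : 'I_(size P)) => P`_i * u n ^+ i) _ _) => [n|i].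
  by rewrite horner_coef.
by apply: climZ; apply: climX.
Qed.

Definition near_half (h : nat) : R[i] := 2^-1 +i* (h.+1%:R)^-1.

Lemma halfC : (2^-1 : R[i]) = (2^-1 : R)%:C.
Proof. by rewrite fmorphV rmorph_nat. Qed.

Lemma near_halfE h : near_half h = 2^-1 + 'i%C * (h.+1%:R)^-1.
Proof. by rewrite halfC (natC R h.+1) -fmorphV /near_half; simpc. Qed.

Lemma near_half_uhp h : 0 < complex.Im (near_half h).
Proof. by rewrite /= invr_gt0. Qed.

Lemma clim_near_half : clim near_half 2^-1.
Proof.
apply: (@clim_inv _ 1); exists 0%N => h _.
by rewrite near_halfE addrC addKr cabsM cabsi cabsV cabs_nat !mul1r.
Qed.

Lemma clim_nome_near_half : clim (fun h => nome (near_half h)) (-1).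
Proof.
apply: (@clim_inv _ (2 * pi * expR (2 * pi))); exists 0%N => h _.
rewrite nome_polar [complex.Re _]/= [complex.Im _]/= -halfC nome_half mulrN1 opprK addrC.
set s := 2 * pi * h.+1%:R^-1.
have -> : 1 - (expR (- s))%:C = - (expR (- s) - 1)%:C by rewrite rmorphB rmorph1 opprB.
rewrite cabsN cabsR; apply: le_trans (expR_sub1_le _) _.
have p0 := pi_gt0 R.
have s0 : 0 <= s by rewrite mulr_ge0 ?invr_ge0 // mulr_ge0 // ltW.
rewrite normrN (ger0_norm s0) mulrAC ler_wpM2r ?invr_ge0 //.
rewrite ler_wpM2l ?mulr_ge0 ?(ltW p0) // ler_expR /s ler_pdivrMr //.
by rewrite ler_peMr ?mulr_ge0 ?(ltW p0) // ler1n.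
Qed.

Lemma half_lower (n : int) : (1 + `|n|%N%:R) / 4 <= `|2^-1 + n%:~R : R|.
Proof.
case: n => n.
  rewrite absz_nat ger0_norm ?addr_ge0 ?invr_ge0 //=.
  have : 0 <= n%:R :> R by []. rewrite -pmulrn. lra.
rewrite NegzE abszN absz_nat mulrNz -pmulrn -nat1r.
have n0 : 0 <= n%:R :> R by [].
rewrite ler0_norm; lra.
Qed.

(** The Lipschitz formula extends to the boundary point 1/2, where q = -1: the polynomial in 1 / (1
    - q) is continuous there, and half-integers stay away from 0, which dominates the left side. *)
Lemma zsum_half j : (0 < j)%N ->
  zsum (fun n : int => (2^-1 + n%:~R : R[i]) ^- j.+1) (lipC R j.+1 * (polylog R j).[2^-1]).
Proof.
move=> j0.
have bound z (n : int) : complex.Re z = 2^-1 ->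
    cabs ((z + n%:~R) ^- j.+1) <= 4 ^+ j.+1 * bz R `|n|%N.
  move=> zh; have h1 : (1 + `|n|%N%:R) / 4 <= cabs (z + n%:~R).
    apply: le_trans (half_lower n) _; apply: le_trans (cabs_Re _).
    by rewrite ReD zh intC.
  have n0 : 0 <= `|n|%N%:R :> R by [].
  have p0 : 0 < (1 + `|n|%N%:R) / 4 :> R by rewrite divr_gt0 // ltr_wpDr.
  rewrite cabsV cabsX; apply: (@le_trans _ _ (((1 + `|n|%N%:R) / 4) ^- j.+1)).
    rewrite lef_pV2 ?posrE ?exprn_gt0 //; last exact: lt_le_trans p0 h1.
    by apply: lerXn2r; rewrite ?nnegrE ?cabs_ge0 // ltW.
  rewrite -exprVn invf_div exprMn ler_wpM2l ?exprn_ge0 // /bz -nat1r exprVn.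
  rewrite lef_pV2 ?posrE ?exprn_gt0 ?ler_weXn2l //; lra.
have half0 (n : int) : 2^-1 + n%:~R != 0 :> R[i].
  rewrite halfC intC -rmorphD /= -cabs_eq0 cabsR gt_eqF //.
  apply: lt_le_trans (half_lower n); rewrite divr_gt0 // ltr_wpDr //.
have lim n : clim (fun h => (near_half h + n%:~R) ^- j.+1) ((2^-1 + n%:~R) ^- j.+1).
  apply: climV; first exact: expf_neq0.
  by apply: climX; apply: climD clim_near_half (clim_cst _).
have [||||s hs1 hs2] := @tannery _ (fun h => zfold (fun n => (near_half h + n%:~R) ^- j.+1))
   (fun h => lipC R j.+1 * psum (npow R j) (nome (near_half h)))
   (zfold (fun n => (2^-1 + n%:~R) ^- j.+1)) (fun i => 2 * (4 ^+ j.+1 * bz R i)) 0%N.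
- by do 2! [apply: rsummableZ; rewrite ?exprn_ge0 //]; apply: rsummable_bz.
- move=> h i _.
  by apply: (@zfold_bound _ _ 0 (fun i => 4 ^+ j.+1 * bz R i)) => n; apply: bound.
- by case=> [|i] /=; [apply: lim | apply: climD; apply: lim].
- by move=> h; apply: lipschitz_lat => //; apply: near_half_uhp.
have h3 : clim (fun h => lipC R j.+1 * psum (npow R j) (nome (near_half h)))
    (lipC R j.+1 * (polylog R j).[2^-1]).
  apply: climZ; apply: (@clim_eq _ (fun h => (polylog R j).[(1 - nome (near_half h))^-1])).
    by move=> h; rewrite psum_npow //; apply: cabs_nome_lt1; apply: near_half_uhp.
  apply: clim_horner; have two : (2 : R[i]) = 1 - -1 by ring.
  rewrite two; apply: climV; first by rewrite -two pnatr_eq0.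
  by apply: climB (clim_cst _) clim_nome_near_half.
by rewrite -(clim_unique hs2 h3).
Qed.

(** Up to the factor 2^k, k = j + 1 even, the sum over half-integers is the sum over odd integers,
    that is (1 - 2^-k) Z. *)
Lemma zeta_half j Z : odd j -> zsum (fun n : int => (n%:~R : R[i]) ^- j.+1) Z ->
  lipC R j.+1 * (polylog R j).[2^-1] = (2 ^+ j.+1 - 1) * Z.
Proof.
move=> oj hZ; have j0 : (0 < j)%N by case: (j) oj.
have hV := zsum_half j0; set V := lipC _ _ * _ in hV *.
set k := j.+1 in hZ hV *.
have ek (x : R[i]) : (- x) ^- k = x ^- k.
  by rewrite exprNn -signr_odd /k /= oj expr0 mul1r.
have z0 : 0 ^- k = 0 :> R[i] by rewrite expr0n invr0.
pose odds (N : nat) : R[i] := \sum_(n < N) (2 * n + 1)%:R ^- k.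
pose all (N : nat) : R[i] := \sum_(n < N) n%:R ^- k.
have allE N : 2 * all N = \sum_(i < N) zfold (fun n : int => (n%:~R : R[i]) ^- k) i.
  rewrite /all mulr_sumr; apply: eq_bigr => -[[|i] ?] _ /=; first by rewrite z0 mulr0.
  by rewrite mulrNz ek -pmulrn; ring.
have h2 : 2 != 0 :> R[i] by rewrite pnatr_eq0.
have hall : clim all (Z / 2).
  rewrite mulrC; apply: clim_eq (climZ 2^-1 hZ) => n.
  by rewrite -allE mulKf.
have split N : all (2 * N)%N = odds N + 2 ^- k * all N.
  rewrite /all /odds; elim: N => [|N IH]; first by rewrite !big_ord0 mulr0 addr0.
  rewrite mulnS !addSn add0n !big_ord_recr /= IH addn1.
  rewrite [(2 * N)%:R]natrM exprMn invfM mulrDr; move: (_ ^- k) (_ ^- k) (_^-1 * _).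
  move=> a b c; rewrite !addrA.
  by ring.
have hodd : clim odds (Z / 2 - 2 ^- k * (Z / 2)).
  have := climB (@clim_sub _ (fun N => (2 * N)%N) _ _ (fun n => @leq_pmull n 2 isT) hall)
    (climZ (2 ^- k) hall).
  by apply: clim_eq => N; rewrite split addrK.
have halves N : 2 ^- k * \sum_(i < N.+1) zfold (fun n : int => (2^-1 + n%:~R : R[i]) ^- k) i =
    2 * odds N + (2 * N + 1)%:R ^- k.
  have pos (n : nat) : 2 ^- k * (2^-1 + n%:R) ^- k = (2 * n + 1)%:R ^- k :> R[i].
    rewrite -invfM -exprMn natrD natrM; congr ((_ ^+ _)^-1); by field.
  have neg (n : nat) : 2 ^- k * (2^-1 - n.+1%:R) ^- k = (2 * n + 1)%:R ^- k :> R[i].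
    rewrite -invfM -exprMn natrD natrM -ek; congr ((_ ^+ _)^-1); rewrite -natr1; by field.
  elim: N => [|N IH].
    by rewrite big_ord1 /odds big_ord0 mulr0 add0r /= pos.
  rewrite big_ord_recr mulrDr IH [zfold _ _]/= mulrNz -!pmulrn mulrDr pos neg.
  by rewrite /odds big_ord_recr /=; ring.
have hend : clim (fun N => (2 * N + 1)%:R ^- k : R[i]) 0.
  have E0 : 0 ^+ k = 0 :> R[i] by rewrite expr0n.
  have := climX k (@clim_inv_nat R); rewrite E0.
  by apply: clim_eq => n; rewrite exprVn mul2n addn1.
have := climZ (2 ^- k) (@clim_sub _ S _ _ (fun n => leqnSn n) hV).
have h3 := climD (climZ 2 hodd) hend.
move=> /clim_unique /(_ (clim_eq (fun n => esym (halves n)) h3)) E.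
have k2 : 2 ^+ k != 0 :> R[i] by rewrite expf_neq0.
apply: (mulfI (invr_neq0 k2)); rewrite E addr0.
move: (2 ^+ k) k2 => x x0; field.
by rewrite x0.
Qed.

End Zeta.

(** * Formal power series *)

(** A separate name keeps the Cauchy product apart from pointwise operations on functions. *)
Definition ps (K : Type) := nat -> K.

HB.instance Definition _ (K : choiceType) := Choice.copy (ps K) (nat -> K).

Section PsRing.
Variable K : comNzRingType.
Implicit Types a b c : ps K.

Definition ps_add a b : ps K := fun n => a n + b n.
Definition ps_opp a : ps K := fun n => - a n.
Definition ps_one : ps K := fun n => (n == 0%N)%:R.
Definition ps_mul a b : ps K := cprod a b.

Lemma ps_addA : associative ps_add.
Proof. by move=> a b c; apply: funext => n; apply: addrA. Qed.
Lemma ps_addC : commutative ps_add.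
Proof. by move=> a b; apply: funext => n; apply: addrC. Qed.
Lemma ps_add0 : left_id (fun=> 0) ps_add.
Proof. by move=> a; apply: funext => n; apply: add0r. Qed.
Lemma ps_addN : left_inverse (fun=> 0) ps_opp ps_add.
Proof. by move=> a; apply: funext => n; apply: addNr. Qed.

HB.instance Definition _ := GRing.isZmodule.Build (ps K) ps_addA ps_addC ps_add0 ps_addN.

Definition ps_trunc (N : nat) a : {poly K} := \poly_(i < N) a i.

Lemma coef_ps_trunc N a n : (n < N)%N -> (ps_trunc N a)`_n = a n.
Proof. by move=> h; rewrite coef_poly h. Qed.

(** A coefficient of a product sees only a truncation of the factors, so associativity and
    commutativity are inherited from polynomials. *)
Lemma cprod_coef N a b n : (n < N)%N -> cprod a b n = (ps_trunc N a * ps_trunc N b)`_n.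
Proof.
move=> h; rewrite coefM; apply: eq_bigr => i _.
rewrite !coef_ps_trunc //; first by apply: leq_ltn_trans (leq_subr _ _) h.
by apply: leq_trans h; apply: ltn_ord.
Qed.

Lemma ps_mulA : associative ps_mul.
Proof.
move=> a b c; apply: funext => n.
rewrite /ps_mul (cprod_coef _ _ (ltnSn n)) [RHS](cprod_coef _ _ (ltnSn n)).
transitivity (ps_trunc n.+1 a * (ps_trunc n.+1 b * ps_trunc n.+1 c))`_n.
  rewrite !coefM; apply: eq_bigr => i _; congr (_ * _).
  have lt : (n - i < n.+1)%N by rewrite ltnS leq_subr.
  by rewrite coef_ps_trunc // (cprod_coef _ _ lt).
rewrite mulrA !coefM; apply: eq_bigr => i _; congr (_ * _).
by rewrite coef_ps_trunc // (cprod_coef _ _ (ltn_ord i)).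
Qed.

Lemma ps_mulC : commutative ps_mul.
Proof.
move=> a b; apply: funext => n.
by rewrite /ps_mul (cprod_coef _ _ (ltnSn n)) mulrC -(cprod_coef _ _ (ltnSn n)).
Qed.

Lemma ps_mul1 : left_id ps_one ps_mul.
Proof.
move=> a; apply: funext => n; rewrite /ps_mul /cprod big_ord_recl /ps_one /= mul1r subn0.
by rewrite big1 ?addr0 // => i _; rewrite mul0r.
Qed.

Lemma ps_mulDl : left_distributive ps_mul +%R.
Proof.
move=> a b c; apply: funext => n; rewrite /ps_mul /cprod.
rewrite -[RHS]/(cprod a c n + cprod b c n) -big_split.
by apply: eq_bigr => i _; apply: mulrDl.
Qed.

Lemma ps_1neq0 : ps_one != (0 : ps K).
Proof.
apply/eqP => /(congr1 (fun a : ps K => a 0%N)) /eqP.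
by rewrite /ps_one eqxx (_ : (0 : ps K) 0%N = 0) // oner_eq0.
Qed.

HB.instance Definition _ := GRing.Zmodule_isComNzRing.Build (ps K)
  ps_mulA ps_mulC ps_mul1 ps_mulDl ps_1neq0.

Lemma psDE a b n : (a + b) n = a n + b n. Proof. by []. Qed.
Lemma psNE a n : (- a) n = - a n. Proof. by []. Qed.
Lemma psME a b : a * b = cprod a b. Proof. by []. Qed.
Lemma ps1E n : (1 : ps K) n = (n == 0%N)%:R. Proof. by []. Qed.
Lemma ps0E n : (0 : ps K) n = 0. Proof. by []. Qed.

Lemma ps_natE m n : (m%:R : ps K) n = if n is 0%N then m%:R else 0.
Proof.
elim: m => [|m IH]; first by rewrite !mulr0n; case: n.
rewrite mulrS psDE IH ps1E; case: n {IH} => [|n]; first by rewrite -mulrS.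
by rewrite addr0.
Qed.

Lemma ps_mul0E a b : (a * b) 0%N = a 0%N * b 0%N.
Proof. by rewrite psME /cprod big_ord1. Qed.

Lemma ps_mul1E a b : (a * b) 1%N = a 0%N * b 1%N + a 1%N * b 0%N.
Proof. by rewrite psME /cprod big_ord_recl big_ord1. Qed.

Lemma ps_exp0E a n : (a ^+ n) 0%N = a 0%N ^+ n.
Proof. by elim: n => [|n IH]; rewrite ?expr0 // !exprS ps_mul0E IH. Qed.

Definition psX : ps K := fun n => (n == 1%N)%:R.

Lemma psXnM (m : nat) a n : (psX ^+ m * a) n = if (m <= n)%N then a (n - m)%N else 0.
Proof.
elim: m a n => [|m IH] a n; first by rewrite expr0 mul1r subn0.
rewrite exprS -mulrA psME /cprod.
case: n => [|n]; first by rewrite big_ord1 /psX /= mul0r.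
rewrite big_ord_recl /psX /= mul0r add0r big_ord_recl /= mul1r ?subSS ?subn0. rewrite IH.
by rewrite big1 ?addr0 // => i _; rewrite mul0r.
Qed.

Definition ps_tail a : ps K := fun n => a n.+1.

Definition psC (x : K) : ps K := fun n => if n is 0%N then x else 0.

Lemma psCX x n : psC x ^+ n = psC (x ^+ n).
Proof.
elim: n => [|n IH]; first by apply: funext => -[].
rewrite !exprS IH psME; apply: funext => -[|i]; rewrite /cprod.
  by rewrite big_ord1.
by apply: big1 => -[[|j] ?] _ /=; rewrite ?mul0r // mulr0.
Qed.

Lemma ps_decomp a : a = psC (a 0%N) + psX ^+ 1 * ps_tail a.
Proof.
apply: funext => -[|n]; rewrite psDE psXnM /= ?addr0 //.
by rewrite add0r /ps_tail subn1.
Qed.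

End PsRing.

Definition map_ps (K L : Type) (f : K -> L) (a : ps K) : ps L := fun n => f (a n).

Section MapPs.
Variables (K L : comNzRingType) (f : {rmorphism K -> L}).

Lemma map_psM (a b : ps K) : map_ps f (a * b) = map_ps f a * map_ps f b.
Proof.
apply: funext => n; rewrite /map_ps !psME /cprod rmorph_sum.
by apply: eq_bigr => i _; rewrite rmorphM.
Qed.

Lemma map_ps1 : map_ps f 1 = 1.
Proof. by apply: funext => n; rewrite /map_ps !ps1E rmorph_nat. Qed.

Lemma map_psX (a : ps K) n : map_ps f (a ^+ n) = map_ps f a ^+ n.
Proof. by elim: n => [|n IH]; rewrite ?expr0 ?map_ps1 // !exprS map_psM IH. Qed.

End MapPs.

(** * The Frobenius map on power series modulo p *)

Section Frobenius.
Variables (p : nat) (p_prime : prime p).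

Lemma ps_pchar : p \in [pchar (ps 'F_p)].
Proof.
rewrite inE p_prime /=; apply/eqP/funext => n; rewrite ps_natE ps0E.
by case: n => [|n] //; apply: pchar_Fp_0.
Qed.

(** Write a = a(0) + q a'. The p-th power is additive and fixes a(0) by Fermat; the other part q^p
    a'^p reduces coefficient n to coefficient n - p. *)
Lemma ps_frobenius (a : ps 'F_p) n :
  (a ^+ p) n = if (p %| n)%N then a (n %/ p)%N else 0.
Proof.
have p0 := prime_gt0 p_prime.
elim/ltn_ind: n a => n IH a.
rewrite -(pFrobenius_autE ps_pchar) {1}(ps_decomp a) pFrobenius_autD_comm; last exact: mulrC.
rewrite !pFrobenius_autE expr1 exprMn psDE psCX psXnM.
have -> : a 0%N ^+ p = a 0%N by have := expf_card (a 0%N); rewrite card_Fp.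
case: n IH => [|n] IH.
  by rewrite dvdn0 div0n leqn0 (gtn_eqF p0) addr0.
rewrite add0r; case: leqP => [pn|np]; last by rewrite gtnNdvd.
rewrite IH; last by rewrite ltn_subrL p0.
have E : (n.+1 = (n.+1 - p) + p)%N by rewrite subnK.
by rewrite [in RHS]E dvdn_addl // divnDr // divnn p0 addn1.
Qed.

Lemma ps_frobenius_pow (a : ps 'F_p) b n :
  (a ^+ (p ^ b)) n = if (p ^ b %| n)%N then a (n %/ p ^ b)%N else 0.
Proof.
have p0 := prime_gt0 p_prime.
elim: b a n => [|b IH] a n; first by rewrite expn0 expr1 dvd1n divn1.
rewrite expnS mulnC exprM ps_frobenius mulnC.
have [/dvdnP[c ->]|pn] := boolP (p %| n)%N.
  by rewrite mulnK // IH [(p * _)%N]mulnC dvdn_pmul2r // divnMr.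
by case: ifP => // /(dvdn_trans (dvdn_mulr _ (dvdnn p))); rewrite (negbTE pn).
Qed.

End Frobenius.

(** * Bernoulli numbers *)

Section Bernoulli.
Implicit Types (n j : nat).

Lemma fact_neq0 n : n`!%:R != 0 :> rat.
Proof. by rewrite pnatr_eq0 -lt0n fact_gt0. Qed.

Lemma bin_ffactQ n i : (i <= n)%N -> 'C(n, i)%:R = n`!%:R / (i`!%:R * (n - i)`!%:R) :> rat.
Proof.
move=> le; apply: (mulIf (mulf_neq0 (fact_neq0 i) (fact_neq0 (n - i)))).
by rewrite divfK ?mulf_neq0 ?fact_neq0 // -!natrM bin_fact.
Qed.

Lemma fact_shuffle (A I D B : rat) : A / (I * D) * B = A * (B / I * D^-1).
Proof. by rewrite invfM; ring. Qed.

(** The series (e^t - 1) / t, whose inverse is [bern_ps]. *)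
Definition expm1_ps : ps rat := fun i => (i.+1`!%:R)^-1.
Definition exp_ps : ps rat := fun i => (i`!%:R)^-1.
Definition bern_ps : ps rat := fun n => bernoulli n / n`!%:R.

Lemma bern_psM : bern_ps * expm1_ps = 1.
Proof.
apply: funext => n; rewrite psME ps1E.
have u0 : (1`!%:R)^-1 != 0 :> rat by rewrite invr_eq0 fact_neq0.
rewrite -(@ps_invP (fun i => (i.+1`!%:R)^-1) n u0); apply: eq_bigr => i _.
congr (_ * _); rewrite /bern_ps /bernoulli mulrAC mulfV ?mul1r //; exact: fact_neq0.
Qed.

Definition scale2 (a : ps rat) : ps rat := fun n => 2 ^+ n * a n.

Lemma scale2M a b : scale2 (a * b) = scale2 a * scale2 b.
Proof.
apply: funext => n; rewrite /scale2 !psME /cprod mulr_sumr; apply: eq_bigr => i _.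
have {1}-> : (n = i + (n - i))%N by rewrite subnKC // -ltnS.
by rewrite exprD mulrACA.
Qed.

(** This is e^(2t) - 1 = (e^t - 1)(e^t + 1), divided by t. *)
Lemma expm1_ps_double : scale2 expm1_ps *+ 2 = expm1_ps * (exp_ps + 1).
Proof.
apply: funext => n.
have -> : (scale2 expm1_ps *+ 2) n = 2 ^+ n.+1 / n.+1`!%:R.
  by rewrite mulr2n psDE /scale2 /expm1_ps exprS; ring.
rewrite mulrDr mulr1 psDE psME /cprod.
apply: (mulfI (fact_neq0 n.+1)); rewrite mulrCA mulfV ?fact_neq0 // mulr1.
rewrite mulrDr /expm1_ps mulfV ?fact_neq0 // mulr_sumr.
have -> : 2 ^+ n.+1 = \sum_(i < n.+2) 'C(n.+1, i)%:R :> rat.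
  rewrite -[2]/(1 + 1) exprDn; apply: eq_bigr => i _.
  by rewrite !expr1n mulr1.
rewrite big_ord_recl bin0 addrC; congr (_ + _); apply: eq_bigr => i _.
rewrite lift0 bin_ffactQ // subSS /exp_ps invfM; ring.
Qed.

(** For B(t) = t / (e^t - 1) the doubling identity reads B(2t)(e^t + 1) = 2 B(t); compare
    coefficients. *)
Lemma bernoulli_double n :
  \sum_(i < n.+1) 'C(n, i)%:R * (2 ^+ i * bernoulli i) = (2 - 2 ^+ n) * bernoulli n.
Proof.
have E : scale2 bern_ps * (exp_ps + 1) = bern_ps *+ 2.
  have h1 : scale2 bern_ps * scale2 expm1_ps = 1.
    rewrite -scale2M bern_psM; apply: funext => m; rewrite /scale2 !ps1E.
    by case: m => [|m]; [rewrite expr0 mul1r | rewrite mulr0].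
  transitivity (scale2 bern_ps * (expm1_ps * (exp_ps + 1)) * bern_ps).
    by rewrite -[LHS]mulr1 -bern_psM; ring.
  by rewrite -expm1_ps_double mulrnAr h1 mulrnAl mul1r.
have := congr1 (fun f : ps rat => n`!%:R * f n) E.
rewrite mulrDr mulr1 psDE mulr2n psDE !mulrDr.
have Bn : n`!%:R * bern_ps n = bernoulli n by rewrite /bern_ps mulrC divfK ?fact_neq0.
rewrite Bn /scale2 [n`!%:R * (2 ^+ n * _)]mulrCA Bn.
have -> : n`!%:R * (scale2 bern_ps * exp_ps) n =
    \sum_(i < n.+1) 'C(n, i)%:R * (2 ^+ i * bernoulli i).
  rewrite psME /cprod mulr_sumr; apply: eq_bigr => i _.
  rewrite (bin_ffactQ (ltnSE (ltn_ord i))) /scale2 /bern_ps /exp_ps invfM; ring.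
by move=> E2; rewrite mulrBl; lra.
Qed.

Lemma bernoulli_rec n : (1 < n)%N -> \sum_(i < n) 'C(n, i)%:R * bernoulli i = 0.
Proof.
case: n => // n n0.
have := congr1 (fun f : ps rat => n.+1`!%:R * f n) bern_psM.
rewrite psME ps1E (gtn_eqF (n0 : (0 < n)%N)) mulr0 /cprod mulr_sumr => E.
rewrite -[RHS]E; apply: eq_bigr => i _; rewrite (bin_ffactQ (ltnW (ltn_ord i))).
rewrite /bern_ps /expm1_ps (subSn (ltnSE (ltn_ord i))); exact: fact_shuffle.
Qed.

Lemma bernoulliE n : (1 < n)%N ->
  bernoulli n.-1 = - (\sum_(i < n.-1) 'C(n, i)%:R * bernoulli i) / n%:R.
Proof.
case: n => // n n0; have := bernoulli_rec n0; rewrite big_ord_recr /= binSn.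
move=> /eqP; rewrite addrC addr_eq0 => /eqP <-.
by rewrite mulrAC mulfV ?mul1r // pnatr_eq0.
Qed.

Lemma bernoulli0 : bernoulli 0 = 1.
Proof. by rewrite /bernoulli /ps_inv /= fact0 !invr1 mulr1. Qed.

Lemma bernoulli_values :
  [/\ bernoulli 2 = 6^-1, bernoulli 4 = - 30^-1 & bernoulli 6 = 42^-1].
Proof.
have b0 := bernoulli0.
have b1 : bernoulli 1 = - 2^-1.
  rewrite (@bernoulliE 2 isT) (_ : \sum_(i < 1) _ = 0 + 1 * bernoulli 0).
    by rewrite b0; field.
  by move: bernoulli => f; rewrite !big_ord_recr big_ord0.
have b2 : bernoulli 2 = 6^-1.
  rewrite (@bernoulliE 3 isT) (_ : \sum_(i < 2) _ = 0 + 1 * bernoulli 0 + 3 * bernoulli 1).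
    by rewrite b0 b1; field.
  by move: bernoulli => f; rewrite !big_ord_recr big_ord0.
have b3 : bernoulli 3 = 0.
  rewrite (@bernoulliE 4 isT) (_ : \sum_(i < 3) _ = 0 + 1 * bernoulli 0 + 4 * bernoulli 1 + 6 * bernoulli 2).
    by rewrite b0 b1 b2; field.
  by move: bernoulli => f; rewrite !big_ord_recr big_ord0.
have b4 : bernoulli 4 = - 30^-1.
  rewrite (@bernoulliE 5 isT) (_ : \sum_(i < 4) _ = 0 + 1 * bernoulli 0 + 5 * bernoulli 1 + 10 * bernoulli 2 + 10 * bernoulli 3).
    by rewrite b0 b1 b2 b3; field.
  by move: bernoulli => f; rewrite !big_ord_recr big_ord0.
have b5 : bernoulli 5 = 0.
  rewrite (@bernoulliE 6 isT) (_ : \sum_(i < 5) _ = 0 + 1 * bernoulli 0 + 6 * bernoulli 1 + 15 * bernoulli 2 + 20 * bernoulli 3 + 15 * bernoulli 4).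
    by rewrite b0 b1 b2 b3 b4; field.
  by move: bernoulli => f; rewrite !big_ord_recr big_ord0.
have b6 : bernoulli 6 = 42^-1.
  rewrite (@bernoulliE 7 isT) (_ : \sum_(i < 6) _ = 0 + 1 * bernoulli 0 + 7 * bernoulli 1 + 21 * bernoulli 2 + 35 * bernoulli 3 + 35 * bernoulli 4 + 21 * bernoulli 5).
    by rewrite b0 b1 b2 b3 b4 b5; field.
  by move: bernoulli => f; rewrite !big_ord_recr big_ord0.
split; [exact: b2|exact: b4|exact: b6].
Qed.

Definition p_integral (p : nat) (x : rat) : Prop :=
  exists d a : int, ~~ (p %| d)%Z /\ d%:~R * x = a%:~R.

Lemma p_integral_int p (a : int) : prime p -> p_integral p a%:~R.
Proof.
move=> pp; exists 1, a; rewrite mul1r; split=> //.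
by rewrite dvdzE absz_nat (_ : `|1|%N = 1%N) // dvdn1 gtn_eqF // prime_gt1.
Qed.

Lemma ndvdzM p (a b : int) : prime p -> ~~ (p %| a)%Z -> ~~ (p %| b)%Z -> ~~ (p %| a * b)%Z.
Proof. by move=> pp; rewrite !dvdzE absz_nat abszM Euclid_dvdM // negb_or => -> ->. Qed.

Lemma p_integralD p x y : prime p -> p_integral p x -> p_integral p y -> p_integral p (x + y).
Proof.
move=> pp [d [a [hd ha]]] [e [b [he hb]]]; exists (d * e), (a * e + d * b).
split; first exact: ndvdzM.
by rewrite !rmorphD !rmorphM /= -ha -hb; ring.
Qed.

Lemma p_integralM p x y : prime p -> p_integral p x -> p_integral p y -> p_integral p (x * y).
Proof.
move=> pp [d [a [hd ha]]] [e [b [he hb]]]; exists (d * e), (a * b).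
split; first exact: ndvdzM.
by rewrite !rmorphM /= -ha -hb; ring.
Qed.

Lemma p_integral_sum p n (F : nat -> rat) : prime p ->
  (forall i, (i < n)%N -> p_integral p (F i)) -> p_integral p (\sum_(i < n) F i).
Proof.
move=> pp; elim: n => [|n IH] h.
  by rewrite big_ord0; apply: (@p_integral_int p 0).
rewrite big_ord_recr; apply: p_integralD => //; last exact: h.
by apply: IH => i hi; apply: h; apply: ltnW.
Qed.

(** The recursion for B_n, n > 0, divides only by n + 1, which is prime to p. *)
Lemma bernoulli_p_integral p n : prime p -> (n.+1 < p)%N -> p_integral p (bernoulli n).
Proof.
move=> pp; elim/ltn_ind: n => -[|n] IH np.
  by rewrite bernoulli0; apply: (@p_integral_int p 1).
rewrite (bernoulliE (n := n.+2)) // -mulN1r -mulrA; apply: p_integralM => //.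
  exact: (@p_integral_int p (-1)).
apply: p_integralM => //.
  apply: (@p_integral_sum p _ (fun i => 'C(n.+2, i)%:R * bernoulli i)) => // i hi.
  apply: p_integralM => //; first exact: (@p_integral_int p 'C(n.+2, i)).
  by apply: IH; lia.
exists n.+2, 1; split; last by rewrite mulfV // intr_eq0.
by rewrite dvdzE !absz_nat gtnNdvd.
Qed.

(* The case n = p - 1 of the von Staudt-Clausen theorem. *)
Lemma bernoulli_von_staudt p : prime p -> (2 < p)%N ->
  exists w d : int, ~~ (p %| w)%Z /\ d%:~R * (p%:R * bernoulli p.-1) = w%:~R.
Proof.
move=> pp p2; have p1 := prime_gt1 pp.
have pQ : p%:R != 0 :> rat by rewrite pnatr_eq0 -lt0n prime_gt0.
(* In p B_(p-1) = - sum_(i < p-1) C(p,i) B_i the term i = 0 gives -1, and p divides all the other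
   binomials. *)
have [y [d [a [hd ha]]] E] : exists2 y, p_integral p y & p%:R * bernoulli p.-1 = -1 - p%:R * y.
  exists (\sum_(i < p.-2) ('C(p, i.+1) %/ p)%:R * bernoulli i.+1).
    apply: (@p_integral_sum p _ (fun i => ('C(p, i.+1) %/ p)%:R * bernoulli i.+1)) => // i hi.
    apply: p_integralM => //; first exact: (@p_integral_int p ('C(p, i.+1) %/ p)%N).
    by apply: bernoulli_p_integral => //; lia.
  have -> : p%:R * bernoulli p.-1 = - \sum_(i < p.-1) 'C(p, i)%:R * bernoulli i.
    by rewrite bernoulliE // mulrC divfK.
  have -> : p.-1 = p.-2.+1 by lia.
  rewrite big_ord_recl bin0 bernoulli0 mulr1 opprD mulr_sumr; congr (_ - _).
  apply: eq_bigr => i _; rewrite lift0 mulrA -natrM mulnC divnK //.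
  by apply: prime_dvd_bin => //; case: i => i /= hi; lia.
exists (- (d + p%:Z * a)), d; split.
  by rewrite rpredN rpredDr ?dvdz_mulr.
by rewrite E mulrBr mulrN1 mulrCA ha rmorphN rmorphD rmorphM /= opprD.
Qed.

End Bernoulli.

(** * Constant terms and quasi-modularity in weight 2 *)

Section QuasiModular.
Variable R : realType.
Implicit Types (z w q : R[i]).

(** The Abel sum of (-1)^d d^j over d >= 0, that is [polylog j] at 1 / (1 - q) for q = -1. *)
Definition bern_half (j : nat) : rat := (1 - 2 ^+ j.+1) * bernoulli j.+1 / j.+1%:R.

(** The recursion [polylogS] at 1/2, obtained as the difference of [bernoulli_rec] and
    [bernoulli_double] with (i+1) C(j+1,i+1) = (j+1) C(j,i). *)
Lemma bern_half_rec j : (0 < j)%N ->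
  2 * bern_half j = - \sum_(i < j) 'C(j, i)%:R * bern_half i.
Proof.
move=> j0.
have h1 := bernoulli_double j.+1.
have h2 := bernoulli_rec (j0 : (1 < j.+1)%N).
have jn0 : j.+1%:R != 0 :> rat by rewrite pnatr_eq0.
have h3 : \sum_(i < j.+2) 'C(j.+1, i)%:R * ((1 - 2 ^+ i) * bernoulli i) =
    (2 ^+ j.+1 - 1) * bernoulli j.+1.
  rewrite (eq_bigr (fun i : 'I_j.+2 => 'C(j.+1, i)%:R * bernoulli i -
    'C(j.+1, i)%:R * (2 ^+ i * bernoulli i))); last by move=> i _; ring.
  rewrite sumrB h1 big_ord_recr /= h2 add0r binn mul1r; ring.
have h4 : \sum_(i < j.+1) 'C(j, i)%:R * bern_half i = - bern_half j.
  apply: (mulfI jn0); rewrite mulrN /bern_half [j.+1%:R * (_ / _)]mulrCA mulfV // mulr1.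
  rewrite -mulNr opprB -h3 [RHS]big_ord_recl (expr0 (2 : rat)) subrr mul0r mulr0 add0r mulr_sumr.
  apply: eq_bigr => i _; rewrite lift0 [LHS]mulrA -natrM (mul_bin_diag j.+1) natrM.
  have i0 : i.+1%:R != 0 :> rat by rewrite pnatr_eq0.
  by move: (i.+1%:R) i0 => x x0; field.
move: h4; rewrite big_ord_recr /= binn mul1r.
move: (bigop _ _ _) (bern_half j) => S B E; lra.
Qed.

Lemma polylog_half j : (polylog R j).[2^-1] = ratr (bern_half j).
Proof.
have two0 : 2 != 0 :> R[i] by rewrite pnatr_eq0.
elim/ltn_ind: j => -[|j] IH.
  rewrite polylog0 hornerX /bern_half.
  have -> : bernoulli 1 = - 2^-1.
    by rewrite (@bernoulliE 2 isT) big_ord1 bernoulli0 bin0 mul1r mulNr mul1r.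
  by rewrite divr1 expr1 (_ : (1 - 2) * - 2^-1 = 2^-1 :> rat) ?fmorphV ?ratr_nat //; field.
apply: (mulfI two0).
have -> : 2 * ratr (bern_half j.+1) = ratr (2 * bern_half j.+1) :> R[i].
  by rewrite [RHS]rmorphM /= ratr_nat.
rewrite bern_half_rec // rmorphN rmorph_sum polylogS hornerM hornerD hornerN hornerC hornerX horner_sum.
rewrite mulrA (_ : 2 * (2^-1 - 1) = -1); last by field.
rewrite mulN1r; congr (- _); apply: eq_bigr => i _.
by rewrite hornerZ IH // [RHS]rmorphM /= ratr_nat.
Qed.

(** The constant term of the Eisenstein series of weight j + 1 whose coefficient at q is 1. *)
Definition eis_const (j : nat) : rat := - (bernoulli j.+1 / (2 * j.+1%:R)).

Lemma zeta_value j Z : odd j -> zsum (fun n : int => (n%:~R : R[i]) ^- j.+1) Z ->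
  Z = 2 * lipC R j.+1 * ratr (eis_const j).
Proof.
move=> oj hZ; have := zeta_half oj hZ; rewrite polylog_half.
have k0 : 2 ^+ j.+1 - 1 != 0 :> R[i].
  rewrite subr_eq0 -natrX -[1]/(1%:R) eqr_nat; apply/eqP => E.
  by have := ltn_expl j.+1 (isT : (1 < 2)%N); rewrite E.
move=> E; apply: (mulfI k0); rewrite -E.
have -> : bern_half j = (2 ^+ j.+1 - 1) * (2 * eis_const j).
  have i0 : j.+1%:R != 0 :> rat by rewrite pnatr_eq0.
  by rewrite /bern_half /eis_const; move: (j.+1%:R) i0 => x x0; field.
by rewrite !rmorphM rmorphB rmorphXn /= !ratr_nat; ring.
Qed.

Lemma eisenstein_modular j z : odd j -> (3 <= j)%N -> 0 < complex.Im z ->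
  ratr (eis_const j) + psum (sigmaC R j) (nome (- z^-1)) =
  z ^+ j.+1 * (ratr (eis_const j) + psum (sigmaC R j) (nome z)).
Proof.
move=> oj j3 z0; have j0 : (0 < j)%N by case: (j) oj.
have [Z hZ] := zsum_lat_ex R j0.
have := eisenstein_inv oj j3 z0 hZ; rewrite {1 2}(zeta_value oj hZ).
have scale (x a b c y : R[i]) : x != 0 -> 2 * x * c + 2 * x * a = y * (2 * x * c + 2 * x * b) ->
   c + a = y * (c + b).
  move=> x0 h; have x2 : 2 * x != 0 by rewrite mulf_neq0 // pnatr_eq0.
  by apply: (mulfI x2); rewrite mulrDr h; ring.
exact: (scale _ _ _ _ _ (lipC_neq0 R j.+1)).
Qed.

(* In weight 2 the lattice sum is regularized by subtracting the telescoping
   term 1 / (w^2 - 1/4) from 1 / w^2: the difference is absolutely summable over the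
   lattice, and the term [12 z / tau] comes from the two iterated sums of
   [half_lat]. *)
Definition half_lat z (m n : int) : R[i] := ((m%:~R * z + n%:~R) ^+ 2 - 4^-1)^-1.

Lemma lattice_half_lower z : 0 < complex.Im z -> exists2 c : R, 0 < c &
  forall m n : int, [/\ c * (1 + `|m|%N%:R + `|n|%N%:R) <= cabs (m%:~R * z + n%:~R - 2^-1),
   c * (1 + `|m|%N%:R + `|n|%N%:R) <= cabs (m%:~R * z + n%:~R + 2^-1) &
   (m, n) != (0, 0) -> c * (1 + `|m|%N%:R + `|n|%N%:R) <= cabs (m%:~R * z + n%:~R)].
Proof.
move=> z0; have [c c0 hc] := lattice_lower z0.
exists (c / 4); first by rewrite divr_gt0.
move=> m n.
have m0 : 0 <= `|m|%N%:R :> R by []. have n0 : 0 <= `|n|%N%:R :> R by [].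
have nE : `|n%:~R| = `|n|%N%:R :> R by rewrite -intr_norm -abszE.
split.
- have := hc m (n%:~R - 2^-1); rewrite rmorphB /= -intC -halfC addrA; apply: le_trans.
  rewrite -mulrA ler_wpM2l ?(ltW c0) //.
  have := half_lower R (- n); rewrite abszN mulrNz -(normrN (2^-1 - _)) opprB; lra.
- have := hc m (n%:~R + 2^-1); rewrite rmorphD /= -intC -halfC addrA; apply: le_trans.
  rewrite -mulrA ler_wpM2l ?(ltW c0) //.
  have := half_lower R n; rewrite [2^-1 + _]addrC; lra.
- move=> mn; have := hc m n%:~R; rewrite -intC; apply: le_trans.
  rewrite -mulrA ler_wpM2l ?(ltW c0) // nE.
  have : 1 <= `|m|%N%:R + `|n|%N%:R :> R.
    rewrite -natrD ler1n; move: mn; rewrite xpair_eqE -!absz_eq0; lia.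
  lra.
Qed.

Lemma half_factor w : w ^+ 2 - 4^-1 = (w - 2^-1) * (w + 2^-1) :> R[i].
Proof. by field. Qed.

Lemma half_lat_split z m n : 0 < complex.Im z ->
  half_lat z m n = (m%:~R * z + n%:~R - 2^-1)^-1 - (m%:~R * z + n%:~R + 2^-1)^-1.
Proof.
move=> z0; have [c c0 hc] := lattice_half_lower z0; have [h1 h2 _] := hc m n.
have p0 : 0 < c * (1 + `|m|%N%:R + `|n|%N%:R).
  by rewrite mulr_gt0 // -addrA ltr_wpDr // addr_ge0.
have := lt_le_trans p0 h1; have := lt_le_trans p0 h2; rewrite !cabs_gt0 /half_lat half_factor.
have -> : m%:~R * z + n%:~R + 2^-1 = m%:~R * z + n%:~R - 2^-1 + 1 by field.
move: (_ - 2^-1) => x x2 x1.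
by field; rewrite x1 x2.
Qed.

Lemma half_lat_row_partial z m N : 0 < complex.Im z ->
  \sum_(i < N.+1) zfold (half_lat z m) i =
  (m%:~R * z - (N%:R + 2^-1))^-1 - (m%:~R * z + (N%:R + 2^-1))^-1.
Proof.
move=> z0; elim: N => [|N IH].
  by rewrite big_ord1 /= half_lat_split // addr0 add0r.
rewrite big_ord_recr /= IH !half_lat_split //.
rewrite mulrNz -!pmulrn -[N.+1%:R]natr1.
have -> : m%:~R * z + (N%:R + 1) - 2^-1 = m%:~R * z + (N%:R + 2^-1) by field.
have -> : m%:~R * z - (N%:R + 1) + 2^-1 = m%:~R * z - (N%:R + 2^-1) by field.
have -> : m%:~R * z - (N%:R + 1 + 2^-1) = m%:~R * z - (N%:R + 1) - 2^-1 by ring.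
have -> : m%:~R * z + (N%:R + 1 + 2^-1) = m%:~R * z + (N%:R + 1) + 2^-1 by ring.
ring.
Qed.

Lemma half_lat_row z m : 0 < complex.Im z -> zsum (half_lat z m) 0.
Proof.
move=> z0; have [c c0 hc] := lattice_half_lower z0.
apply: (@clim_shift _ 1); apply: (@clim_inv _ (2 / c)); exists 0%N => N _.
rewrite subr0 addn1 half_lat_row_partial //.
have cN : 0 < c * N.+1%:R by rewrite mulr_gt0.
have m0 : 0 <= `|m|%N%:R :> R by [].
have h1 : c * N.+1%:R <= cabs (m%:~R * z - (N%:R + 2^-1)).
  have [h _ _] := hc m (- N%:Z); rewrite opprD addrA -[N%:R]/(N%:Z%:~R) -mulrNz.
  apply: le_trans h; rewrite ler_wpM2l ?(ltW c0) // abszN absz_nat -nat1r; lra.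
have h2 : c * N.+1%:R <= cabs (m%:~R * z + (N%:R + 2^-1)).
  have [_ h _] := hc m N%:Z; rewrite addrA -[N%:R]/(N%:Z%:~R).
  apply: le_trans h; rewrite ler_wpM2l ?(ltW c0) // absz_nat -nat1r; lra.
apply: le_trans (cabsB _ _) _; rewrite !cabsV.
have -> : 2 / c / N.+1%:R = (c * N.+1%:R)^-1 + (c * N.+1%:R)^-1.
  by rewrite invfM; ring.
by apply: lerD; rewrite lef_pV2 ?posrE ?(lt_le_trans cN).
Qed.

(** The difference 1/w^2 - 1/(w^2 - 1/4) decays like |w|^-4, which brings the domination of weight 4
    back. *)
Lemma half_lat_bound z : 0 < complex.Im z -> exists2 C : R, 0 <= C &
  forall m n, cabs (lat 2 z m n - half_lat z m n) <= C * bz R `|m|%N * bz R `|n|%N.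
Proof.
move=> z0; have [c c0 hc] := lattice_half_lower z0.
have c4 : 0 <= c ^- 4 by rewrite invr_ge0 exprn_ge0 // ltW.
exists (c ^- 4 + 4); first by rewrite addr_ge0.
move=> m n; have [h1 h2 h3] := hc m n.
have m0 : 0 <= `|m|%N%:R :> R by []. have n0 : 0 <= `|n|%N%:R :> R by [].
set s : R := 1 + _ + _ in h1 h2 h3.
have s0 : 0 < s by rewrite /s; lra.
have bb : 0 <= bz R `|m| * bz R `|n| by rewrite mulr_ge0 ?bz_ge0.
rewrite -mulrA mulrDl.
have [[-> ->]|mn] := eqVneq (m, n) (0, 0).
  (* At the origin [lat] is 0 and [half_lat] is -4, whence the summand 4 of the constant. *)
  rewrite /lat /half_lat mul0r addr0 expr0n invr0 !sub0r invrN invrK opprK cabs_nat.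
  rewrite /bz expr1n invr1 !mulr1 addrC lerDl //.
have cs : 0 < c * s by rewrite mulr_gt0.
have x0 : m%:~R * z + n%:~R != 0 by rewrite -cabs_gt0 (lt_le_trans cs (h3 mn)).
have x1 : m%:~R * z + n%:~R - 2^-1 != 0 by rewrite -cabs_gt0 (lt_le_trans cs h1).
have x2 : m%:~R * z + n%:~R + 2^-1 != 0 by rewrite -cabs_gt0 (lt_le_trans cs h2).
have -> : lat 2 z m n - half_lat z m n = - (4^-1 / ((m%:~R * z + n%:~R) ^+ 2 *
    ((m%:~R * z + n%:~R - 2^-1) * (m%:~R * z + n%:~R + 2^-1)))).
  rewrite /lat /half_lat -half_factor.
  have := mulf_neq0 x1 x2; rewrite -half_factor.
  move: (_ + n%:~R) x0 => x x0 y0.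
  have -> : 4^-1 = x ^+ 2 - (x ^+ 2 - 4^-1) by ring.
  move: (x ^+ 2 - 4^-1) y0 => y y0; field.
  by rewrite x0 subKr y0.
rewrite cabsN cabsM !cabsV cabs_nat cabsM cabsX cabsM.
set X := cabs _ in h1 h2 h3 *.
apply: (@le_trans _ _ (c ^- 4 * (s ^+ 4)^-1)); last first.
  rewrite -[leLHS]addr0; apply: lerD; last by rewrite mulr_ge0.
  by rewrite ler_wpM2l // bz_mul_ge.
rewrite -[leRHS]invfM -[in leRHS]exprMn; apply: le_trans (_ : (c * s) ^- 4 <= _) => //.
have h4 : (c * s) ^+ 4 <= cabs (m%:~R * z + n%:~R) ^+ 2 * (cabs (m%:~R * z + n%:~R - 2^-1) * cabs (m%:~R * z + n%:~R + 2^-1)).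
  rewrite -[4%N]/(2 + 2)%N exprD [X in _ * X <= _]expr2.
  have cs' := ltW cs.
  apply: (ler_pM (exprn_ge0 2 cs') (mulr_ge0 cs' cs')).
    by apply: lerXn2r; rewrite ?nnegrE ?cabs_ge0 ?h3.
  by apply: ler_pM.
apply: (@le_trans _ _ (1 * (c * s) ^- 4)); last by rewrite mul1r.
apply: ler_pM; rewrite ?invr_ge0 ?mulr_ge0 ?exprn_ge0 ?cabs_ge0 //; first by rewrite invf_le1 ?ler1n.
rewrite lef_pV2 ?posrE ?exprn_gt0 //; exact: lt_le_trans (exprn_gt0 4 cs) h4.
Qed.

(** Each partial row telescopes to two simple fractions in m, with denominators proportional to w +
    m and w - m for w = (N + 1/2)(-1/z); [cot_expansion] at w sums them. *)
Lemma half_lat_col_partial z N : 0 < complex.Im z ->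
  zsum (fun m => \sum_(i < N.+1) zfold (half_lat z m) i)
    (- (2 * tau R / z) * ((1 - nome ((N%:R + 2^-1) * - z^-1))^-1 - 2^-1)).
Proof.
move=> z0; have zn := uhp_neq0 z0; have w0 := uhp_negV z0.
set w := (N%:R + 2^-1) * - z^-1.
have h0 : 0 < N%:R + 2^-1 :> R by rewrite ltr_wpDl ?invr_gt0.
have wu : 0 < complex.Im w.
  rewrite /w (natC R N) halfC -rmorphD /=; move: (- z^-1) w0 => [a b] /= b0; simpc.
  by rewrite mulr_gt0.
have h := cot_expansion wu.
have h2 := zsumZ (- (tau R / z)) (zsumD h (zsum_opp h)).
have -> : - (2 * tau R / z) * ((1 - nome w)^-1 - 2^-1) =
   - (tau R / z) * ((1 - nome w)^-1 - 2^-1 + ((1 - nome w)^-1 - 2^-1)) by ring.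
apply: zsum_eq h2 => m; rewrite half_lat_row_partial //.
have wn (n : int) : w + n%:~R != 0 := uhp_addz_neq0 n wu.
have t0 := tau_neq0 R.
have e1 : m%:~R * z - (N%:R + 2^-1) = z * (w + m%:~R) by rewrite /w; field.
have e2 : m%:~R * z + (N%:R + 2^-1) = - (z * (w + (- m)%:~R)) by rewrite /w mulrNz; field.
rewrite e1 e2; move: (tau R) (w + m%:~R) (w + (- m)%:~R) t0 (wn m) (wn (- m)) => t x y t0' x0 y0.
by field; rewrite t0' x0 y0 zn.
Qed.

Lemma clim_nome_ray z : 0 < complex.Im z ->
  clim (fun N => nome ((N%:R + 2^-1) * z)) 0.
Proof.
move=> z0; have p0 := pi_gt0 R.
have y0 : 0 < 2 * pi * complex.Im z by rewrite !mulr_gt0.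
apply: (@clim_inv _ (2 / (2 * pi * complex.Im z))); exists 0%N => N _.
rewrite subr0 cabs_nome.
have -> : complex.Im ((N%:R + 2^-1) * z) = (N%:R + 2^-1) * complex.Im z.
  by rewrite (natC R N) halfC -rmorphD /=; case: (z) => a b /=; simpc.
set s := 2 * pi * (_ * _).
have N0 : 0 <= N%:R :> R by [].
have sE : s = (N%:R + 2^-1) * (2 * pi * complex.Im z) by rewrite /s; ring.
have s0 : 0 < s by rewrite sE mulr_gt0 //; lra.
rewrite expRN; apply: (@le_trans _ _ s^-1).
  rewrite lef_pV2 ?posrE ?expR_gt0 //; apply: le_trans (expR_ge1Dx s); lra.
have N1 : 0 < N%:R + 2^-1 :> R by lra.
rewrite sE invfM [leRHS]mulrAC ler_wpM2r ?invr_ge0 ?(ltW y0) //.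
by rewrite ler_pdivlMr // ler_pdivrMl // -nat1r; lra.
Qed.

Definition E2 z : R[i] := 1 - 24 * psum (sigmaC R 1) (nome z).

(** Let G be the lattice series of weight 2, a multiple of [E2]. Rows of [half_lat] sum to 0, so the
    regularized sum by rows is G(z); by columns it is z^-2 G(-1/z) minus the column total of
    [half_lat]. That total is not 0 but -tau / z. *)
Lemma E2_quasi_modular z : 0 < complex.Im z ->
  E2 (- z^-1) = z ^+ 2 * E2 z + 12 * z / tau R.
Proof.
move=> z0; have zn := uhp_neq0 z0; have w0 := uhp_negV z0; have t0 := tau_neq0 R.
have [Z hZ] := zsum_lat_ex R (isT : (0 < 1)%N).
have [C C0 hC] := half_lat_bound z0.
pose d m n := lat 2 z m n - half_lat z m n.
pose dc n := csum (zfold (d^~ n)).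
have hdc n : zsum (d^~ n) (dc n).
  have [|m|s hs] := @zsum_ex _ (d^~ n) (C * bz R `|n|); first by rewrite mulr_ge0 ?bz_ge0.
    by apply: le_trans (hC m n) _; rewrite mulrAC.
  by rewrite /dc (csumP hs).
have hr m : zsum (d m) (rowsum 2 Z z m).
  have := zsumD (zsum_row m (isT : odd 1) z0 hZ) (zsumN (half_lat_row m z0)).
  by rewrite oppr0 addr0.
have [s hs1 hs2] := zsum_swap C0 hC hr hdc.
have hlc n : zsum ((lat 2 z)^~ n) (z ^- 2 * rowsum 2 Z (- z^-1) (- n)).
  apply: zsum_eq (zsumZ (z ^- 2) (zsum_row (- n) (isT : odd 1) w0 hZ)) => m.
  by rewrite [RHS]lat_swap.
have hc n : zsum ((half_lat z)^~ n) (z ^- 2 * rowsum 2 Z (- z^-1) (- n) - dc n).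
  by apply: zsum_eq (zsumD (hlc n) (zsumN (hdc n))) => m; rewrite /d; ring.
have hlr := zsumZ (z ^- 2) (zsum_opp (zsum_rows Z (isT : (0 < 1)%N) w0)).
have hC1 := zsumD hlr (zsumN hs2).
rewrite (zsum_unique hs1 (zsum_rows Z (isT : (0 < 1)%N) z0)) in hC1.
have hN N : \sum_(i < N.+1) zfold (fun n => z ^- 2 * rowsum 2 Z (- z^-1) (- n) - dc n) i =
    - (2 * tau R / z) * ((1 - nome ((N%:R + 2^-1) * - z^-1))^-1 - 2^-1).
  have hf i : has_sum (zfold (fun m => zfold (half_lat z m) i))
      (zfold (fun n => z ^- 2 * rowsum 2 Z (- z^-1) (- n) - dc n) i).
    by case: i => [|i]; [apply: hc | apply: zsumD; apply: hc].
  apply: zsum_unique (half_lat_col_partial N z0).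
  have := @has_sum_sum _ _ (index_enum 'I_N.+1) xpredT _ _ (fun i _ => hf (i : 'I_N.+1)).
  apply: has_sum_eq => -[|k] /=; first by [].
  by rewrite -big_split.
(* Along the ray the nome tends to 0, so the last factor tends to 1 - 1/2. *)
have hlim : clim (fun N => - (2 * tau R / z) * ((1 - nome ((N%:R + 2^-1) * - z^-1))^-1 - 2^-1))
    (- (2 * tau R / z) * ((1 - 0)^-1 - 2^-1)).
  apply: climZ; apply: climB (clim_cst _); apply: climV; first by rewrite subr0 oner_neq0.
  by apply: climB (clim_cst _) _; apply: clim_nome_ray.
have := clim_unique (@clim_sub _ S _ _ (fun n => leqnSn n) hC1)
   (clim_eq (fun N => esym (hN N)) hlim).
have eis1 : eis_const 1 = - 24^-1.
  by have [b2 _ _] := bernoulli_values; rewrite /eis_const b2; field.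
rewrite (zeta_value (isT : odd 1) hZ) eis1.
have -> : lipC R 2 = tau R ^+ 2 by rewrite /lipC sqrrN divr1.
have -> : ratr (- 24^-1) = - 24^-1 :> R[i] by rewrite rmorphN fmorphV /= ratr_nat.
rewrite /E2; move: (psum _ _) (psum _ _) (tau R) t0 => b a t t0 E.
have {}E : z ^- 2 * (2 * t ^+ 2 * - 24^-1 + 2 * t ^+ 2 * a) =
   2 * t ^+ 2 * - 24^-1 + 2 * t ^+ 2 * b - t / z.
  by move/eqP: E; rewrite subr_eq => /eqP ->; field.
have k0 : z ^- 2 * t ^+ 2 != 0 by rewrite mulf_neq0 ?invr_eq0 ?expf_neq0.
apply: (mulfI k0).
have -> : z ^- 2 * t ^+ 2 * (1 - 24 * a) =
  -12 * (z ^- 2 * (2 * t ^+ 2 * - 24^-1 + 2 * t ^+ 2 * a)) by field.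
rewrite E; field.
by rewrite t0 zn.
Qed.

End QuasiModular.

(** * The residue theorem in weight 2 *)

Section Calculus.
Variable R : realType.
Implicit Types (z w h d : R[i]) (f g : R[i] -> R[i]).

(* Complex differentiability with a quadratic error term: it holds
   for analytic functions and is stable under the usual rules. *)
Definition cder f z d := exists C e : R, [/\ 0 <= C, 0 < e &
  forall h, cabs h <= e -> cabs (f (z + h) - f z - h * d) <= C * cabs h ^+ 2].

Lemma cder_lip f z d : cder f z d -> exists K e : R, [/\ 0 <= K, 0 < e &
  forall h, cabs h <= e -> cabs (f (z + h) - f z) <= K * cabs h].
Proof.
move=> [C [e [C0 e0 hC]]]; exists (C * e + cabs d), e; split=> //.
  by rewrite addr_ge0 ?cabs_ge0 // mulr_ge0 // ltW.
move=> h he; have -> : f (z + h) - f z = (f (z + h) - f z - h * d) + h * d by ring.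
apply: le_trans (cabsD _ _) _; rewrite mulrDl cabsM [cabs h * _]mulrC lerD2r.
apply: le_trans (hC h he) _; rewrite -mulrA ler_wpM2l // expr2.
by rewrite ler_wpM2r ?cabs_ge0.
Qed.

Lemma cder_cst c z : cder (fun=> c) z 0.
Proof.
exists 0, 1; split=> // h _.
by rewrite mulr0 !subr0 subrr cabs0 mul0r.
Qed.

Lemma cder_id z : cder id z 1.
Proof.
exists 0, 1; split=> // h _.
by rewrite /= (_ : _ - _ - _ = 0) ?cabs0 ?mul0r //; ring.
Qed.

Lemma cderD f g z a b : cder f z a -> cder g z b -> cder (fun w => f w + g w) z (a + b).
Proof.
move=> [C [e [C0 e0 hC]]] [D [e' [D0 e'0 hD]]].
exists (C + D), (Num.min e e'); split; [exact: addr_ge0 | by rewrite lt_min e0|].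
move=> h; rewrite le_min => /andP[h1 h2].
have -> : f (z + h) + g (z + h) - (f z + g z) - h * (a + b) =
  (f (z + h) - f z - h * a) + (g (z + h) - g z - h * b) by ring.
by apply: le_trans (cabsD _ _) _; rewrite [leRHS]mulrDl lerD ?hC ?hD.
Qed.

Lemma cderM f g z a b : cder f z a -> cder g z b ->
  cder (fun w => f w * g w) z (a * g z + f z * b).
Proof.
move=> hf hg; have [K [e1 [K0 e10 hK]]] := cder_lip hf.
have [L [e2 [L0 e20 hL]]] := cder_lip hg.
move: hf hg => [C [e [C0 e0 hC]]] [D [e' [D0 e'0 hD]]].
exists (C * cabs (g z) + cabs (f z) * D + K * L), (Num.min (Num.min e1 e2) (Num.min e e')).
split; [by rewrite !addr_ge0 ?mulr_ge0 ?cabs_ge0| by rewrite !lt_min e10 e20 e0|].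
move=> h; rewrite !le_min => /andP[/andP[h1 h2] /andP[h3 h4]].
have -> : f (z + h) * g (z + h) - f z * g z - h * (a * g z + f z * b) =
  (f (z + h) - f z - h * a) * g z + f z * (g (z + h) - g z - h * b)
  + (f (z + h) - f z) * (g (z + h) - g z) by ring.
apply: le_trans (cabsD _ _) _; rewrite [leRHS]mulrDl; apply: lerD.
  apply: le_trans (cabsD _ _) _; rewrite [leRHS]mulrDl !cabsM; apply: lerD.
    by rewrite mulrAC ler_wpM2r ?cabs_ge0 ?hC.
  by rewrite -mulrA ler_wpM2l ?cabs_ge0 ?hD.
rewrite cabsM expr2 mulrACA; apply: ler_pM; rewrite ?cabs_ge0 ?hK ?hL //.
Qed.

Lemma cder_comp f g z a b : cder g z b -> cder f (g z) a ->
  cder (fun w => f (g w)) z (a * b).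
Proof.
move=> hg; have [L [e2 [L0 e20 hL]]] := cder_lip hg.
move: hg => [D [e' [D0 e'0 hD]]] [C [e [C0 e0 hC]]].
have L1 : 0 < L + 1 by rewrite ltr_wpDl.
exists (C * L ^+ 2 + cabs a * D), (Num.min e2 (Num.min e' (e / (L + 1)))).
split; first by rewrite addr_ge0 ?mulr_ge0 ?exprn_ge0 ?cabs_ge0.
  by rewrite !lt_min e20 e'0 divr_gt0.
move=> h; rewrite !le_min => /andP[h2 /andP[h1 h3]].
set k := g (z + h) - g z; have hk := hL h h2; rewrite -/k in hk.
have -> : f (g (z + h)) - f (g z) - h * (a * b) =
  (f (g z + k) - f (g z) - k * a) + a * (g (z + h) - g z - h * b).
  have -> : g z + k = g (z + h) by rewrite /k; ring.
  by rewrite /k; ring.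
have hke : cabs k <= e.
  apply: le_trans hk _; rewrite ler_pdivlMr // in h3; apply: le_trans h3.
  by rewrite mulrC ler_wpM2l ?cabs_ge0 // lerDl.
apply: le_trans (cabsD _ _) _; rewrite [leRHS]mulrDl; apply: lerD.
  apply: le_trans (hC _ hke) _; rewrite -mulrA ler_wpM2l // -exprMn.
  by apply: lerXn2r; rewrite ?nnegrE ?mulr_ge0 ?cabs_ge0.
by rewrite cabsM -mulrA ler_wpM2l ?cabs_ge0 ?hD.
Qed.

Lemma cder_eq f z a b : a = b -> cder f z a -> cder f z b.
Proof. by move=> ->. Qed.

Lemma cderN f z a : cder f z a -> cder (fun w => - f w) z (- a).
Proof.
move=> [C [e [C0 e0 hC]]]; exists C, e; split=> // h he.
have -> : - f (z + h) - - f z - h * - a = - (f (z + h) - f z - h * a) by ring.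
by rewrite cabsN hC.
Qed.

Lemma cderX f z a n : cder f z a -> cder (fun w => f w ^+ n.+1) z (n.+1%:R * a * f z ^+ n).
Proof.
move=> h; elim: n => [|n IH]; first by rewrite mul1r expr0 mulr1.
have := cderM h IH; apply: cder_eq.
by rewrite [in RHS]mulrS !exprS; ring.
Qed.

Lemma cder_neginv z : z != 0 -> cder (fun w => - w^-1) z (z ^- 2).
Proof.
move=> z0; have c0 : 0 < cabs z by rewrite cabs_gt0.
exists (2 / cabs z ^+ 3), (cabs z / 2); split; rewrite ?divr_ge0 ?exprn_ge0 ?(ltW c0) ?divr_gt0 //.
move=> h he.
have h1 : cabs z / 2 <= cabs (z + h).
  have := cabs_subr_ge z (- h); rewrite cabsN opprK; lra.
have zh : z + h != 0 by rewrite -cabs_gt0; lra.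
have -> : - (z + h)^-1 - - z^-1 - h * z ^- 2 = - (h ^+ 2 / (z ^+ 2 * (z + h))).
  by field; rewrite zh z0.
rewrite cabsN cabsM cabsV cabsM !cabsX mulrC; apply: ler_wpM2r; first by rewrite exprn_ge0 ?cabs_ge0.
have -> : 2 / cabs z ^+ 3 = (cabs z ^+ 2 * (cabs z / 2))^-1.
  by field; rewrite gt_eqF.
rewrite lef_pV2 ?posrE ?mulr_gt0 ?exprn_gt0 ?divr_gt0 ?cabs_gt0 //.
by rewrite ler_wpM2l ?exprn_ge0 ?cabs_ge0.
Qed.

Lemma cder_nome_lin c z : cder (fun w => nome (c * w)) z (tau R * c * nome (c * z)).
Proof.
set t := tau R * c; set B := cabs (nome (c * z)) * (3 * cabs t ^+ 2 * expR (cabs t)).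
exists B, 1; split=> //.
  by rewrite !mulr_ge0 ?exprn_ge0 ?cabs_ge0 ?expR_ge0.
move=> h h1; have -> : nome (c * (z + h)) - nome (c * z) - h * (t * nome (c * z)) =
    nome (c * z) * (cexp (t * h) - 1 - t * h).
  by rewrite mulrDr nomeD [nome (c * h)]nomeE mulrA -/t; ring.
rewrite cabsM /B -mulrA ler_wpM2l ?cabs_ge0 //.
apply: le_trans (cexp_bound _) _; rewrite cabsM exprMn [leRHS]mulrAC mulrA.
apply: ler_pM; rewrite ?mulr_ge0 ?exprn_ge0 ?cabs_ge0 ?expR_ge0 //.
by rewrite ler_expR ler_piMr ?cabs_ge0.
Qed.

(** Differentiation term by term: the error of q^n is at most n^2 |h|^2 |q|^n exp(2 pi n |h|) up to
    a constant. The radius [e] is chosen so that |q| exp(2 pi e) = r < 1, leaving the convergent sum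
    of n^2 |a n| r^n. *)
Lemma cder_psum (a : nat -> R[i]) z : conv a -> 0 < complex.Im z ->
  cder (fun w => psum a (nome w)) z (tau R * psum (fun n => n%:R * a n) (nome z)).
Proof.
move=> ca z0; set q := nome z; have q1 : cabs q < 1 := cabs_nome_lt1 z0.
have q0 : 0 < cabs q by rewrite cabs_gt0 nome_neq0.
set r := (1 + cabs q) / 2.
have r1 : r < 1 by rewrite /r; lra.
have r0 : 0 < r by rewrite /r; lra.
have rqp : 0 < r / cabs q by rewrite divr_gt0.
have rq : 1 < r / cabs q by rewrite ltr_pdivlMr // mul1r /r; lra.
have p0 := pi_gt0 R.
set e := ln (r / cabs q) / (2 * pi).
have e0 : 0 < e by rewrite divr_gt0 ?ln_gt0 ?mulr_gt0.
have [b0 [B hB]] := conv_rsummable (ltW r0) r1 (conv_der (conv_der ca)).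
have B0 : 0 <= B by have := hB 0%N; rewrite big_ord0.
set c : R := 3 * (2 * pi) ^+ 2.
have c0 : 0 <= c by rewrite mulr_ge0 ?exprn_ge0 ?mulr_ge0 ?(ltW p0).
exists (c * B), e; split=> //; first exact: mulr_ge0.
move=> h he.
have zh : 0 < complex.Im (z + h).
  suff : cabs (nome (z + h)) < 1.
    by rewrite cabs_nome -expR0 ltr_expR oppr_lt0 pmulr_rgt0 ?mulr_gt0.
  rewrite nomeD cabsM -/q cabs_nome; apply: le_lt_trans r1.
  rewrite mulrC -ler_pdivlMr // -[r / _]lnK ?posrE // ler_expR.
  apply: le_trans (_ : 2 * pi * cabs h <= _).
    rewrite -mulrN ler_wpM2l ?mulr_ge0 ?(ltW p0) //; apply: le_trans (cabs_Im h).
    by rewrite -normrN ler_norm.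
  by move: he; rewrite ler_pdivlMr ?mulr_gt0 // mulrC.
have h1 := psumP ca (cabs_nome_lt1 zh); have h2 := psumP ca q1.
have h3 := has_sumZ (h * tau R) (psumP (conv_der ca) q1).
have hs := has_sumB (has_sumB h1 h2) h3.
rewrite -/q [h * (tau R * _)]mulrA.
apply: (has_sum_bound (b := fun n => (c * cabs h ^+ 2) * (cabs (n%:R * (n%:R * a n)) * r ^+ n)) _ _ hs) => [n|n]; last first.
  rewrite -mulr_sumr [leRHS]mulrAC ler_wpM2l ?hB //.
  by rewrite mulr_ge0 ?exprn_ge0 ?cabs_ge0.
have -> : a n * nome (z + h) ^+ n - a n * q ^+ n - h * tau R * (n%:R * a n * q ^+ n) =
   a n * q ^+ n * (cexp (tau R * n%:R * h) - 1 - tau R * n%:R * h).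
  rewrite nomeD exprMn -/q -[nome h ^+ n]nome_nat nomeE mulrA; ring.
rewrite [leLHS]cabsM [cabs (a n * q ^+ n)]cabsM cabsX.
rewrite [cabs (n%:R * (n%:R * _))]cabsM [cabs (n%:R * a n)]cabsM !cabs_nat.
apply: le_trans (ler_wpM2l _ (cexp_bound _)) _; first by rewrite mulr_ge0 ?exprn_ge0 ?cabs_ge0.
rewrite [cabs (tau R * n%:R * h)]cabsM [cabs (tau R * _)]cabsM cabs_tau cabs_nat.
have h4 : cabs q ^+ n * expR (2 * pi * n%:R * cabs h) <= r ^+ n.
  have -> : 2 * pi * n%:R * cabs h = n%:R * (2 * pi * cabs h) by ring.
  have h5 : cabs q * expR (2 * pi * cabs h) <= r.
    rewrite mulrC -ler_pdivlMr // -[r / _]lnK ?posrE // ler_expR.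
    by move: he; rewrite ler_pdivlMr ?mulr_gt0 // mulrC.
  rewrite expRM_natl -exprMn; apply: lerXn2r; rewrite ?nnegrE ?(ltW r0) //.
  by rewrite mulr_ge0 ?cabs_ge0 ?expR_ge0.
set A := cabs (a n); have A0 : 0 <= A := cabs_ge0 _.
set X := expR _ in h4 *; set Y := cabs q ^+ n in h4 *.
have -> : A * Y * (3 * (2 * pi * n%:R * cabs h) ^+ 2 * X) =
  (c * cabs h ^+ 2) * (n%:R * (n%:R * A)) * (Y * X) by rewrite /c; ring.
rewrite [leRHS]mulrA ler_wpM2l // !mulr_ge0 ?exprn_ge0 ?cabs_ge0 ?(ltW p0) //.
Qed.

Lemma small_quadratic_derive (g : R -> R) (t K e : R) : 0 <= K -> 0 < e ->
  (forall h : R, `|h| <= e -> `|g (t + h) - g t| <= K * `|h| ^+ 2) -> is_derive t (1 : R) g 0.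
Proof.
move=> K0 e0 hg.
have lim : (h : R)^-1 *: (g (h *: (1 : R) + t) - g t) @[h --> (0 : R)^'] --> (0 : R).
  apply/cvgrPdist_le => eps eps0; near=> h.
  have h0 : h != 0 by near: h; exact: nbhs_dnbhs_neq.
  have he : `|h| <= Num.min e (eps / (K + 1)).
    near: h; apply: dnbhs0_le; rewrite lt_min e0 divr_gt0 // ltr_wpDl //.
  move: he; rewrite le_min => /andP[h1 h2].
  rewrite sub0r normrN /GRing.scale /= mulr1 addrC normrM normfV.
  have hp : 0 < `|h| by rewrite normr_gt0.
  rewrite mulrC ler_pdivrMr // addrC.
  rewrite [h + t]addrC; apply: le_trans (hg h h1) _.
  rewrite expr2 mulrA ler_wpM2r // mulrC.
  move: h2; rewrite ler_pdivlMr ?ltr_wpDl // => h2; apply: le_trans h2.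
  by rewrite ler_wpM2l // lerDl.
have dg : derivable g t 1 by apply/cvg_ex; exists 0.
by apply: DeriveDef => //; apply: cvg_lim.
Unshelve. all: by end_near.
Qed.

(** The half-plane is convex: on a segment the real mean value theorem applies to the real and
    imaginary parts separately. *)
Lemma uhp_const f : (forall z, 0 < complex.Im z -> cder f z 0) ->
  forall z w, 0 < complex.Im z -> 0 < complex.Im w -> f z = f w.
Proof.
move=> hf z w z0 w0.
pose path (t : R) := z + t%:C * (w - z).
have pu t : 0 <= t -> t <= 1 -> 0 < complex.Im (path t).
  move=> t0 t1; have -> : complex.Im (path t) = (1 - t) * complex.Im z + t * complex.Im w.
    by rewrite /path; case: (z) (w) => [a b] [c d] /=; ring.
  have [->|tn] := eqVneq t 0; first by rewrite subr0 mul1r mul0r addr0 z0.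
  have tp : 0 < t by rewrite lt_neqAle eq_sym tn.
  have h2 := mulr_gt0 tp w0.
  have h1 : 0 <= (1 - t) * complex.Im z by rewrite mulr_ge0 ?subr_ge0 ?(ltW z0).
  lra.
have key (p : R[i] -> R) : (forall x y, p (x - y) = p x - p y) -> (forall x, `|p x| <= cabs x) ->
    p (f z) = p (f w).
  move=> pB ple; pose g (t : R) := p (f (path t)).
  have gd (t : R) : t \in `[0, 1] -> is_derive t (1 : R) g 0.
    rewrite in_itv /= => /andP[t0 t1].
    have [C [e [C0 e0 hC]]] := hf _ (pu t t0 t1).
    set D := cabs (w - z) + 1; have D0 : 0 < D by rewrite /D ltr_wpDl ?cabs_ge0.
    apply: (@small_quadratic_derive g t (C * D ^+ 2) (e / D)).
    - by rewrite mulr_ge0 ?exprn_ge0 ?(ltW D0).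
    - by rewrite divr_gt0.
    move=> h he; rewrite /g -pB; apply: le_trans (ple _) _.
    have E : path (t + h) = path t + h%:C * (w - z).
      by rewrite /path rmorphD /=; ring.
    have hh : cabs (h%:C * (w - z)) <= `|h| * D.
      by rewrite cabsM cabsR ler_wpM2l // lerDl.
    have := hC (h%:C * (w - z)); rewrite mulr0 subr0 -E => /(_ _)/le_trans; apply.
      by apply: le_trans hh _; rewrite -ler_pdivlMr.
    rewrite -mulrA ler_wpM2l // [D ^+ 2 * _]mulrC -exprMn.
    by apply: lerXn2r; rewrite ?nnegrE ?cabs_ge0 ?mulr_ge0 ?(ltW D0).
  have gc : {within `[0, 1], continuous g}.
    by apply: derivable_within_continuous => t t01; case: (gd t t01).
  have gd' (t : R) : t \in `]0, 1[ -> is_derive t (1 : R) g 0.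
    by rewrite in_itv /= => /andP[/ltW t0 /ltW t1]; apply: gd; rewrite in_itv /= t0.
  have [t _] := MVT ltr01 gd' gc; rewrite mul0r /g /path => /eqP.
  by rewrite rmorph0 rmorph1 mul0r mul1r addr0 [z + _]addrC subrK subr_eq0 => /eqP.
have eR := key (fun x => complex.Re x) (fun x y => etrans (ReD _ _) (congr1 _ (ReN _))) (@cabs_Re R).
have eI := key (fun x => complex.Im x) (fun x y => etrans (ImD _ _) (congr1 _ (ImN _))) (@cabs_Im R).
by move: eR eI; case: (f z) (f w) => [a b] [c d] /= -> ->.
Qed.

End Calculus.

Section Residue.
Variable R : realType.
Implicit Types (z w : R[i]).

Lemma uhp_i : 0 < complex.Im ('i%C : R[i]).
Proof. exact: ltr01. Qed.

Lemma neginv_i : - 'i%C^-1 = 'i%C :> R[i].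
Proof.
have i0 : 'i%C != 0 :> R[i] := uhp_neq0 uhp_i.
by apply: (mulIf i0); rewrite mulNr mulVf // -expr2 sqr_i.
Qed.

Definition rho : R[i] := (- 2^-1) +i* (Num.sqrt 3 / 2).

Lemma uhp_rho : 0 < complex.Im rho.
Proof. by rewrite /= divr_gt0 // sqrtr_gt0. Qed.

Lemma neginv_rho : - rho^-1 = rho + 1.
Proof.
have r0 : rho != 0 := uhp_neq0 uhp_rho.
apply: (mulIf r0); rewrite mulNr mulVf //.
have s3 : Num.sqrt 3 * Num.sqrt 3 = 3 :> R by rewrite -expr2 sqr_sqrtr.
rewrite /rho; set s := Num.sqrt 3 in s3 *.
have s4 : s / 2 * (s / 2) = 3 / 4 by rewrite mulf_div s3; field.
move: (s / 2) s4 => t t4.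
by apply/eqP; rewrite eq_complex /=; apply/andP; split; apply/eqP; lra.
Qed.

(* The residue theorem for weight 2 without contour integration: the
   antiderivative [G] of [F = \sum_n c_n q^(n - K)] satisfies
   [G (-1/z) = G z], both sides having the same derivative and the same value at
   [i], while [G (z + 1) = G z + c_K]. Evaluate at a point with
   [-1/z = z + 1]. *)
Lemma weight2_constant_term (c : nat -> R[i]) (K : nat) : conv c ->
  (forall z, 0 < complex.Im z ->
     nome (- z^-1) ^- K * psum c (nome (- z^-1)) = z ^+ 2 * (nome z ^- K * psum c (nome z))) ->
  c K = 0.
Proof.
move=> cc hF; have t0 := tau_neq0 R.
pose F z := nome z ^- K * psum c (nome z).
(* Coefficients of the antiderivative. [e K] is 0, the inverse of 0 being 0; the primitive of the
   constant term is the linear term [c K * z] of [G]. *)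
pose e (n : nat) := c n / (tau R * (n%:R - K%:R)).
have ce : conv e.
  apply: conv_le (convZ (tau R)^-1 cc) => n.
  rewrite /e invfM mulrCA ![cabs ((tau R)^-1 * _)]cabsM ler_wpM2l ?cabs_ge0 //.
  rewrite cabsM ler_piMr ?cabs_ge0 // cabsV.
  have -> : n%:R - K%:R = (n%:Z - K%:Z)%:~R :> R[i] by rewrite rmorphB.
  rewrite cabs_int; have [->|nK] := eqVneq (n%:Z - K%:Z) 0; first by rewrite normr0 invr0.
  have h : 1 <= `|(n%:Z - K%:Z)%:~R| :> R by rewrite norm_intr_ge1 // intr_eq0.
  by rewrite invf_le1 // (lt_le_trans ltr01).
have psum_e q : cabs q < 1 -> tau R * psum (fun n => n%:R * e n) q =
    psum c q - c K * q ^+ K + tau R * K%:R * psum e q.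
  move=> q1; have h1 := has_sumZ (tau R) (psumP (conv_der ce) q1).
  apply: has_sum_unique h1 _.
  have h2 := @has_sum_fin R K.+1 (fun n => if n == K then c K * q ^+ K else 0) _.
  have -> : c K * q ^+ K = \sum_(i < K.+1) (if (i : nat) == K then c K * q ^+ K else 0).
    by rewrite -big_mkcond (big_pred1 ord_max).
  apply: has_sum_eq (has_sumD (has_sumB (psumP cc q1) (h2 _)) (has_sumZ (tau R * K%:R) (psumP ce q1))).
    move=> n /=; rewrite /e; case: eqP => [->|/eqP nK].
      by rewrite !subrr mulr0 invr0 !(mulr0, mul0r) addr0.
    have d0 : n%:R - K%:R != 0 :> R[i] by rewrite subr_eq0 eqr_nat.
    move: (n%:R) (K%:R) d0 => x y d0; field.
    by rewrite d0 t0.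
  by move=> i hi; rewrite gtn_eqF.
pose G z := c K * z + nome (- K%:R * z) * psum e (nome z).
have GD z : 0 < complex.Im z -> cder G z (F z).
  move=> z0; have q1 := cabs_nome_lt1 z0.
  have h1 := cderM (cder_cst (c K) z) (cder_id z).
  have h2 := cderM (cder_nome_lin (- K%:R) z) (cder_psum ce z0).
  apply: cder_eq (cderD h1 h2).
  rewrite psum_e // /F mulNr nomeN nome_nat.
  have qK : nome z ^+ K != 0 by rewrite expf_neq0 ?nome_neq0.
  by move: (psum c _) (psum e _) (nome z ^+ K) qK => a b x x0; rewrite mul0r mulr1; field.
have Dc := @uhp_const R (fun z => G (- z^-1) - G z) _.
have D0 z : 0 < complex.Im z -> G (- z^-1) - G z = 0.
  move=> z0; rewrite (Dc _ z 'i%C) ?uhp_i //; first by rewrite neginv_i subrr.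
  move=> w w0; have wn := uhp_neq0 w0.
  have h := cderD (cder_comp (cder_neginv wn) (GD _ (uhp_negV w0))) (cderN (GD _ w0)).
  apply: cder_eq h; have -> : F (- w^-1) = w ^+ 2 * F w by exact: hF.
  by move: (F w) => X; field.
have := D0 _ uhp_rho; rewrite neginv_rho /G.
have nr : nome (rho + 1) = nome rho by exact: (nomeDint 1).
have nK : nome (- K%:R * (rho + 1)) = nome (- K%:R * rho).
  rewrite mulrDr mulr1 -(nomeDint (- K%:Z) (- K%:R * rho)).
  by congr (nome (_ + _)); rewrite mulrNz.
by rewrite nr nK => E; rewrite -[RHS]E; ring.
Qed.

End Residue.

(** * The discriminant *)

Section LogDerivative.
Variable K : comNzRingType.
Implicit Types (a b x y : ps K).

Definition theta a : ps K := fun n => n%:R * a n.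

Lemma thetaM a b : theta (a * b) = theta a * b + a * theta b.
Proof.
apply: funext => n; rewrite psDE /theta !psME /cprod mulr_sumr -big_split.
apply: eq_bigr => i _ /=.
have {1}-> : (n = i + (n - i))%N by rewrite subnKC // -ltnS.
by rewrite natrD; ring.
Qed.

Lemma theta1 : theta 1 = 0.
Proof. by apply: funext => -[|n]; rewrite /theta ?mul0r // ps1E mulr0. Qed.

(** [x] is the logarithmic derivative theta a / a, stated without division. *)
Definition logder a x := theta a = a * x.

Lemma logder1 : logder 1 0.
Proof. by rewrite /logder theta1 mulr0. Qed.

Lemma logderM a b x y : logder a x -> logder b y -> logder (a * b) (x + y).
Proof. by rewrite /logder thetaM => -> ->; ring. Qed.

Lemma logderX a x n : logder a x -> logder (a ^+ n) (x *+ n).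
Proof.
move=> h; elim: n => [|n IH]; first exact: logder1.
by rewrite exprS mulrS; apply: logderM.
Qed.

Definition near1 (m : nat) a := a 0%N = 1 /\ forall n, (0 < n < m)%N -> a n = 0.

Lemma near1_mul m a b n : near1 m b -> (n < m)%N -> (a * b) n = a n.
Proof.
move=> [b0 bn] nm; rewrite psME /cprod big_ord_recr /= subnn b0 mulr1.
rewrite big1 ?add0r // => i _; rewrite bn ?mulr0 // subn_gt0 ltn_ord /=.
by apply: leq_ltn_trans (leq_subr _ _) nm.
Qed.

Lemma near1X m a n : (0 < m)%N -> near1 m a -> near1 m (a ^+ n).
Proof.
move=> m0 ha; elim: n => [|n IH].
  by split=> [|i /andP[i0 _]]; rewrite expr0 ps1E // gtn_eqF.
have E i : (i < m)%N -> (a ^+ n.+1) i = a i by move=> h; rewrite exprS (near1_mul _ IH).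
by split=> [|i /andP[i0 im]]; rewrite E //; [apply: (proj1 ha) | apply: (proj2 ha); rewrite i0].
Qed.

Section Limit.
Variables (g l : nat -> ps K).
Hypothesis g_near1 : forall i, near1 i.+1 (g i).
Hypothesis g_logder : forall i, logder (g i) (l i).

Definition eta_prod (N : nat) : ps K := \prod_(i < N) g i ^+ 24.

Lemma eta_prod_stable n N : (n <= N)%N -> eta_prod N n = eta_prod n n.
Proof.
elim: N => [|N IH]; first by rewrite leqn0 => /eqP->.
rewrite leq_eqVlt => /predU1P[-> //|]; rewrite ltnS => nN.
rewrite /eta_prod big_ord_recr /= (@near1_mul N.+1) ?ltnS //; first exact: IH.
by apply: near1X.
Qed.

(** The infinite product, read on the diagonal: the factors of index at least n are 1 + O(q^(n+1))
    and leave coefficient n alone. *)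
Definition eta_lim : ps K := fun n => eta_prod n n.

Lemma eta_lim0 : eta_lim 0%N = 1.
Proof. by rewrite /eta_lim /eta_prod big_ord0. Qed.

Lemma eta_lim_logder (s : ps K) :
  (forall n N, (n <= N)%N -> (\sum_(i < N) l i) n = s n) -> logder eta_lim (s *+ 24).
Proof.
move=> ls; have h N : logder (eta_prod N) ((\sum_(i < N) l i) *+ 24).
  elim: N => [|N IH]; first by rewrite /eta_prod !big_ord0 mul0rn; apply: logder1.
  by rewrite /eta_prod !big_ord_recr mulrnDl; apply: logderM IH _; apply: logderX.
apply: funext => n; have := congr1 (fun f : ps K => f n) (h n).
rewrite /theta => E; rewrite E !psME /cprod; apply: eq_bigr => i _.
rewrite /eta_lim -(eta_prod_stable (ltnSE (ltn_ord i))); congr (_ * _).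
have mE (a : ps K) m k : (a *+ m) k = a k *+ m.
  by elim: m => [|m IHm]; rewrite ?mulr0n // !mulrS psDE IHm.
by rewrite !mE ls // leq_subr.
Qed.

End Limit.

Lemma eta_lim_inv (g g' : nat -> ps K) : (forall i, near1 i.+1 (g i)) ->
  (forall i, near1 i.+1 (g' i)) -> (forall i, g i * g' i = 1) -> eta_lim g * eta_lim g' = 1.
Proof.
move=> hg hg' gg'; apply: funext => n.
have <- : (eta_prod g n * eta_prod g' n) n = (1 : ps K) n.
  rewrite /eta_prod -big_split /= big1 // => i _; by rewrite -exprMn gg' expr1n.
rewrite !psME /cprod; apply: eq_bigr => i _.
by rewrite /eta_lim (eta_prod_stable hg (ltnSE (ltn_ord i))) (eta_prod_stable hg' (leq_subr i n)).
Qed.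

End LogDerivative.

(** The series d q^d / (1 - q^d), d = i + 1: the logarithmic derivative of 1 / (1 - q^d). Its sum
    over d generates sigma_1. *)
Definition lambert_ps (i : nat) : ps int := fun n => if (0 < n)%N && (i.+1 %| n)%N then i.+1%:Z else 0.
Definition geo_ps (i : nat) : ps int := fun n => (i.+1 %| n)%:R.
Definition cyc_ps (i : nat) : ps int := 1 - psX int ^+ i.+1.

Lemma cyc_psM i (a : ps int) n :
  (cyc_ps i * a) n = a n - (if (i.+1 <= n)%N then a (n - i.+1)%N else 0).
Proof. by rewrite /cyc_ps mulrBl mul1r psDE psNE psXnM. Qed.

Lemma cyc_psE i n : cyc_ps i n = (n == 0%N)%:R - (n == i.+1)%:R.
Proof.
rewrite -[cyc_ps i]mulr1 cyc_psM ps1E; have [h|h] := leqP i.+1 n; rewrite ?ps1E.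
  by congr (_ - _%:R); congr nat_of_bool; lia.
by rewrite (ltn_eqF h).
Qed.

Lemma geo_cyc i : cyc_ps i * geo_ps i = 1.
Proof.
apply: funext => n; rewrite cyc_psM ps1E /geo_ps.
case: n => [|n]; first by rewrite dvdn0 ltn0 subr0.
have [h|h] := leqP i.+1 n.+1; last by rewrite gtnNdvd // subr0.
by rewrite dvdn_subl // subrr.
Qed.

Lemma geo_near1 i : near1 i.+1 (geo_ps i).
Proof.
split=> [|n /andP[n0 ni]]; first by rewrite /geo_ps dvdn0.
by rewrite /geo_ps gtnNdvd.
Qed.

Lemma cyc_near1 i : near1 i.+1 (cyc_ps i).
Proof.
split=> [|n /andP[n0 ni]]; rewrite cyc_psE ?subr0 //.
by rewrite gtn_eqF // ltn_eqF // subr0.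
Qed.

Lemma lambert_cyc i : theta (cyc_ps i) = - (cyc_ps i * lambert_ps i).
Proof.
apply: funext => n; rewrite psNE cyc_psM /theta.
rewrite cyc_psE /lambert_ps; case: n => [|n]; first by rewrite mul0r.
have [h|h] := leqP i.+1 n.+1.
  rewrite dvdn_subl // subn_gt0; have [->|ne] := eqVneq n.+1 i.+1.
    by rewrite ltnn dvdnn /= subr0 sub0r mulrN1 natz.
  have -> : (i.+1 < n.+1)%N by rewrite ltn_neqAle eq_sym ne.
  rewrite /=.
  by case: ifP => _; rewrite ?subrr ?subr0 ?mulr0 ?oppr0 ?subrr.
by rewrite gtnNdvd // (ltn_eqF h) andbF !subr0 mulr0 oppr0.
Qed.

Lemma cyc_logder i : logder (cyc_ps i) (- lambert_ps i).
Proof. by rewrite /logder mulrN lambert_cyc. Qed.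

Lemma geo_logder i : logder (geo_ps i) (lambert_ps i).
Proof.
have := congr1 (@theta int) (geo_cyc i); rewrite theta1 thetaM lambert_cyc => E.
rewrite /logder -[LHS]mul1r -(geo_cyc i) mulrAC.
have -> : cyc_ps i * theta (geo_ps i) = cyc_ps i * lambert_ps i * geo_ps i.
  by apply/eqP; rewrite -subr_eq0 -[X in _ == X]E; apply/eqP; ring.
by rewrite [cyc_ps i * _ * _]mulrAC geo_cyc mul1r mulrC.
Qed.

Lemma lambert_sigma n N : (n <= N)%N -> (\sum_(i < N) lambert_ps i) n = (sigma 1 n)%:Z.
Proof.
move=> nN; have E M : (\sum_(i < M) lambert_ps i) n = \sum_(i < M) lambert_ps i n.
  by elim: M => [|M IH]; rewrite ?big_ord0 // !big_ord_recr /= psDE IH.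
rewrite E (@sum_fin _ (fun i => lambert_ps i n) n N nN) => [|i hi]; last first.
  by rewrite /lambert_ps; case: n nN hi {E} => // n _ hi; rewrite gtnNdvd.
rewrite /sigma -natz natr_sum [RHS]big_mkcond; apply: eq_bigr => i _.
rewrite /lambert_ps; case: n nN E i => [|n] _ _ i; first by case: i.
by rewrite [(0 < _)%N && _]andTb expn1; case: ifP => //; rewrite natz.
Qed.

(** This is Delta / q and the next series is q / Delta. The latter is integral because it is a
    product of geometric series. *)
Definition delta_ps : ps int := eta_lim cyc_ps.
Definition delta_inv_ps : ps int := eta_lim geo_ps.

Definition sigma_ps : ps int := fun n => (sigma 1 n)%:Z.

Lemma delta_ps_logder : logder delta_ps ((- sigma_ps) *+ 24).
Proof.
apply: (@eta_lim_logder _ _ (fun i => - lambert_ps i)).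
- exact: cyc_near1.
- exact: cyc_logder.
by move=> n N nN; rewrite sumrN !psNE lambert_sigma.
Qed.

Lemma delta_inv_ps_logder : logder delta_inv_ps (sigma_ps *+ 24).
Proof.
apply: (@eta_lim_logder _ _ lambert_ps).
- exact: geo_near1.
- exact: geo_logder.
by move=> n N nN; rewrite lambert_sigma.
Qed.

Lemma delta_psV : delta_ps * delta_inv_ps = 1.
Proof. by apply: eta_lim_inv; [apply: cyc_near1|apply: geo_near1|apply: geo_cyc]. Qed.

Lemma delta_inv_ps0 : delta_inv_ps 0%N = 1.
Proof. exact: eta_lim0. Qed.

(** * Modular forms as q-expansions *)

Section ModularForms.
Variable R : realType.
Implicit Types (z : R[i]) (w : int) (a b : ps R[i]).

(** As s 0 = 0, the relation expresses n a_n by earlier coefficients. Once n exceeds B, a bound for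
    the sums of |s_i| r^i, the factor n absorbs the sum, and a bound for the first terms propagates.
    The products for Delta and 1 / Delta thus converge without being estimated. *)
Lemma conv_logder (a s : nat -> R[i]) : conv s -> s 0%N = 0 ->
  (forall n, n%:R * a n = cprod s a n) -> conv a.
Proof.
move=> cs s0 ha r r0 r1.
have [b0 [B hB]] := conv_rsummable (ltW r0) r1 cs.
have B0 : 0 <= B by have := hB 0%N; rewrite big_ord0.
set N := (Num.bound B).+1.
have NB : B <= N%:R.
  by apply: ltW; apply: lt_le_trans (archi_boundP B0) _; rewrite ler_nat.
pose C := \sum_(i < N) cabs (a i) * r ^+ i.
have term0 i : 0 <= cabs (a i) * r ^+ i by rewrite mulr_ge0 ?cabs_ge0 ?exprn_ge0 ?(ltW r0).
have C0 : 0 <= C by apply: sumr_ge0.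
exists C => // n; elim/ltn_ind: n => n IH.
have [nN|Nn] := ltnP n N.
  by rewrite /C (bigD1 (Ordinal nN)) //= lerDl sumr_ge0.
have n0 : 0 < n%:R :> R by rewrite ltr0n (leq_trans _ Nn).
rewrite -(ler_pM2l n0) mulrA.
have -> : n%:R * cabs (a n) = cabs (n%:R * a n) by rewrite cabsM cabs_nat.
rewrite ha; apply: (@le_trans _ _ (B * C)); last first.
  by rewrite ler_wpM2r //; apply: le_trans NB _; rewrite ler_nat.
apply: (@le_trans _ _ (\sum_(i < n.+1) (cabs (s i) * r ^+ i) * C)); last first.
  by rewrite -mulr_suml ler_wpM2r.
apply: le_trans (ler_wpM2r _ (cabs_sum _ _ _)) _; first by rewrite exprn_ge0 // ltW.
rewrite mulr_suml; apply: ler_sum => -[i i_lt] _ /=; rewrite cabsM.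
have -> : r ^+ n = r ^+ i * r ^+ (n - i) by rewrite -exprD subnKC // -ltnS.
rewrite mulrACA; case: i i_lt => [|i] i_lt; first by rewrite s0 cabs0 !mul0r.
by apply: ler_wpM2l => //; apply: IH; lia.
Qed.

Definition cps (a : ps int) : ps R[i] := map_ps (intr : int -> R[i]) a.

Lemma cpsM (a b : ps int) : cps (a * b) = cps a * cps b.
Proof. exact: map_psM. Qed.

Lemma cpsX (a : ps int) n : cps (a ^+ n) = cps a ^+ n.
Proof. exact: map_psX. Qed.

Definition qeval (e : nat) a z : R[i] := nome z ^- e * psum a (nome z).

(* Invariance under z -> z + 1 is built into the q-expansion. *)
Definition mform (w : int) (e : nat) a : Prop :=
  conv a /\ forall z, 0 < complex.Im z -> qeval e a (- z^-1) = z ^ w * qeval e a z.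

Lemma mformM (w1 : int) e1 a (w2 : int) e2 b : mform w1 e1 a -> mform w2 e2 b ->
  mform (w1 + w2) (e1 + e2) (a * b).
Proof.
move=> [ca ha] [cb hb]; split; first exact: conv_cprod.
move=> z z0; have zn := uhp_neq0 z0.
have E u : 0 < complex.Im u -> qeval (e1 + e2) (a * b) u = qeval e1 a u * qeval e2 b u.
  move=> u0; rewrite /qeval psME psumM ?cabs_nome_lt1 // exprD invfM.
  by move: (_ ^- _) (_ ^- _) (psum _ _) (psum _ _) => x1 x2 x3 x4; ring.
rewrite !E ?uhp_negV // ha // hb // expfzDr //.
by move: (z ^ _) (z ^ _) (qeval _ _ z) (qeval _ _ z) => x1 x2 x3 x4; ring.
Qed.

Lemma conv_ps1 : conv (1 : ps R[i]).
Proof.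
apply: (@conv_bounded _ _ 1) => // n; rewrite ps1E.
by case: eqP => _; rewrite ?cabs1 // cabs0.
Qed.

Lemma psum_ps1 q : psum (1 : ps R[i]) q = 1.
Proof.
apply: psumE.
have E : 1 = \sum_(i < 1) (1 : ps R[i]) i * q ^+ i by rewrite big_ord1 ps1E expr0 mulr1.
rewrite [X in has_sum _ X]E; apply: (@has_sum_fin _ 1 (fun i => (1 : ps R[i]) i * q ^+ i)) => -[|i] // _.
by rewrite ps1E mul0r.
Qed.

Lemma mform1 : mform 0 0 1.
Proof.
split; first exact: conv_ps1.
by move=> z _; rewrite /qeval !psum_ps1 expr0z mul1r !expr0.
Qed.

Lemma mformX w e a n : mform w e a -> mform (w *+ n) (e * n) (a ^+ n).
Proof.
move=> h; elim: n => [|n IH]; first by rewrite muln0; apply: mform1.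
by rewrite mulnS exprS mulrS; apply: mformM.
Qed.

Lemma mformZ w e a (c : R[i]) : mform w e a -> mform w e (fun n => c * a n).
Proof.
move=> [ca ha]; split; first exact: convZ.
move=> z z0; rewrite /qeval !psumZ ?cabs_nome_lt1 ?uhp_negV //.
have := ha z z0; rewrite /qeval; move: (psum _ _) (psum _ _) (_ ^- _) (_ ^- _) (z ^ w).
by move=> x1 x2 x3 x4 x5 E; rewrite mulrCA E; ring.
Qed.

Lemma mform_eq w e a b : a =1 b -> mform w e a -> mform w e b.
Proof. by move=> /funext ->. Qed.

Definition eis_ps (j : nat) : ps R[i] :=
  fun n => if n is 0%N then ratr (eis_const j) else sigmaC R j n.

Lemma eis_psE j : eis_ps j = (fun n => ratr (eis_const j) * (1 : ps R[i]) n + sigmaC R j n).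
Proof.
apply: funext => -[|n]; rewrite ps1E /=; last by rewrite mulr0 add0r.
by rewrite /sigmaC /sigma big_ord0 mulr1 addr0.
Qed.

Lemma conv_eis_ps j : conv (eis_ps j).
Proof.
by rewrite eis_psE; apply: convD (convZ _ conv_ps1) (@conv_sigma R j).
Qed.

Lemma psum_eis_ps j q : cabs q < 1 ->
  psum (eis_ps j) q = ratr (eis_const j) + psum (sigmaC R j) q.
Proof.
move=> q1; rewrite eis_psE psumD //.
- by rewrite psumZ ?psum_ps1 ?mulr1 //; apply: conv_ps1.
- exact: convZ conv_ps1.
- exact: conv_sigma.
Qed.

Lemma mform_eis j : odd j -> (3 <= j)%N -> mform j.+1 0 (eis_ps j).
Proof.
move=> oj j3; split; first exact: conv_eis_ps.
have E u : 0 < complex.Im u ->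
    qeval 0 (eis_ps j) u = ratr (eis_const j) + psum (sigmaC R j) (nome u).
  by move=> u0; rewrite /qeval expr0 invr1 mul1r psum_eis_ps ?cabs_nome_lt1.
move=> z z0; apply: etrans (E _ (uhp_negV z0)) _.
by rewrite [in RHS](E z z0); apply: eisenstein_modular.
Qed.

Lemma cps_logder (a x : ps int) : logder a x -> forall n, n%:R * cps a n = cprod (cps x) (cps a) n.
Proof.
move=> h n; have -> : cprod (cps x) (cps a) = cps x * cps a by [].
have <- : cps (theta a) = cps x * cps a by rewrite h cpsM mulrC.
by rewrite /cps /map_ps /theta rmorphM /= rmorph_nat.
Qed.

Lemma cps_sigma24 : cps (sigma_ps *+ 24) = (fun n => 24 * sigmaC R 1 n).
Proof.
have mE (a : ps int) m k : (a *+ m) k = a k *+ m.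
  by elim: m => [|m IHm]; rewrite ?mulr0n // !mulrS psDE IHm.
apply: funext => n; rewrite /cps /map_ps mE rmorphMn /=.
by rewrite [RHS]mulr_natl.
Qed.

Lemma cps_sigmaN24 : cps ((- sigma_ps) *+ 24) = (fun n => -24 * sigmaC R 1 n).
Proof.
rewrite mulNrn; apply: funext => n; have := congr1 (fun f => f n) cps_sigma24.
by rewrite /cps /map_ps psNE rmorphN mulNr => <-.
Qed.

Lemma sigmaC0 j : sigmaC R j 0%N = 0.
Proof. by rewrite /sigmaC /sigma big_ord0. Qed.

Lemma conv_delta : conv (cps delta_ps).
Proof.
apply: (conv_logder _ _ (cps_logder delta_ps_logder)).
  by rewrite cps_sigmaN24; apply: convZ; apply: conv_sigma.
by rewrite cps_sigmaN24 sigmaC0 mulr0.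
Qed.

Lemma conv_delta_inv : conv (cps delta_inv_ps).
Proof.
apply: (conv_logder _ _ (cps_logder delta_inv_ps_logder)).
  by rewrite cps_sigma24; apply: convZ; apply: conv_sigma.
by rewrite cps_sigma24 sigmaC0 mulr0.
Qed.

Lemma psum_delta_mul z : 0 < complex.Im z ->
  psum (cps delta_ps) (nome z) * psum (cps delta_inv_ps) (nome z) = 1.
Proof.
move=> z0; rewrite -psumM ?cabs_nome_lt1 //; [|exact: conv_delta|exact: conv_delta_inv].
rewrite -psME -cpsM delta_psV /cps map_ps1; exact: psum_ps1.
Qed.

Lemma cder_delta z : 0 < complex.Im z ->
  cder (fun u => nome (1 * u) * psum (cps delta_ps) (nome u)) z
    (tau R * E2 z * (nome (1 * z) * psum (cps delta_ps) (nome z))).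
Proof.
move=> z0; have q1 := cabs_nome_lt1 z0.
apply: cder_eq (cderM (cder_nome_lin 1 z) (cder_psum conv_delta z0)).
rewrite (psum_eq _ (cps_logder delta_ps_logder)) cps_sigmaN24 psumM ?psumZ //; last first.
- exact: conv_delta.
- exact: convZ (@conv_sigma R 1).
- exact: conv_sigma.
by rewrite /E2; ring.
Qed.

Lemma cder_delta_inv z : 0 < complex.Im z ->
  cder (fun u => nome (-1 * u) * psum (cps delta_inv_ps) (nome u)) z
    (- tau R * E2 z * (nome (-1 * z) * psum (cps delta_inv_ps) (nome z))).
Proof.
move=> z0; have q1 := cabs_nome_lt1 z0.
apply: cder_eq (cderM (cder_nome_lin (-1) z) (cder_psum conv_delta_inv z0)).
rewrite (psum_eq _ (cps_logder delta_inv_ps_logder)) cps_sigma24 psumM ?psumZ //; last first.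
- exact: conv_delta_inv.
- exact: convZ (@conv_sigma R 1).
- exact: conv_sigma.
by rewrite /E2; ring.
Qed.

(** With [V] = Delta and [W] = 1 / Delta, the function W(-1/z) V(z) z^12 is constant: in its
    logarithmic derivative the anomaly 12 z / tau of [E2] cancels the 12 / z coming from z^12. At
    the fixed point i it equals i^12 = 1. *)
Lemma mform_delta_inv : mform (-12) 1 (cps delta_inv_ps).
Proof.
split; first exact: conv_delta_inv.
pose W z := nome (-1 * z) * psum (cps delta_inv_ps) (nome z).
pose V z := nome (1 * z) * psum (cps delta_ps) (nome z).
have VW z : 0 < complex.Im z -> V z * W z = 1.
  move=> z0; rewrite /V /W mulrACA psum_delta_mul // mulr1 -nomeD.
  by rewrite -mulrDl subrr mul0r nome0.
have WE z : qeval 1 (cps delta_inv_ps) z = W z.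
  by rewrite /qeval /W expr1 mulN1r nomeN.
have const : forall z, 0 < complex.Im z -> W (- z^-1) * V z * z ^+ 12 = 1.
  have hc := @uhp_const R (fun z => W (- z^-1) * V z * z ^+ 12) _.
  move=> z z0; rewrite (hc _ z 'i%C) ?uhp_i //.
    rewrite neginv_i [W _ * _]mulrC VW ?uhp_i // mul1r.
    by rewrite -[12%N]/(2 * 6)%N exprM sqr_i -[6%N]/(2 * 3)%N exprM sqrrN expr1n expr1n.
  move=> w w0; have wn := uhp_neq0 w0; have w1 := uhp_negV w0.
  have h1 := cder_comp (cder_neginv wn) (cder_delta_inv w1).
  have h := cderM (cderM h1 (cder_delta w0)) (cderX 11 (cder_id w)).
  apply: cder_eq h; rewrite -/(W _) -/(V _) E2_quasi_modular //.
  have t0 := tau_neq0 R.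
  move: (W _) (V _) (E2 w) (tau R) t0 => x1 x2 x3 t t0; rewrite /=.
  by field; rewrite t0 wn.
move=> z z0; have zn := uhp_neq0 z0; have := const z z0.
rewrite !WE => E; have := VW z z0.
rewrite [z ^ _](_ : _ = z ^- 12) //; move: (W _) (W _) (V z) E => x y v E vw.
have z12 : z ^+ 12 != 0 by rewrite expf_neq0.
apply: (mulfI z12); rewrite mulrA mulfV // mul1r -[RHS]mul1r -E.
by rewrite -[LHS]mulr1 -vw; ring.
Qed.

Lemma slash_S k (f : R[i] -> R[i]) z : weight_invariant k f -> 0 < complex.Im z ->
  f (- z^-1) = z ^ k * f z.
Proof.
move=> hf z0.
pose g : 'M[int]_2 := \matrix_(i, j) (if i == j then 0 else if i == 0 then -1 else 1).
have dg : \det g = 1 by rewrite (expand_det_row _ 0) !big_ord_recl big_ord0 /cofactor !det_mx11 !mxE /=.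
have := hf g dg z z0; rewrite /mobius /automorphy_factor !mxE /=.
by rewrite mul1r addr0 mul0r add0r mulN1r.
Qed.

Lemma weakly_holomorphic_mform k (f : R[i] -> R[i]) : weakly_holomorphic k f ->
  exists2 N : nat, (forall n : int, n < - N%:Z -> fourier_coef f n = 0) &
    mform k N (fun j => fourier_coef f (j%:Z - N%:Z)).
Proof.
move=> [_ hw hex].
have : fourier_expansion f (fourier_coef f).
  by case: hex => a ha; apply: xgetPex; exists a.
move=> [N [hN hs]]; exists N => //; set a := fun j : nat => _.
have hs' z : 0 < complex.Im z -> has_sum (fun j => a j * nome z ^ (j%:Z - N%:Z)) (f z).
  move=> z0; apply/climP; have := hs z z0.
  by rewrite (_ : series _ = (fun n => \sum_(i < n) (a i * nome z ^ (i%:Z - N%:Z)))) //;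
     apply: funext => n; rewrite /series /= big_mkord.
have pw z (j : nat) : nome z ^ (j%:Z - N%:Z) = nome z ^- N * nome z ^+ j.
  by rewrite expfzDr ?nome_neq0 // -exprnN mulrC.
have ca : conv a.
  move=> r r0 r1.
  (* The point of the imaginary axis with |q| = r: every radius below 1 is reached, so convergence
     on the half-plane gives [conv]. *)
  pose z : R[i] := 0 +i* (- ln r / (2 * pi)).
  have p0 : 0 < 2 * pi :> R by rewrite mulr_gt0 ?pi_gt0.
  have z0 : 0 < complex.Im z by rewrite /= divr_gt0 // oppr_gt0 ln_lt0 // r0.
  have zr : cabs (nome z) = r.
    rewrite cabs_nome /= mulrC divfK ?gt_eqF // opprK lnK ?posrE //.
  have [B B0 hB] := has_sum_bounded_terms (hs' z z0).
  exists (B * r ^+ N); first by rewrite mulr_ge0 // exprn_ge0 // ltW.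
  move=> n; have := hB n; rewrite pw cabsM cabsM cabsV !cabsX zr.
  by rewrite mulrCA mulrC ler_pdivrMr ?exprn_gt0.
have fE z : 0 < complex.Im z -> f z = qeval N a z.
  move=> z0; have h := has_sumZ (nome z ^- N) (psumP ca (cabs_nome_lt1 z0)).
  by apply: has_sum_unique (hs' z z0) _; apply: has_sum_eq h => j; rewrite pw mulrCA.
split=> // z z0; rewrite -!fE ?uhp_negV //.
exact: slash_S.
Qed.

Lemma mform_weight2 a e : mform 2 e a -> a e = 0.
Proof. by move=> [ca ha]; apply: (weight2_constant_term ca) => z z0; apply: ha. Qed.

End ModularForms.

(** * Congruences *)

Section Integrality.
Variables (R : realType) (L : fieldExtType rat) (iota : {rmorphism L -> R[i]}).
Let O := ring_of_integers iota.

Lemma O_D x y : O x -> O y -> O (x + y).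
Proof.
by move=> [u hu <-] [v hv <-]; exists (u + v); [apply: integral_add | rewrite rmorphD].
Qed.

Lemma O_M x y : O x -> O y -> O (x * y).
Proof.
by move=> [u hu <-] [v hv <-]; exists (u * v); [apply: integral_mul | rewrite rmorphM].
Qed.

Lemma O_int (n : int) : O n%:~R.
Proof. by exists n%:~R; [apply: integral_id | rewrite rmorph_int]. Qed.

Variable p : nat.

Definition pO (x : R[i]) := exists2 w, O w & x = p%:R * w.

Lemma pO_D x y : pO x -> pO y -> pO (x + y).
Proof.
by move=> [u hu ->] [v hv ->]; exists (u + v); [apply: O_D | rewrite mulrDr].
Qed.

Lemma pO_M x y : O x -> pO y -> pO (x * y).
Proof. by move=> hx [v hv ->]; exists (x * v); [apply: O_M | rewrite mulrCA]. Qed.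

Lemma pO_N x : pO x -> pO (- x).
Proof. by move=> h; rewrite -mulN1r; apply: pO_M => //; apply: (O_int (-1)). Qed.

Lemma pO_0 : pO 0.
Proof. by exists 0; [apply: (O_int 0) | rewrite mulr0]. Qed.

Lemma pO_int (n : int) x : (p %| n)%Z -> O x -> pO (n%:~R * x).
Proof.
move=> /dvdzP[c ->] hx; exists (c%:~R * x); first by apply: O_M => //; apply: O_int.
by rewrite rmorphM /= mulrAC mulrC -[(p%:Z)%:~R]/(p%:R).
Qed.

Lemma pO_sum n (F : nat -> R[i]) : (forall i, (i < n)%N -> pO (F i)) -> pO (\sum_(i < n) F i).
Proof.
elim: n => [|n IH] h; first by rewrite big_ord0; apply: pO_0.
rewrite big_ord_recr; apply: pO_D; last exact: h.
by apply: IH => i hi; apply: h; apply: ltnW.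
Qed.

(** A Bezout relation between n and p over the integers suffices, whatever the factorization of p in
    L. *)
Lemma pO_cancel (n : int) x : prime p -> ~~ (p %| n)%Z -> O x -> pO (n%:~R * x) -> pO x.
Proof.
move=> pp pn hx h; have [u [v]] := Bezoutz n p.
have -> : gcdz n p = 1.
  apply/eqP; rewrite -/(coprimez n p) coprimezE absz_nat coprime_sym prime_coprime //.
move=> E; have -> : x = u%:~R * (n%:~R * x) + p%:R * (v%:~R * x).
  rewrite mulrA -intrM mulrA -[p%:R]/((p%:Z)%:~R) -intrM -mulrDl -intrD.
  by rewrite [p%:Z * v]mulrC E mul1r.
apply: pO_D; first by apply: pO_M => //; apply: O_int.
by exists (v%:~R * x) => //; apply: O_M => //; apply: O_int.
Qed.

End Integrality.

Section IntegralForms.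
Variable R : realType.

Definition E4_ps : ps int := fun n => if n is 0%N then 1 else 240 * (sigma 3 n)%:Z.
Definition E6_ps : ps int := fun n => if n is 0%N then 1 else -504 * (sigma 5 n)%:Z.

Lemma ratr_natV n : ratr (n%:R^-1 : rat) = n%:R^-1 :> R[i].
Proof. by rewrite fmorphV /= ratr_nat. Qed.

Lemma mform_E4 : mform 4 0 (cps R E4_ps).
Proof.
apply: mform_eq (mformZ 240 (@mform_eis R 3 isT isT)) => -[|n].
  rewrite /cps /map_ps /= /eis_const; have [_ -> _] := bernoulli_values.
  have -> : - (- 30^-1 / (2 * 4)) = 240^-1 :> rat by field.
  by rewrite ratr_natV; apply: mulfV; rewrite pnatr_eq0.
by rewrite /cps /map_ps /= rmorphM /= rmorph_nat.
Qed.

Lemma mform_E6 : mform 6 0 (cps R E6_ps).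
Proof.
apply: mform_eq (mformZ (-504) (@mform_eis R 5 isT isT)) => -[|n].
  rewrite /cps /map_ps /= /eis_const; have [_ _ ->] := bernoulli_values.
  have -> : - (42^-1 / (2 * 6)) = - 504^-1 :> rat by field.
  by rewrite rmorphN /= ratr_natV mulrNN; apply: mulfV; rewrite pnatr_eq0.
by rewrite /cps /map_ps /= rmorphM /= rmorphN rmorph_nat.
Qed.

(* An integral multiple of the Eisenstein series of weight p - 1 that reduces
   to a nonzero constant modulo p. *)
Lemma hasse_form p : prime p -> (5 <= p)%N -> exists (v : int) (T : ps int),
  [/\ ~~ (p %| v)%Z, mform p.-1 0 (cps R T), T 0%N = v &
      forall n, (0 < n)%N -> (p %| T n)%Z].
Proof.
move=> pp p5; have [v [d [pv E]]] := bernoulli_von_staudt pp (ltnW (ltnW p5)).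
(* Chosen so that c times the constant term -B_(p-1) / (2(p-1)) is d p B_(p-1) = v; its factor p
   divides all other coefficients. *)
pose c : int := - (2 * p.-1%:Z * d * p%:Z).
exists v, (fun n => if n is 0%N then v else c * (sigma p.-2 n)%:Z); split => //; last first.
  case=> // n _; apply/dvdzP; exists (- (2 * p.-1%:Z * d * (sigma p.-2 n.+1)%:Z)).
  by rewrite /c; ring.
have oj : odd p.-2.
  by case: (even_prime pp) => [E2|op]; [lia | rewrite -subn2 oddB ?op //; lia].
have j3 : (3 <= p.-2)%N by lia.
have := mformZ c%:~R (@mform_eis R _ oj j3).
rewrite (_ : p.-2.+1 = p.-1); last by lia.
apply: mform_eq => -[|n]; rewrite /cps /map_ps /eis_ps.
  rewrite -[c%:~R](ratr_int R[i]) -rmorphM -[RHS](ratr_int R[i]) -E; congr ratr.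
  have k0 : p.-1%:R != 0 :> rat by rewrite pnatr_eq0; lia.
  rewrite /eis_const (_ : p.-2.+1 = p.-1); last by lia.
  rewrite /c rmorphN !rmorphM /= -!pmulrn; move: (bernoulli _) (d%:~R) (p%:R) => x y t.
  move: (p.-1%:R) k0 => s s0; field.
  by rewrite s0.
by rewrite rmorphM.
Qed.

End IntegralForms.

Section Congruence.
Variables (p : nat) (p_prime : prime p).

Lemma Fp_int_eq0 (x : int) : (x%:~R == 0 :> 'F_p) = (p %| x)%Z.
Proof.
rewrite dvdzE absz_nat (dvdn_pcharf (pchar_Fp p_prime)).
by case: x => n //; rewrite NegzE mulrNz oppr_eq0.
Qed.

Definition red_ps (a : ps int) : ps 'F_p := map_ps intr a.

(** Modulo p, [T] is the constant v and raising [s] to the power p^b is the substitution of q^(p^b)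
    for q. *)
Lemma frobenius_product (T s : ps int) (v : int) (j b : nat) :
  T 0%N = v -> (forall n, (0 < n)%N -> (p %| T n)%Z) ->
  forall n, (p %| (T ^+ j * s ^+ (p ^ b)) n -
     v ^+ j * (if (p ^ b %| n)%N then s (n %/ p ^ b)%N else 0))%Z.
Proof.
move=> T0 Tn n; rewrite -Fp_int_eq0 rmorphB subr_eq0 /=.
have -> : ((T ^+ j * s ^+ (p ^ b)) n)%:~R = (red_ps T ^+ j * red_ps s ^+ (p ^ b)) n.
  by rewrite /red_ps -!map_psX -map_psM.
have -> : red_ps T = psC v%:~R.
  apply: funext => -[|i]; rewrite /red_ps /map_ps /=; first by rewrite T0.
  by apply/eqP; rewrite Fp_int_eq0 Tn.
have psCM (x : 'F_p) a i : (psC x * a) i = x * a i.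
  rewrite psME /cprod big_ord_recl subn0 big1 ?addr0 // => m _; by rewrite mul0r.
rewrite psCX psCM ps_frobenius_pow // rmorphM rmorphXn /=; apply/eqP; congr (_ * _).
by case: ifP.
Qed.

End Congruence.

Section KeyCongruence.
Variables (R : realType) (p : nat) (k : int) (L : fieldExtType rat).
Variables (iota : {rmorphism L -> R[i]}) (f : R[i] -> R[i]).
Hypotheses (p_prime : prime p) (p_ge5 : (5 <= p)%N) (f_wh : weakly_holomorphic k f).
Hypothesis f_int : forall n : int, ring_of_integers iota (fourier_coef f n).

(** The expansion of q^eps g for the g of the overview; the pole is recorded as the shift [eps] in
    [mform_test]. *)
Definition test_ps (al be : nat) (eps : bool) : ps int :=
  E4_ps ^+ al * E6_ps ^+ be * delta_inv_ps ^+ eps.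

Lemma test_ps0 al be eps : test_ps al be eps 0%N = 1.
Proof. by rewrite /test_ps !ps_mul0E !ps_exp0E delta_inv_ps0 !expr1n !mulr1. Qed.

Lemma mform_test al be (eps : bool) :
  mform (4 *+ al + 6 *+ be + (-12) *+ eps) eps (cps R (test_ps al be eps)).
Proof.
have := mformM (mformM (mformX al (mform_E4 R)) (mformX be (mform_E6 R)))
  (mformX eps (mform_delta_inv R)).
by rewrite !mul0n mul1n add0n /test_ps !cpsM !cpsX.
Qed.

(** Both cases at once: without the pole it says that p divides a(0), with the pole it links a(P) to
    a(0) through the constant term c of g, which is coefficient 1 of [test_ps]. *)
Lemma key_congruence (j al be b : nat) (eps : bool) :
  k + p.-1%:Z *+ j + (4 *+ al + 6 *+ be + (-12) *+ eps) *+ (p ^ b) = 2 ->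
  (forall n : int, n <= - (p ^ b)%:Z -> fourier_coef f n = 0) ->
  pO iota p (fourier_coef f ((eps * p ^ b)%N%:Z) +
     (eps%:Z * test_ps al be eps 1%N)%:~R * fourier_coef f 0).
Proof.
move=> hk hord; set P := (p ^ b)%N in hk hord *.
have P0 : (0 < P)%N by rewrite expn_gt0 prime_gt0.
have [N _ hf] := weakly_holomorphic_mform f_wh.
have [v [T [pv hT T0 Tn]]] := hasse_form R p_prime p_ge5.
set s := test_ps al be eps; pose G := T ^+ j * s ^+ P.
have hG := mformM hf (mformM (mformX j hT) (mformX P (mform_test al be eps))).
rewrite mul0n add0n addrA hk -!cpsX -cpsM -/s -/G in hG.
have := mform_weight2 hG; rewrite mulrC psME /cprod; set K := (N + eps * P)%N => hsum.
(* [F n] is the coefficient of f that meets coefficient n of [G] in the constant term; the pole of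
   g^P shifts the index by [eps * P]. *)
pose F (n : nat) := fourier_coef f ((eps * P)%N%:Z - n%:Z).
have {}hsum : \sum_(n < K.+1) (G n)%:~R * F n = 0.
  rewrite -[RHS]hsum; apply: eq_bigr => n _; congr (_ * fourier_coef f _).
  by rewrite -subzn ?(ltnSE (ltn_ord n)) // /K PoszD; ring.
have hcong := @frobenius_product p p_prime T s v j b T0 Tn.
pose t (n : nat) : int := if (P %| n)%N then s (n %/ P)%N else 0.
(* Modulo p only multiples of P matter. Those beyond [eps * P] meet coefficients of f of index at
   most -P, so only n = 0 and, if [eps] holds, n = P remain. *)
have Fz c : (eps < c)%N -> F (c * P)%N = 0.
  move=> ec; apply: hord.
  have : (eps * P + P <= c * P)%N by rewrite -mulSnr leq_mul2r ec orbT.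
  by lia.
have hmain : pO iota p ((v ^+ j)%:~R * \sum_(n < K.+1) (t n)%:~R * F n).
  have -> : (v ^+ j)%:~R * \sum_(n < K.+1) (t n)%:~R * F n =
      - \sum_(n < K.+1) (G n - v ^+ j * t n)%:~R * F n.
    apply/eqP; rewrite mulr_sumr -subr_eq0 opprK -big_split -[X in _ == X]hsum.
    apply/eqP/eq_bigr => n _; rewrite rmorphB rmorphM /=; ring.
  apply: pO_N; apply: (@pO_sum _ _ _ _ _ (fun n => (G n - v ^+ j * t n)%:~R * F n)) => n _.
  by apply: pO_int; [apply: hcong | apply: f_int].
have pvj : ~~ (p %| v ^+ j)%Z.
  by elim: (j) => [|i IH]; [rewrite expr0 dvdzE absz_nat dvdn1; lia | rewrite exprS ndvdzM].
have sumE : \sum_(n < K.+1) (t n)%:~R * F n =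
    fourier_coef f ((eps * P)%N%:Z) + (eps%:Z * s 1%N)%:~R * fourier_coef f 0.
  have tF n : (t n)%:~R * F n = (n == 0)%N%:R * fourier_coef f (eps * P)%N%:Z +
      (n == P)%N%:R * ((eps%:Z * s 1%N)%:~R * fourier_coef f 0).
    rewrite /t; case: ifP => [/dvdnP[c ->]|nP]; last first.
      rewrite mul0r; have /negPf-> : n != 0%N by apply: contraFneq nP => ->; apply: dvdn0.
      have /negPf-> : n != P by apply: contraFneq nP => ->; apply: dvdnn.
      by rewrite !mul0r addr0.
    rewrite mulnK // muln_eq0 (gtn_eqF P0) orbF.
    have -> : (c * P == P)%N = (c == 1)%N by rewrite -{2}[P]mul1n eqn_pmul2r.
    case: c => [|[|c]].
    - by rewrite /F mul0n subr0 /s test_ps0 mul0r addr0.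
    - rewrite /= mul0r add0r mul1r; case eps1: (eps).
        by rewrite /F eps1 !mul1n mul1r subrr.
      by rewrite Fz ?eps1 // !mul0r mulr0.
    - by rewrite Fz ?mulr0 ?mul0r ?addr0 //; case: (eps).
  under eq_bigr do rewrite tF; rewrite big_split /= -!mulr_suml.
  have delta m : (m <= K)%N -> \sum_(n < K.+1) (n == m :> nat)%:R = 1 :> R[i].
    move=> mK; rewrite (bigD1 (Ordinal (mK : m < K.+1)%N)) //= eqxx big1 ?addr0 // => n.
    by rewrite -val_eqE /= => /negPf->.
  rewrite delta // mul1r; congr (_ + _).
  case eps1: (eps); last by rewrite !mul0r mulr0.
  by rewrite delta ?mul1r // /K eps1 mul1n leq_addl.
rewrite -sumE; apply: pO_cancel pvj _ hmain => //.
by rewrite sumE; apply: O_D; [|apply: O_M; [apply: O_int|]]; apply: f_int.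
Qed.

End KeyCongruence.

Lemma ord_infty_vanish (R : realType) (f : R[i] -> R[i]) (p a : nat) (n : int) :
  (- (p%:R ^+ a)%:E < ord_infty f)%E -> n <= - (p ^ a)%:Z -> fourier_coef f n = 0.
Proof.
move=> h hn; apply/eqP; apply: contraTT h => nz; rewrite -leNgt.
apply: (le_trans (ereal_inf_lbound _)); first by exists n.
by rewrite -EFinN lee_fin -natrX -[(p ^ a)%:R]/((p ^ a)%:Z%:~R) -mulrNz ler_int.
Qed.

(* The constant term of the weight 2 form E_m E4^al E6^be / Delta, m = j + 1. *)
Lemma test_const (R : realType) (j al be : nat) : odd j -> (3 <= j)%N ->
  (j.+1 + 4 * al + 6 * be = 14)%N ->
  ratr (2 * j.+1%:R / bernoulli j.+1) = (test_ps al be true 1%N)%:~R :> R[i].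
Proof.
move=> oj j3 E; have h := mformM (mform_eis R oj j3) (mform_test R al be true).
have E2 : j.+1%:Z + (4 *+ al + 6 *+ be + (-12) *+ true) = 2 by lia.
rewrite E2 add0n in h; have := mform_weight2 h.
rewrite ps_mul1E /cps /map_ps test_ps0 /eis_ps /eis_const.
have -> : sigmaC R j 1%N = 1.
  by rewrite /sigmaC /sigma big_mkcond big_ord_recl big_ord0 /= exp1n.
rewrite mulr1 -(ratr_int R[i] (test_ps _ _ _ _)) -rmorphM -(rmorph1 (@ratr R[i])).
rewrite -rmorphD -(rmorph0 (@ratr R[i])) => /fmorph_inj.
have J0 : j.+1%:R != 0 :> rat by rewrite pnatr_eq0.
move: (bernoulli _) (_%:~R) (j.+1%:R) J0 => x s J J0 H; congr ratr.
(* The vanishing constant term reads 1 - (B_m / 2m) s = 0. It also shows that B_m is nonzero, so the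
   quotient in the statement is a genuine one. *)
have xs : x * s = 2 * J.
  move/eqP: H; rewrite mulNr addrC subr_eq0 => /eqP H.
  have -> : x * s = 2 * J * (x / (2 * J) * s) by field.
  by rewrite -H mulr1.
have x0 : x != 0 by apply: contra_eq_neq xs => ->; rewrite mul0r eq_sym mulf_neq0.
by rewrite -xs mulrAC divff // mul1r.
Qed.

(** Residue 0 modulo 4 uses E4 alone; residue 2 trades one 4 for a 6, which is possible from 6
    on. *)
Lemma even_4_6 (s : nat) : ~~ odd s -> s != 2%N -> exists al be : nat, s = (4 * al + 6 * be)%N.
Proof.
move=> os s2; have := divn_eq s 4; have := ltn_pmod s (isT : 0 < 4)%N.
case: (s %% 4)%N => [|[|[|[|//]]]] _ E; try lia.
  by exists (s %/ 4)%N, 0%N; lia.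
by exists (s %/ 4).-1, 1%N; lia.
Qed.

Lemma congr_modP (R : realType) (L : fieldExtType rat) (iota : {rmorphism L -> R[i]}) p x y :
  pO iota p (x - y) -> congr_mod (ring_of_integers iota) p x y.
Proof. by case=> w; exists w. Qed.

Theorem theorem2p5 (R : realType) (p : nat) (k : int)
    (L : fieldExtType rat) (iota : {rmorphism L -> R[i]}) (f : R[i] -> R[i])
    (p_prime : prime p) (p_ge5 : (5 <= p)%N)
    (k_even : (2 %| k)%Z)
    (f_wh : weakly_holomorphic k f)
    (f_int : forall n : int, ring_of_integers iota (fourier_coef f n)) :
  (forall a m : nat,
     m \in [:: 4; 6; 8; 10; 14]%N ->
     k - 2 <= (m%:Z - 2) * (p%:Z ^+ a) ->
     (- (p%:R ^+ a)%:E < ord_infty f)%E ->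
     (p%:Z - 1 %| k - m%:Z)%Z ->
     forall b : nat, (a <= b)%N ->
       congr_mod (ring_of_integers iota) p
         (fourier_coef f (p%:Z ^+ b))
         (- ratr (2 * m%:R / bernoulli m) * fourier_coef f 0))
  /\
  (k <= 2 ->
   forall r s t u : nat,
     (0 < t)%N -> (0 < u)%N ->
     2 - k = r%:Z * (p%:Z - 1) + s%:Z * p%:Z ^+ t ->
     s != 2%N ->
     (- (p%:R ^+ u)%:E < ord_infty f)%E ->
     (u <= t)%N ->
     forall v : nat, (u <= v <= t)%N ->
       congr_mod (ring_of_integers iota) p
         (fourier_coef f (p%:Z ^+ v)) (fourier_coef f 0) /\
       congr_mod (ring_of_integers iota) p (fourier_coef f 0) 0).
Proof.
have p0 : (0 < p)%N by apply: prime_gt0.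
have vanish u t n : (u <= t)%N -> (- (p%:R ^+ u)%:E < ord_infty f)%E ->
    n <= - (p ^ t)%:Z -> fourier_coef f n = 0.
  move=> ut hu hn; apply: ord_infty_vanish hu _; apply: (le_trans hn).
  by rewrite lerN2 lez_nat leq_pexp2l.
have XE e : p%:Z ^+ e = (p ^ e)%:Z by rewrite -[p%:Z]natz -natrX natz.
split=> [a m hm hk ho hdiv b ab | k2 r s t u t0 u0 E s2 ho ut v /andP[uv vt]].
  (* 14 - m is 10, 8, 6, 4 or 0; with 1 / Delta the form g then has weight 2 - m. *)
  have [al [be [om m3 abm]]] : exists al be : nat,
      [/\ odd m.-1, (3 <= m.-1)%N & (m.-1.+1 + 4 * al + 6 * be = 14)%N].
    move: hm; rewrite !inE => /or4P[/eqP->|/eqP->|/eqP->|/orP[]/eqP->].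
    - by exists 1%N, 1%N.
    - by exists 2%N, 0%N.
    - by exists 0%N, 1%N.
    - by exists 1%N, 0%N.
    - by exists 0%N, 0%N.
  have mE : m.-1.+1 = m by lia.
  have := test_const R om m3 abm; rewrite mE => ->.
  (* The power of E that brings the weight to 2. It is nonnegative since p^a <= p^b, and integral
     since p - 1 divides both p^b - 1 and k - m. *)
  have [j jE] : exists j : nat, (m%:Z - 2) * (p ^ b)%:Z - (k - 2) = j%:Z * (p%:Z - 1).
    have h0 : 0 <= (m%:Z - 2) * (p ^ b)%:Z - (k - 2).
      rewrite subr_ge0; apply: (le_trans hk); rewrite XE ler_wpM2l ?lez_nat ?leq_pexp2l //.
      by lia.
    have /dvdzP[q qE] : (p%:Z - 1 %| (m%:Z - 2) * (p ^ b)%:Z - (k - 2))%Z.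
      have -> : (m%:Z - 2) * (p ^ b)%:Z - (k - 2) =
          (m%:Z - 2) * (p%:Z ^+ b - 1) - (k - m%:Z) by rewrite XE; ring.
      by apply: rpredB => //; rewrite subrX1; apply/dvdz_mull/dvdz_mulr.
    case: q qE h0 => [q|q] -> h0; first by exists q.
    by exfalso; move: h0; rewrite NegzE; nia.
  apply: congr_modP; rewrite XE mulNr opprK.
  have := @key_congruence R p k L iota f p_prime p_ge5 f_wh f_int j al be b true.
  rewrite mul1n mul1r; apply; last by move=> n; apply: vanish ho.
  have -> : p.-1%:Z = p%:Z - 1 by lia.
  have -> : 4 *+ al + 6 *+ be + (-12) *+ true = 2 - m%:Z by lia.
  rewrite -[_ *+ j]mulr_natr -[_ *+ (p ^ b)]mulr_natr !natz [_ * j%:Z]mulrC -jE; ring.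
have op : odd p by case: (even_prime p_prime) => // p2; move: p_ge5; rewrite p2.
(* 2 - k and r (p - 1) are even while p^t is odd. *)
have os : ~~ odd s.
  apply/negP => os; have := oddX p t; rewrite op orbT => oP.
  have : odd (s * p ^ t) by rewrite oddM os oP.
  have /dvdzP[q kE] := k_even; move: E; rewrite XE kE -PoszM.
  have -> : r%:Z * (p%:Z - 1) = (r * p./2)%:Z * 2 by rewrite PoszM -[in LHS](odd_double_half p) op; lia.
  by move: (r * _)%N (s * _)%N => x y; lia.
have p1E : p.-1%:Z = p%:Z - 1 by lia.
(* Here P = p^t and g = E4^al E6^be of weight s has no pole, so a(0) is isolated. *)
have fc0 : pO iota p (fourier_coef f 0).
  have [al [be sE]] := even_4_6 os s2.
  have := @key_congruence R p k L iota f p_prime p_ge5 f_wh f_int r al be t false.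
  rewrite mul0n mul0r [_%:~R * _]mul0r !addr0; apply; last by move=> n; apply: vanish ho.
  have -> : 4 *+ al + 6 *+ be = s%:Z by lia.
  rewrite p1E -[_ *+ r]mulr_natr -[_ *+ (p ^ t)]mulr_natr !natz -XE; lia.
have fcv : pO iota p (fourier_coef f (p ^ v)%N).
  (* Now P = p^v and g has weight s p^(t-v), since s p^t = s p^(t-v) P. The 12 makes up for 1 /
     Delta and keeps the even number away from 2. *)
  have [al [be sE]] : exists al be : nat, (s * p ^ (t - v) + 12 = 4 * al + 6 * be)%N.
    by apply: even_4_6; [rewrite oddD oddM (negPf os) | lia].
  have := @key_congruence R p k L iota f p_prime p_ge5 f_wh f_int r al be v true.
  rewrite mul1n mul1r => h.
  (* The constant term of g is not computed: its multiple of a(0) is already known to vanish modulo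
     p. *)
  rewrite -[fourier_coef _ _](addrK ((test_ps al be true 1%N)%:~R * fourier_coef f 0)).
  apply: pO_D; last by apply/pO_N/pO_M => //; apply: O_int.
  apply: h; last by move=> n; apply: vanish ho.
  have -> : 4 *+ al + 6 *+ be + (-12) *+ true = (s * p ^ (t - v))%:Z by lia.
  rewrite p1E -[_ *+ r]mulr_natr -[_ *+ (p ^ v)]mulr_natr !natz -PoszM -mulnA -expnD subnK // PoszM -XE; lia.
split; apply: congr_modP; last by rewrite subr0.
by rewrite XE; apply: pO_D => //; apply: pO_N.
Qed.
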